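(* Let $T>0$, let $\varepsilon,\mu,\beta$ be positive constants, let $b\in C^2[0,1]$ and $\eta_b(x)=1-\beta b(x)$, and suppose there are positive constants $c_1,c_2$ such that for all $x\in[0,1]$ $$\eta_b(x)\ge c_1,\qquad \eta_b(x)-\tfrac{\mu}{2}\,\eta_b^2(x)\,\eta_b''(x)\ge c_2 .$$ Let $(\zeta,u)$ be a sufficiently smooth solution on $[0,1]\times[0,T]$, with $\varepsilon\zeta+\eta_b>0$, of the initial-boundary-value problem $$\zeta_t+\varepsilon(\zeta u)_x+(\eta_b u)_x=0,$$ $$\Bigl(\eta_b-\tfrac{\mu}{2}\eta_b^2\eta_b''\Bigr)u_t-\tfrac{\mu}{3}(\eta_b^3u_{tx})_x+\eta_b\zeta_x+\varepsilon\eta_b uu_x=0,$$ for $(x,t)\in[0,1]\times[0,T]$, with $\zeta(x,0)=\zeta_0(x)$, $u(x,0)=u_0(x)$ for $x\in[0,1]$ and $u(0,t)=u(1,t)=0$ for $t\in[0,T]$. Let $r\ge 2$ and $0\le k\le r-2$ be integers and let $S_h$, $S_{h,0}$ be the finite element spaces of piecewise polynomials of degree at most $r-1$ and smoothness $C^k$ on a quasiuniform family of partitions of $[0,1]$ with maximal mesh length $h$. Consider the semidiscrete problem: find $\zeta_h:[0,T]\to S_h$, $u_h:[0,T]\to S_{h,0}$ such that for $0\le t\le T$ $$(\zeta_{ht},\phi)+\varepsilon\bigl((\zeta_hu_h)_x,\phi\bigr)+\bigl((\eta_bu_h)_x,\phi\bigr)=0\quad\forall\phi\in S_h,$$ $$A(u_{ht},\chi)+(\eta_b\zeta_{hx},\chi)+\varepsilon(\eta_bu_hu_{hx},\chi)=0\quad\forall\chi\in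 S_{h,0},$$ $$\zeta_h(0)=\mathrm{P}\zeta_0,\qquad u_h(0)=\mathrm{R}_hu_0,$$ where $A(v,w)=\bigl((\eta_b-\tfrac{\mu}{2}\eta_b^2\eta_b'')v,w\bigr)+\tfrac{\mu}{3}(\eta_b^3v',w')$, $\mathrm{P}$ is the $L^2$ projection onto $S_h$, and $\mathrm{R}_h$ is the elliptic projection onto $S_{h,0}$ associated with $A$. Then there exist $h_0>0$ and a constant $C$ independent of $h$ such that, for every partition of the family with $h\le h_0$, the semidiscrete problem has a unique solution $(\zeta_h,u_h)$ for $0\le t\le T$, and it satisfies $$\max_{0\le t\le T}\bigl(\|\zeta(t)-\zeta_h(t)\|+\|u(t)-u_h(t)\|_1\bigr)\le C\,h^{r-1}.$$
   Context: Notation: $(\cdot,\cdot)$ and $\|\cdot\|$ are the inner product and norm of $L^2=L^2(0,1)$; $\|\cdot\|_1$ is the norm of the Sobolev space $H^1=H^1(0,1)$; $H_0^1$ is the subspace of $H^1$ of functions vanishing at $x=0$ and $x=1$. $\zeta(t)$ denotes $\zeta(\cdot,t)$, etc. Subscripts $t,x$ denote partial derivatives and primes denote $d/dx$. Finite element spaces: $0=x_1<x_2<\dots<x_{N+1}=1$ is a partition of $[0,1]$ with $h=\max_i(x_{i+1}-x_i)$; the family of partitions is quasiuniform, i.e. $h/\min_i(x_{i+1}-x_i)$ is bounded by a constant independent of the partition. $S_h=\{\phi\in C^k[0,1]:\ \phi|_{[x_i,x_{i+1}]}\in\mathbb{P}_{r-1}\ \text{for all } i\}$, where $\mathbb{P}_{r-1}$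 is the set of polynomials of degree at most $r-1$, and $S_{h,0}=\{\phi\in S_h:\ \phi(0)=\phi(1)=0\}$. Projections: $\mathrm{P}:L^2\to S_h$ is defined by $(\mathrm{P}v,\phi)=(v,\phi)$ for all $\phi\in S_h$. $\mathrm{R}_h:H_0^1\to S_{h,0}$ is defined by $A(\mathrm{R}_hv,\chi)=A(v,\chi)$ for all $\chi\in S_{h,0}$. The parameters $\varepsilon,\mu,\beta$ are fixed positive constants (the modelling regime is $\varepsilon=\mathcal{O}(\mu)$, $\mu\ll1$, $\beta=\mathcal{O}(1)$); the constant $C$ and the threshold $h_0$ may depend on them and on $T$, $b$, $c_1$, $c_2$, $r$, $k$, the quasiuniformity constant and the solution $(\zeta,u)$, but not on $h$. ''Sufficiently smooth'' means that $\zeta$ and $u$ possess on $[0,1]\times[0,T]$ as many continuous derivatives (a number depending only on $r$) as needed for the estimate. It is a standing assumption that the initial-boundary-value problem has a unique solution that is this smooth. *)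

(* Defs.v *)
From Stdlib Require Import Reals Lra List.
From Coquelicot Require Import Coquelicot.
Open Scope R_scope.

(* Functions on [a, b] are total functions on R whose values outside [a, b]
   are irrelevant: derivatives are taken relative to [a, b], hence one-sided
   at the end points. *)

Definition is_derive_on (a b : R) (f : R -> R) (x l : R) : Prop :=
  filterdiff f (within (fun y => a <= y <= b) (locally x)) (fun y => scal y l).

Definition ex_derive_on (a b : R) (f : R -> R) (x : R) : Prop :=
  exists l, is_derive_on a b f x l.

(* Unspecified (but real) where the derivative does not exist, like [RInt]. *)
Definition Derive_on (a b : R) (f : R -> R) (x : R) : R :=
  iota (is_derive_on a b f x).

Fixpoint Ck_on (k : nat) (a b : R) (f : R -> R) : Prop :=
  continuous_on (fun x => a <= x <= b) f /\
  match k with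
  | O => True
  | S k' => (forall x, a <= x <= b -> ex_derive_on a b f x) /\
            Ck_on k' a b (Derive_on a b f)
  end.

Lemma within_interval_proper (a b x : R) :
  a < b -> a <= x <= b ->
  ProperFilter (within (fun y => a <= y <= b) (locally x)).
Proof.
intros Hab Hx; split.
- intros P [e He].
  pose proof (cond_pos e) as He0.
  set (d := Rmin (e / 2) (b - a)).
  assert (Hd1 : d <= e / 2) by apply Rmin_l.
  assert (Hd2 : d <= b - a) by apply Rmin_r.
  assert (Hd : 0 < d) by (apply Rmin_glb_lt; lra).
  destruct (Rle_dec x (b - d / 2)) as [H|H].
  + exists (x + d / 2); apply He; [|lra].
    change (Rabs (x + d / 2 + - x) < e).
    rewrite Rabs_pos_eq; lra.
  + exists (x - d / 2); apply He; [|lra].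
    change (Rabs (x - d / 2 + - x) < e).
    rewrite Rabs_left1; lra.
- apply within_filter, locally_filter.
Qed.

Lemma is_derive_on_unique (a b : R) (f : R -> R) (x l : R) :
  a < b -> a <= x <= b -> is_derive_on a b f x l -> Derive_on a b f x = l.
Proof.
intros Hab Hx Hl.
assert (PF := within_interval_proper a b x Hab Hx).
assert (Hlim : is_filter_lim (within (fun y => a <= y <= b) (locally x)) x)
  by (intros P HP; apply filter_le_within, HP).
apply (iota_unique (V := R_CompleteNormedModule)); [|exact Hl].
intros l' Hl'.
destruct Hl as [_ Hl]; destruct Hl' as [_ Hl'].
specialize (Hl x Hlim); specialize (Hl' x Hlim).
apply cond_eq; intros e He.
assert (He4 : 0 < e / 4) by lra.
specialize (Hl (mkposreal _ He4)); specialize (Hl' (mkposreal _ He4)).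
simpl in Hl, Hl'.
assert (Hne : forall P : R -> Prop,
  within (fun y => a <= y <= b) (locally x) P -> exists y, y <> x /\ P y).
{ intros P [d HP].
  pose proof (cond_pos d) as Hd0.
  set (m := Rmin (d / 2) (b - a)).
  assert (Hm1 : m <= d / 2) by apply Rmin_l.
  assert (Hm2 : m <= b - a) by apply Rmin_r.
  assert (Hm : 0 < m) by (apply Rmin_glb_lt; lra).
  destruct (Rle_dec x (b - m / 2)) as [H|H].
  - exists (x + m / 2); split; [lra|]; apply HP; [|lra].
    change (Rabs (x + m / 2 + - x) < d).
    rewrite Rabs_pos_eq; lra.
  - exists (x - m / 2); split; [lra|]; apply HP; [|lra].
    change (Rabs (x - m / 2 + - x) < d).
    rewrite Rabs_left1; lra. }
destruct (Hne _ (filter_and _ _ Hl Hl')) as [y [Hyx [H1 H2]]].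
revert H1 H2; unfold norm, minus, plus, opp, scal, mult; simpl;
  unfold abs, mult; simpl; intros H1 H2.
assert (Hp : 0 < Rabs (y + - x)) by (apply Rabs_pos_lt; lra).
assert (H3 : Rabs (y + - x) * Rabs (l' - l) <= Rabs (y + - x) * (e / 2)).
{ rewrite <- Rabs_mult.
  replace ((y + - x) * (l' - l)) with
    ((f y + - f x + - ((y + - x) * l)) - (f y + - f x + - ((y + - x) * l')))
    by ring.
  eapply Rle_trans; [apply Rabs_triang|rewrite Rabs_Ropp; lra]. }
apply Rmult_le_reg_l in H3; lra.
Qed.

Definition rect (T : R) (p : R * R) : Prop :=
  0 <= fst p <= 1 /\ 0 <= snd p <= T.

Definition Dx (f : R -> R -> R) (x t : R) : R :=
  Derive_on 0 1 (fun y => f y t) x.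

Definition Dt (T : R) (f : R -> R -> R) (x t : R) : R :=
  Derive_on 0 T (fun s => f x s) t.

Fixpoint Cm_rect (m : nat) (T : R) (f : R -> R -> R) : Prop :=
  continuous_on (rect T) (fun p => f (fst p) (snd p)) /\
  match m with
  | O => True
  | S m' =>
      (forall x t, 0 <= x <= 1 -> 0 <= t <= T ->
         ex_derive_on 0 1 (fun y => f y t) x /\
         ex_derive_on 0 T (fun s => f x s) t) /\
      Cm_rect m' T (Dx f) /\ Cm_rect m' T (Dt T f)
  end.

(* All functions to which these are applied are piecewise continuous and
   bounded, so that Riemann integrals suffice; for continuous piecewise C^1
   functions the weak derivative is the derivative away from the nodes. *)

Definition inner (v w : R -> R) : R := RInt (fun x => v x * w x) 0 1.

Definition normL2 (v : R -> R) : R := sqrt (inner v v).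

Definition normH1 (v : R -> R) : R :=
  sqrt (inner v v + inner (Derive_on 0 1 v) (Derive_on 0 1 v)).

Definition eta_b (beta : R) (b : R -> R) (x : R) : R := 1 - beta * b x.

Definition mass_coef (mu beta : R) (b : R -> R) (x : R) : R :=
  eta_b beta b x
  - mu / 2 * (eta_b beta b x) ^ 2
    * Derive_on 0 1 (Derive_on 0 1 (eta_b beta b)) x.

Definition formA (mu beta : R) (b v w : R -> R) : R :=
  inner (fun x => mass_coef mu beta b x * v x) w
  + mu / 3 * inner (fun x => (eta_b beta b x) ^ 3 * Derive_on 0 1 v x)
                   (Derive_on 0 1 w).

Definition ibvp_solution (T eps mu beta : R) (b zeta0 u0 : R -> R)
    (zeta u : R -> R -> R) : Prop :=
  let eta := eta_b beta b in
  (forall x t, 0 <= x <= 1 -> 0 <= t <= T ->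
     Dt T zeta x t + eps * Dx (fun y s => zeta y s * u y s) x t
     + Dx (fun y s => eta y * u y s) x t = 0) /\
  (forall x t, 0 <= x <= 1 -> 0 <= t <= T ->
     mass_coef mu beta b x * Dt T u x t
     - mu / 3 * Dx (fun y s => (eta y) ^ 3 * Dx (Dt T u) y s) x t
     + eta x * Dx zeta x t + eps * (eta x * u x t * Dx u x t) = 0) /\
  (forall x, 0 <= x <= 1 -> zeta x 0 = zeta0 x /\ u x 0 = u0 x) /\
  (forall t, 0 <= t <= T -> u 0 t = 0 /\ u 1 t = 0).

Record partition := Partition {
  ncells : nat;
  node : nat -> R;
  node_first : node 0%nat = 0;
  node_last : node ncells = 1;
  node_incr : forall i, (i < ncells)%nat -> node i < node (S i)
}.

Definition cell (P : partition) (i : nat) : R := node P (S i) - node P i.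

Definition mesh (P : partition) : R :=
  fold_right Rmax 0 (map (cell P) (List.seq 0 (ncells P))).

(* h / min_i (x_{i+1} - x_i) <= q *)
Definition quasiuniform (q : R) (P : partition) : Prop :=
  forall i, (i < ncells P)%nat -> mesh P / cell P i <= q.

Definition poly_on (r : nat) (a b : R) (f : R -> R) : Prop :=
  exists c : nat -> R, forall x, a <= x <= b ->
    f x = sum_n (fun j => c j * x ^ j) (r - 1).

Definition Sh (r k : nat) (P : partition) (phi : R -> R) : Prop :=
  Ck_on k 0 1 phi /\
  forall i, (i < ncells P)%nat -> poly_on r (node P i) (node P (S i)) phi.

Definition Sh0 (r k : nat) (P : partition) (phi : R -> R) : Prop :=
  Sh r k P phi /\ phi 0 = 0 /\ phi 1 = 0.

(* w = P v, the L^2 projection of v *)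
Definition is_L2proj (r k : nat) (P : partition) (v w : R -> R) : Prop :=
  Sh r k P w /\ forall phi, Sh r k P phi -> inner w phi = inner v phi.

(* w = R_h v, the elliptic projection of v *)
Definition is_ellproj (mu beta : R) (b : R -> R) (r k : nat) (P : partition)
    (v w : R -> R) : Prop :=
  Sh0 r k P w /\
  forall chi, Sh0 r k P chi -> formA mu beta b w chi = formA mu beta b v chi.

(* As S_h is finite-dimensional, differentiability in t of an S_h-valued map
   is that of its point values. *)

Definition semidiscrete_solution (T eps mu beta : R) (b zeta0 u0 : R -> R)
    (r k : nat) (P : partition) (zh uh : R -> R -> R) : Prop :=
  let eta := eta_b beta b in
  (forall t, 0 <= t <= T ->
     Sh r k P (fun x => zh x t) /\ Sh0 r k P (fun x => uh x t)) /\
  (forall x t, 0 <= x <= 1 -> 0 <= t <= T ->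
     ex_derive_on 0 T (fun s => zh x s) t /\
     ex_derive_on 0 T (fun s => uh x s) t) /\
  (forall t, 0 <= t <= T -> forall phi, Sh r k P phi ->
     inner (fun x => Dt T zh x t) phi
     + eps * inner (fun x => Dx (fun y s => zh y s * uh y s) x t) phi
     + inner (fun x => Dx (fun y s => eta y * uh y s) x t) phi = 0) /\
  (forall t, 0 <= t <= T -> forall chi, Sh0 r k P chi ->
     formA mu beta b (fun x => Dt T uh x t) chi
     + inner (fun x => eta x * Dx zh x t) chi
     + eps * inner (fun x => eta x * uh x t * Dx uh x t) chi = 0) /\
  is_L2proj r k P zeta0 (fun x => zh x 0) /\
  is_ellproj mu beta b r k P u0 (fun x => uh x 0).

(* Main.v *)
From Stdlib Require Import Reals Lra Lia List Arith.
From Stdlib Require Import FunctionalExtensionality PropExtensionality ClassicalEpsilon.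
From Coquelicot Require Import Coquelicot.
Require Import Defs.
Open Scope R_scope.

(* Write theta = P zeta - zeta_h, xi = R_h u - u_h and test the error equations
   with theta and xi.  After integration by parts every term is bounded by the
   energy |theta|^2 + A(xi, xi) and by h^(2r-2), as long as u_h and its
   derivative stay bounded; the term with the projection error of zeta, for
   which |zeta - P zeta| <= C h^r, costs one inverse inequality.  Gronwall's
   lemma gives energy <= C h^(2r-2), while the inverse inequality bounds u_h
   and its derivative whenever the energy is at most h > C h^(2r-2): a
   continuity argument closes the loop.  The a priori bound also shows that
   the Galerkin ODE with its coefficients truncated, which is globally
   Lipschitz, has the same solution as the original one.  P and R_h enter
   through one orthonormal basis of S_h x S_{h,0} for the energy inner
   product, so that the energy is a sum of squares of coordinates. *)

(** * Finite sums and orthonormal bases *)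

(** The energy controls [theta] only in L^2 but [xi] in H^1, so a derivative of [theta] or [zeta_h]
    must be moved away or paid for. The product is split as [zeta u - zeta_h u_h = zeta (u - u_h) +
    (zeta - zeta_h) u_h]. In the second part the [theta] contribution turns into [u_h' theta^2 / 2],
    and the projection error meets [u_h theta']. So bounds are required on the smooth solution, the
    bottom, [u_h] and [u_h'], but not on [zeta_h]; the power lost to [theta'] gives the rate
    [h^(r-1)]. The bound on [u_h'] is obtained through [s - u_h], where [s] is a spline close to
    [u]. The inverse inequality tolerates an L^2 norm of order [h^(1/2)], hence the energy level
    [h]; as [2r - 2 >= 2], a factor [h] remains to absorb the exponential of Gronwall's lemma.
    Approximation is done once, for the smoothest splines [k = r - 2], which lie in every other
    [S_h]. In general these allow no cellwise interpolation, whence the steps rising over [2^d]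
    cells and the induction on the degree. *)

Fixpoint rsum (n : nat) (f : nat -> R) : R :=
  match n with O => 0 | S m => rsum m f + f m end.

Lemma rsum_ext (n : nat) (f g : nat -> R) :
  (forall i, (i < n)%nat -> f i = g i) -> rsum n f = rsum n g.
Proof.
induction n as [|n IH]; intros H; simpl; [reflexivity|].
rewrite IH by (intros; apply H; lia); rewrite H by lia; reflexivity.
Qed.

Lemma rsum_lin (n : nat) (a : R) (f g : nat -> R) :
  rsum n (fun i => f i + a * g i) = rsum n f + a * rsum n g.
Proof. induction n as [|n IH]; simpl; [ring|rewrite IH; ring]. Qed.

Lemma rsum_scal (n : nat) (a : R) (f : nat -> R) :
  rsum n (fun i => a * f i) = a * rsum n f.
Proof. induction n as [|n IH]; simpl; [ring|rewrite IH; ring]. Qed.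

Lemma rsum_le (n : nat) (f g : nat -> R) :
  (forall i, (i < n)%nat -> f i <= g i) -> rsum n f <= rsum n g.
Proof.
induction n as [|n IH]; intros H; simpl; [lra|].
apply Rplus_le_compat; [apply IH; intros; apply H; lia|apply H; lia].
Qed.

Lemma rsum_const (n : nat) (a : R) : rsum n (fun _ => a) = INR n * a.
Proof.
induction n as [|n IH]; [simpl; ring|].
rewrite S_INR; simpl rsum; rewrite IH; ring.
Qed.

Lemma rsum_ge0 (n : nat) (f : nat -> R) :
  (forall i, (i < n)%nat -> 0 <= f i) -> 0 <= rsum n f.
Proof.
intros H; replace 0 with (rsum n (fun _ => 0)).
- apply rsum_le, H.
- rewrite rsum_const; ring.
Qed.

Lemma rsum_term_le (n : nat) (f : nat -> R) (i : nat) :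
  (forall j, (j < n)%nat -> 0 <= f j) -> (i < n)%nat -> f i <= rsum n f.
Proof.
intros H; induction n as [|n IH]; intros Hi; [lia|simpl].
destruct (Nat.eq_dec i n) as [->|Hn].
- assert (0 <= rsum n f) by (apply rsum_ge0; intros; apply H; lia); lra.
- assert (f i <= rsum n f) by (apply IH; [intros; apply H|]; lia).
  assert (0 <= f n) by (apply H; lia); lra.
Qed.

Definition delta (i j : nat) : R := if Nat.eq_dec i j then 1 else 0.

Lemma rsum_delta (n : nat) (f : nat -> R) (j : nat) :
  (j < n)%nat -> rsum n (fun i => f i * delta i j) = f j.
Proof.
induction n as [|n IH]; intros Hj; [lia|simpl].
destruct (Nat.eq_dec j n) as [->|Hn].
- rewrite (rsum_ext n _ (fun _ => 0)), rsum_const.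
  + unfold delta; destruct (Nat.eq_dec n n); [ring|congruence].
  + intros i Hi; unfold delta; destruct (Nat.eq_dec i n); [lia|ring].
- rewrite IH by lia; unfold delta; destruct (Nat.eq_dec n j); [lia|ring].
Qed.

Lemma rsum_cauchy_schwarz (n : nat) (a b : nat -> R) :
  rsum n (fun i => a i * b i) ^ 2
  <= rsum n (fun i => a i ^ 2) * rsum n (fun i => b i ^ 2).
Proof.
set (A := rsum n (fun i => a i ^ 2)); set (C := rsum n (fun i => b i ^ 2));
  set (D := rsum n (fun i => a i * b i)).
assert (HA : 0 <= A) by (apply rsum_ge0; intros; apply pow2_ge_0).
assert (HC : 0 <= C) by (apply rsum_ge0; intros; apply pow2_ge_0).
assert (Hq : forall s, 0 <= A + 2 * s * D + s ^ 2 * C).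
{ intros s.
  replace (A + 2 * s * D + s ^ 2 * C) with (rsum n (fun i => (a i + s * b i) ^ 2)).
  - apply rsum_ge0; intros; apply pow2_ge_0.
  - rewrite (rsum_ext n _
      (fun i => (a i ^ 2 + (2 * s) * (a i * b i)) + s ^ 2 * b i ^ 2))
      by (intros; ring).
    rewrite !rsum_lin; reflexivity. }
destruct (Req_dec C 0) as [HC0|HC0].
- destruct (Req_dec D 0) as [HD|HD].
  + rewrite HD, HC0; lra.
  (* For [C = 0] the quadratic is affine in [s], and this [s] gives it the value [-1]. *)
  + specialize (Hq (- (A + 1) / (2 * D))); rewrite HC0 in Hq.
    replace (A + 2 * (- (A + 1) / (2 * D)) * D + (- (A + 1) / (2 * D)) ^ 2 * 0)
      with (- 1) in Hq by (field; assumption).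
    lra.
- specialize (Hq (- D / C)).
  replace (A + 2 * (- D / C) * D + (- D / C) ^ 2 * C)
    with ((A * C - D ^ 2) / C) in Hq by (field; assumption).
  assert (0 <= (A * C - D ^ 2) / C * C) by (apply Rmult_le_pos; lra).
  replace ((A * C - D ^ 2) / C * C) with (A * C - D ^ 2) in H
    by (field; assumption).
  lra.
Qed.

Definition lcomb {I : Type} (n : nat) (c : nat -> R) (E : nat -> I -> R) : I -> R :=
  fun p => rsum n (fun i => c i * E i p).

(** Only semidefiniteness is asked: functions are total on R while the forms see only [0, 1], so a
    nonzero function may have norm zero. [V] is a predicate, which makes passing to subspaces
    easy. *)
Record inner_space {I : Type} (V : (I -> R) -> Prop)
    (B : (I -> R) -> (I -> R) -> R) : Prop := {
  inner_space_zero : V (fun _ => 0);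
  inner_space_axpy : forall v w a, V v -> V w -> V (fun p => v p + a * w p);
  inner_space_lin : forall v w z a, V v -> V w -> V z ->
    B (fun p => v p + a * w p) z = B v z + a * B w z;
  inner_space_sym : forall v w, V v -> V w -> B v w = B w v;
  inner_space_ge0 : forall v, V v -> 0 <= B v v
}.

Definition linear_on {I : Type} (V : (I -> R) -> Prop) (l : (I -> R) -> R) : Prop :=
  forall v w a, V v -> V w -> l (fun p => v p + a * w p) = l v + a * l w.

Lemma linear_on_zero {I : Type} (V : (I -> R) -> Prop) (l : (I -> R) -> R) :
  V (fun _ => 0) -> linear_on V l -> l (fun _ => 0) = 0.
Proof.
intros HV Hl.
assert (H := Hl _ _ (-1) HV HV); cbv beta in H; revert H.
replace (fun _ : I => 0 + -1 * 0) with (fun _ : I => 0)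
  by (extensionality p; ring).
intros; lra.
Qed.

Lemma lcomb_closed {I : Type} (V : (I -> R) -> Prop) (n : nat) (c : nat -> R)
    (E : nat -> I -> R) :
  V (fun _ => 0) -> (forall v w a, V v -> V w -> V (fun p => v p + a * w p)) ->
  (forall i, (i < n)%nat -> V (E i)) -> V (lcomb n c E).
Proof.
intros H0 H1; induction n as [|n IH]; intros HE; [exact H0|].
apply (H1 (lcomb n c E) (E n) (c n)); [apply IH; intros; apply HE|apply HE]; lia.
Qed.

Lemma linear_on_lcomb {I : Type} (V : (I -> R) -> Prop) (l : (I -> R) -> R)
    (n : nat) (c : nat -> R) (E : nat -> I -> R) :
  V (fun _ => 0) -> (forall v w a, V v -> V w -> V (fun p => v p + a * w p)) ->
  linear_on V l -> (forall i, (i < n)%nat -> V (E i)) ->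
  l (lcomb n c E) = rsum n (fun i => c i * l (E i)).
Proof.
intros H0 H1 Hl; induction n as [|n IH]; intros HE.
- exact (linear_on_zero V l H0 Hl).
- assert (H := Hl (lcomb n c E) (E n) (c n)); revert H.
  change (fun p => lcomb n c E p + c n * E n p) with (lcomb (S n) c E).
  intros H; rewrite H, IH; [reflexivity| | |].
  + intros; apply HE; lia.
  + apply lcomb_closed; try assumption; intros; apply HE; lia.
  + apply HE; lia.
Qed.

Lemma inner_space_linear {I : Type} (V : (I -> R) -> Prop) B (z : I -> R) :
  inner_space V B -> V z -> linear_on V (fun v => B v z).
Proof. intros HB Hz v w a Hv Hw; apply (inner_space_lin V B HB); assumption. Qed.

(** When [B x x = 0] the square of [y + a x] is affine in [a], so a nonzero slope [B x y] would make
    it negative for some [a]. Null vectors are thus orthogonal to everything, which stands in for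
    definiteness below. *)
Lemma inner_space_null {I : Type} (V : (I -> R) -> Prop) B (x y : I -> R) :
  inner_space V B -> V x -> V y -> B x x = 0 -> B x y = 0.
Proof.
intros HB Hx Hy H0.
destruct (Req_dec (B x y) 0) as [H|H]; [assumption|exfalso].
set (a := - (B y y + 1) / (2 * B x y)).
assert (Hz : V (fun p => y p + a * x p)) by (apply (inner_space_axpy V B HB); assumption).
assert (Hp := inner_space_ge0 V B HB _ Hz).
rewrite (inner_space_lin V B HB) in Hp by assumption.
rewrite (inner_space_sym V B HB y), (inner_space_sym V B HB x) in Hp by assumption.
rewrite !(inner_space_lin V B HB) in Hp by assumption.
rewrite (inner_space_sym V B HB y x), H0 in Hp by assumption.
replace (B y y + a * B x y + a * (B x y + a * 0)) with (B y y + 2 * a * B x y) in Hp by ring.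
unfold a in Hp.
replace (B y y + 2 * (- (B y y + 1) / (2 * B x y)) * B x y) with (- 1) in Hp
  by (field; assumption).
lra.
Qed.

Definition orthonormal {I : Type} (V : (I -> R) -> Prop) (B : (I -> R) -> (I -> R) -> R)
    (n : nat) (E : nat -> I -> R) : Prop :=
  (forall i, (i < n)%nat -> V (E i)) /\
  (forall i j, (i < n)%nat -> (j < n)%nat -> B (E i) (E j) = delta i j).

Definition coords {I : Type} (B : (I -> R) -> (I -> R) -> R) (E : nat -> I -> R)
    (v : I -> R) : nat -> R := fun i => B v (E i).

Lemma orthonormal_coords {I : Type} (V : (I -> R) -> Prop) B n (E : nat -> I -> R) c j :
  inner_space V B -> orthonormal V B n E -> (j < n)%nat ->
  B (lcomb n c E) (E j) = c j.
Proof.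
intros HB [HE HO] Hj.
rewrite (linear_on_lcomb V (fun v => B v (E j))); try assumption.
- rewrite (rsum_ext n _ (fun i => c i * delta i j)).
  + apply rsum_delta, Hj.
  + intros i Hi; rewrite HO by assumption; reflexivity.
- apply (inner_space_zero V B HB).
- apply (inner_space_axpy V B HB).
- apply inner_space_linear; [assumption|apply HE, Hj].
Qed.

Lemma lcomb_ext {I : Type} n c c' (E : nat -> I -> R) :
  (forall i, (i < n)%nat -> c i = c' i) -> lcomb n c E = lcomb n c' E.
Proof.
intros H; extensionality p; apply rsum_ext; intros i Hi; rewrite H by assumption; reflexivity.
Qed.

(* The last clause says that the coordinate functionals are linear
   combinations of the functionals of [l]: every class of functionals
   containing [l] and closed under linear combinations contains them. *)
Lemma orthonormal_basis {I : Type} (B : (I -> R) -> (I -> R) -> R)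
    (l : list ((I -> R) -> R)) : forall V : (I -> R) -> Prop,
  inner_space V B ->
  (forall f, In f l -> linear_on V f) ->
  (forall v, V v -> B v v = 0 -> forall f, In f l -> f v = 0) ->
  (forall v, V v -> (forall f, In f l -> f v = 0) -> B v v = 0) ->
  exists (n : nat) (E : nat -> I -> R),
    orthonormal V B n E /\
    (forall v, V v ->
       B (fun p => v p + -1 * lcomb n (coords B E v) E p)
         (fun p => v p + -1 * lcomb n (coords B E v) E p) = 0) /\
    (forall Q : ((I -> R) -> R) -> Prop,
       Q (fun _ => 0) ->
       (forall f g a, Q f -> Q g -> Q (fun v => f v + a * g v)) ->
       (forall f g, (forall v, V v -> f v = g v) -> Q f -> Q g) ->
       (forall f, In f l -> Q f) ->
       forall i, (i < n)%nat -> Q (fun v => B v (E i))).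
Proof.
induction l as [|f l IH]; intros V HB Hlin Hpos Hker.
- exists O, (fun _ _ => 0); split; [|split].
  + split; intros; lia.
  + intros v Hv; replace (fun p => _) with v.
    * apply Hker; [assumption|intros f []].
    * extensionality p; unfold lcomb; simpl; ring.
  + intros; lia.
(* Induction on the list: the kernel of [f] in [V] has a basis adapted to the remaining functionals,
   and [V] is larger by at most one dimension. *)
- set (V' := fun v => V v /\ f v = 0).
  assert (Hf : linear_on V f) by (apply Hlin; left; reflexivity).
  assert (H0 := inner_space_zero V B HB).
  assert (H1 := inner_space_axpy V B HB).
  assert (HB' : inner_space V' B).
  { constructor.
    - split; [assumption|exact (linear_on_zero V f H0 Hf)].
    - intros v w a [Hv Hv'] [Hw Hw']; split; [apply H1; assumption|].
      rewrite Hf, Hv', Hw' by assumption; ring.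
    - intros v w z a [Hv _] [Hw _] [Hz _]; apply (inner_space_lin V B HB); assumption.
    - intros v w [Hv _] [Hw _]; apply (inner_space_sym V B HB); assumption.
    - intros v [Hv _]; apply (inner_space_ge0 V B HB); assumption. }
  destruct (IH V' HB') as [n [E [HO [HC HQ]]]].
  { intros g Hg v w a [Hv _] [Hw _]; apply Hlin; [right|..]; assumption. }
  { intros v [Hv _] Hv0 g Hg; apply Hpos; [assumption..|right; assumption]. }
  { intros v [Hv Hfv] Hg; apply Hker; [assumption|].
    intros g [<-|Hg']; [assumption|apply Hg, Hg']. }
  assert (HE : forall i, (i < n)%nat -> V (E i)) by (intros i Hi; apply (proj1 HO i Hi)).
  destruct (classic (exists w, V w /\ f w <> 0)) as [[w0 [Hw0 Hfw0]]|Hno].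
  2: { assert (HVV : forall v, V v -> V' v).
       { intros v Hv; split; [assumption|].
         apply NNPP; intros Hn; apply Hno; exists v; split; assumption. }
       exists n, E; split; [|split].
       - split; [exact HE|apply HO].
       - intros v Hv; apply HC, HVV, Hv.
       - intros Q Q0 Q1 Q2 Q3; apply HQ; try assumption.
         + intros g g' Hgg; apply Q2; intros v Hv; apply Hgg, HVV, Hv.
         + intros g Hg; apply Q3; right; assumption. }
  (* Gram-Schmidt: a vector outside the kernel of [f], made orthogonal to the kernel and scaled so
     that [f w = 1]. *)
  set (w1 := fun p => w0 p + -1 * lcomb n (coords B E w0) E p).
  set (w := fun p => 0 + / f w0 * w1 p).
  assert (Hlc : forall c, V' (lcomb n c E)).
  { intros c; apply lcomb_closed.
    - apply (inner_space_zero V' B HB').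
    - apply (inner_space_axpy V' B HB').
    - apply (proj1 HO). }
  assert (Hw1 : V w1) by (apply H1; [assumption|apply Hlc]).
  assert (Hw : V w) by (apply (H1 (fun _ => 0) w1); assumption).
  assert (Hfw : f w = 1).
  { unfold w; rewrite (Hf (fun _ => 0) w1), (linear_on_zero V f H0 Hf) by assumption.
    unfold w1; rewrite Hf by (first [assumption|apply Hlc]).
    rewrite (proj2 (Hlc _)); field; assumption. }
  assert (HwE : forall i, (i < n)%nat -> B w (E i) = 0).
  { intros i Hi.
    assert (Hl := inner_space_linear V B (E i) HB (HE i Hi)).
    unfold w; rewrite (Hl (fun _ => 0) w1), (linear_on_zero V _ H0 Hl) by assumption.
    unfold w1; rewrite (Hl w0) by (first [assumption|apply Hlc]).
    rewrite (orthonormal_coords V' B) by assumption.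
    unfold coords; ring. }
  assert (Hww : 0 < B w w).
  { destruct (inner_space_ge0 V B HB w Hw) as [H|H]; [assumption|exfalso].
    assert (f w = 0) by (apply Hpos; [assumption|symmetry; assumption|left; reflexivity]).
    lra. }
  assert (Hsq := sqrt_lt_R0 _ Hww); set (s := sqrt (B w w)) in *.
  assert (Hss : s * s = B w w) by (apply sqrt_sqrt; lra).
  set (e := fun p => 0 + / s * w p).
  assert (He : V e) by (apply (H1 (fun _ => 0) w); assumption).
  assert (HBe : forall v, V v -> B v e = / s * B v w).
  { intros v Hv; rewrite (inner_space_sym V B HB v e), (inner_space_sym V B HB v w) by assumption.
    assert (Hl := inner_space_linear V B v HB Hv).
    unfold e; rewrite (Hl (fun _ => 0) w), (linear_on_zero V _ H0 Hl) by assumption; ring. }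
  (* The projection of [V] onto the kernel of [f] along [w]. Since [w] is orthogonal to that kernel,
     [f] is represented by a multiple of [w]. *)
  set (red := fun (v : I -> R) p => v p + - f v * w p).
  assert (Hred : forall v, V v -> V' (red v)).
  { intros v Hv; split; [apply H1; assumption|].
    unfold red; rewrite Hf, Hfw by assumption; ring. }
  assert (HredE : forall v i, V v -> (i < n)%nat -> B (red v) (E i) = B v (E i)).
  { intros v i Hv Hi; unfold red.
    rewrite (inner_space_lin V B HB), HwE by (auto); ring. }
  (* [red v] differs from its expansion in [E] by a null vector, and both the null vector and the
     expansion are orthogonal to [w]. *)
  assert (Hredw : forall v, V v -> B (red v) w = 0).
  { intros v Hv; assert (Hv' := Hred v Hv).
    set (x := fun p => red v p + -1 * lcomb n (coords B E (red v)) E p).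
    assert (Hx : V x) by (apply H1; [apply Hv'|apply Hlc]).
    assert (Hx0 : B x w = 0) by (apply (inner_space_null V); try assumption; apply HC, Hv').
    unfold x in Hx0; rewrite (inner_space_lin V B HB) in Hx0
      by (first [apply Hv'|assumption|apply Hlc]).
    rewrite (linear_on_lcomb V (fun v => B v w)) in Hx0; try assumption.
    - rewrite (rsum_ext n _ (fun _ => 0)), rsum_const in Hx0; [lra|].
      intros i Hi; rewrite (inner_space_sym V B HB), HwE by auto; ring.
    - apply inner_space_linear; assumption. }
  assert (Hvw : forall v, V v -> B v w = f v * B w w).
  { intros v Hv; assert (H := Hredw v Hv); unfold red in H.
    rewrite (inner_space_lin V B HB) in H by assumption; lra. }
  set (E' := fun i => if Nat.eq_dec i n then e else E i).
  assert (E'n : E' n = e) by (unfold E'; destruct (Nat.eq_dec n n); congruence).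
  assert (E'i : forall i, (i < n)%nat -> E' i = E i)
    by (intros i Hi; unfold E'; destruct (Nat.eq_dec i n); [lia|reflexivity]).
  exists (S n), E'; split; [|split].
  + split.
    * intros i Hi; destruct (Nat.eq_dec i n) as [->|Hn]; [rewrite E'n; assumption|].
      rewrite E'i by lia; apply HE; lia.
    * intros i j Hi Hj; destruct (Nat.eq_dec i n) as [->|Hin]; destruct (Nat.eq_dec j n) as [->|Hjn].
      -- rewrite E'n, HBe by assumption.
         rewrite (inner_space_sym V B HB e w), HBe, <- Hss by assumption.
         unfold delta; destruct (Nat.eq_dec n n); [field; lra|congruence].
      -- rewrite E'n, E'i by lia; rewrite (inner_space_sym V B HB), HBe by (auto with zarith).
         rewrite (inner_space_sym V B HB), HwE by (first [assumption|apply HE; lia|lia]).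
         unfold delta; destruct (Nat.eq_dec n j); [lia|ring].
      -- rewrite E'n, E'i, HBe by (first [lia|apply HE; lia]).
         rewrite (inner_space_sym V B HB), HwE by (first [assumption|apply HE; lia|lia]).
         unfold delta; destruct (Nat.eq_dec i n); [lia|ring].
      -- rewrite !E'i by lia; apply HO; lia.
  + intros v Hv.
    replace (fun p => v p + -1 * lcomb (S n) (coords B E' v) E' p)
      with (fun p => red v p + -1 * lcomb n (coords B E (red v)) E p); [apply HC, Hred, Hv|].
    extensionality p; unfold lcomb; simpl rsum.
    rewrite (rsum_ext n (fun i => coords B E' v i * E' i p)
               (fun i => coords B E (red v) i * E i p)).
    * unfold coords at 3; rewrite E'n, HBe, Hvw, <- Hss by assumption.
      unfold red at 1, e; field; lra.
    * intros i Hi; unfold coords; rewrite E'i, HredE by assumption; reflexivity.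
  (* The new coordinate is [s * f]. An old one acts on [red v], and [g (red v) = g v - f v * g w] is
     a combination of two functionals of the list. *)
  + intros Q Q0 Q1 Q2 Q3 i Hi; destruct (Nat.eq_dec i n) as [->|Hn].
    * apply (Q2 (fun v => 0 + s * f v)); [|apply Q1; [assumption|apply Q3; left; reflexivity]].
      intros v Hv; rewrite E'n, HBe, Hvw, <- Hss by assumption; field; lra.
    * apply (Q2 (fun v => B (red v) (E i))).
      { intros v Hv; rewrite E'i by lia; apply HredE; [assumption|lia]. }
      apply (HQ (fun g => Q (fun v => g (red v)))); [exact Q0| | | |lia].
      -- intros g g' a Hg Hg'; apply (Q1 (fun v => g (red v)) (fun v => g' (red v))); assumption.
      -- intros g g' Hgg; apply Q2; intros v Hv; apply Hgg, Hred, Hv.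
      -- intros g Hg; apply (Q2 (fun v => g v + - g w * f v)).
         ++ intros v Hv; unfold red; rewrite (Hlin g) by (try (right; assumption); assumption); ring.
         ++ apply Q1; apply Q3; [right; assumption|left; reflexivity].
Qed.

(** * Polynomials and the inverse inequality *)

(** Polynomials of degree at most [d] on the whole line, peeled off by the leading term. Being
    global, they can be differentiated, integrated and rescaled without regard to the cell on which
    a spline coincides with them. *)
Fixpoint polyn (d : nat) (g : R -> R) : Prop :=
  match d with
  | O => exists c, forall x, g x = c
  | S d' => exists k c, polyn d' k /\ forall x, g x = k x + c * x ^ d
  end.

Lemma polyn_ext (d : nat) (g h : R -> R) :
  (forall x, g x = h x) -> polyn d g -> polyn d h.
Proof.
destruct d as [|d]; simpl; intros H.
- intros [c Hc]; exists c; intros; rewrite <- H; apply Hc.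
- intros [k [c [Hk Hc]]]; exists k, c; split; [assumption|].
  intros; rewrite <- H; apply Hc.
Qed.

Lemma polyn_const (d : nat) (c : R) : polyn d (fun _ => c).
Proof.
induction d as [|d IH]; [exists c; reflexivity|].
exists (fun _ => c), 0; split; [assumption|intros; ring].
Qed.

Lemma polyn_axpy (d : nat) (g h : R -> R) (a : R) :
  polyn d g -> polyn d h -> polyn d (fun x => g x + a * h x).
Proof.
revert g h; induction d as [|d IH]; intros g h.
- intros [c Hc] [c' Hc']; exists (c + a * c'); intros; rewrite Hc, Hc'; reflexivity.
- intros [k [c [Hk Hc]]] [k' [c' [Hk' Hc']]].
  exists (fun x => k x + a * k' x), (c + a * c'); split; [apply IH; assumption|].
  intros; rewrite Hc, Hc'; ring.
Qed.

Lemma polyn_S (d : nat) (g : R -> R) : polyn d g -> polyn (S d) g.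
Proof. intros H; exists g, 0; split; [assumption|intros; ring]. Qed.

Lemma polyn_monomial (d : nat) (c : R) : polyn d (fun x => c * x ^ d).
Proof.
destruct d as [|d]; [exists c; intros; simpl; ring|].
exists (fun _ => 0), c; split; [apply polyn_const|intros; ring].
Qed.

Lemma polyn_mulx (d : nat) (g : R -> R) :
  polyn d g -> polyn (S d) (fun x => x * g x).
Proof.
revert g; induction d as [|d IH]; intros g.
- intros [c Hc]; exists (fun _ => 0), c; split; [apply polyn_const|].
  intros; rewrite Hc; simpl; ring.
- intros [k [c [Hk Hc]]]; exists (fun x => x * k x), c; split; [apply IH, Hk|].
  intros; rewrite Hc; simpl; ring.
Qed.

Lemma polyn_affine (d : nat) (g : R -> R) (a l : R) :
  polyn d g -> polyn d (fun x => g (a + l * x)).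
Proof.
assert (Hm : forall d, polyn d (fun x => (a + l * x) ^ d)).
{ clear; induction d as [|d IH]; [exists 1; reflexivity|].
  apply (polyn_ext _ (fun x => (0 + a * (a + l * x) ^ d) + l * (x * (a + l * x) ^ d)));
    [intros; simpl; ring|].
  apply (polyn_axpy _ (fun x => 0 + a * (a + l * x) ^ d)); [|apply polyn_mulx, IH].
  apply polyn_axpy; [apply polyn_const|apply polyn_S, IH]. }
revert g; induction d as [|d IH]; intros g.
- intros [c Hc]; exists c; intros; apply Hc.
- intros [k [c [Hk Hc]]].
  apply (polyn_ext _ (fun x => k (a + l * x) + c * (a + l * x) ^ S d));
    [intros; rewrite Hc; reflexivity|].
  apply polyn_axpy; [apply polyn_S, IH, Hk|apply Hm].
Qed.

Lemma polyn_derive (d : nat) (g : R -> R) : polyn d g ->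
  exists dg, polyn d dg /\ forall x, is_derive g x (dg x).
Proof.
revert g; induction d as [|d IH]; intros g.
- intros [c Hc]; exists (fun _ => 0); split; [apply polyn_const|].
  intros x; apply (is_derive_ext (fun _ => c)); [intros; symmetry; apply Hc|].
  apply @is_derive_const.
- intros [k [c [Hk Hc]]]; destruct (IH k Hk) as [dk [Hdk Hd]].
  exists (fun x => dk x + (c * INR (S d)) * x ^ d); split.
  + apply polyn_axpy; apply polyn_S; [assumption|].
    apply (polyn_ext _ (fun x => 1 * x ^ d)); [intros; ring|apply polyn_monomial].
  + intros x; apply (is_derive_ext (fun x => k x + c * x ^ S d));
      [intros; symmetry; apply Hc|].
    auto_derive; [exists (dk x); apply Hd|].
    replace (Derive (fun x => k x) x) with (dk x)
      by (symmetry; apply is_derive_unique, Hd).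
    change (match d with O => 1 | S _ => INR d + 1 end) with (INR (S d)); ring.
Qed.

Lemma polyn_antiderive (d : nat) (g : R -> R) : polyn d g ->
  exists G, polyn (S d) G /\ forall x, is_derive G x (g x).
Proof.
revert g; induction d as [|d IH]; intros g.
- intros [c Hc]; exists (fun x => 0 + c * x ^ 1); split.
  + apply polyn_axpy; [apply polyn_const|].
    apply (polyn_ext _ (fun x => 1 * x ^ 1)); [intros; ring|apply polyn_monomial].
  + intros x; rewrite Hc; auto_derive; [exact I|ring].
- intros [k [c [Hk Hc]]]; destruct (IH k Hk) as [K [HK Hd]].
  assert (Hn : INR (S (S d)) <> 0) by (apply not_0_INR; lia).
  exists (fun x => K x + (c / INR (S (S d))) * x ^ S (S d)); split.
  + apply (polyn_axpy _ K); [apply polyn_S, HK|].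
    apply (polyn_ext _ (fun x => 1 * x ^ S (S d))); [intros; ring|apply polyn_monomial].
  + intros x; rewrite Hc; auto_derive; [exists (k x); apply Hd|].
    replace (Derive (fun x => K x) x) with (k x)
      by (symmetry; apply is_derive_unique, Hd).
    change (match d with O => 1 | S _ => INR d + 1 end) with (INR (S d)).
    change (pred (S (S d))) with (S d).
    replace (INR (S (S d))) with (INR (S d) + 1) in * by (rewrite <- S_INR; reflexivity).
    change (x ^ S d) with (x * x ^ d); field; assumption.
Qed.

Lemma polyn_continuous (d : nat) (g : R -> R) (x : R) : polyn d g -> continuous g x.
Proof.
intros H; destruct (polyn_derive d g H) as [dg [_ Hd]].
apply (@ex_derive_continuous R_AbsRing R_NormedModule); exists (dg x); apply Hd.
Qed.

Lemma polyn_factor (d : nat) (g : R -> R) (a : R) : polyn (S d) g ->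
  exists k, polyn d k /\ forall x, g x = g a + (x - a) * k x.
Proof.
assert (Hm : forall d, exists k, polyn d k /\
  forall x, x ^ S d = a ^ S d + (x - a) * k x).
{ clear; induction d as [|d [k [Hk IH]]].
  - exists (fun _ => 1); split; [apply polyn_const|intros; simpl; ring].
  - exists (fun x => x * k x + a ^ S d * 1); split.
    + apply polyn_axpy; [apply polyn_mulx, Hk|apply polyn_const].
    + intros x; change (x ^ S (S d)) with (x * x ^ S d); rewrite IH; simpl; ring. }
revert g; induction d as [|d IH]; intros g [k [c [Hk Hc]]].
- destruct Hk as [c0 Hk]; exists (fun _ => c); split; [apply polyn_const|].
  intros; rewrite !Hc, !Hk; ring.
- destruct (IH k Hk) as [k1 [Hk1 H1]]; destruct (Hm (S d)) as [k2 [Hk2 H2]].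
  exists (fun x => k1 x + c * k2 x); split.
  + apply polyn_axpy; [apply polyn_S|]; assumption.
  + intros x; rewrite (Hc x), (Hc a), (H1 x), (H2 x); ring.
Qed.

(** Each root splits off a linear factor and lowers the degree; a constant with a root is zero. *)
Lemma polyn_roots (d : nat) (p : nat -> R) (g : R -> R) : polyn d g ->
  (forall i j, (i < j <= d)%nat -> p i <> p j) ->
  (forall i, (i <= d)%nat -> g (p i) = 0) -> forall x, g x = 0.
Proof.
revert g; induction d as [|d IH]; intros g Hg Hp H0 x.
- destruct Hg as [c Hc]; rewrite Hc, <- (Hc (p O)); apply H0; lia.
- destruct (polyn_factor d g (p (S d)) Hg) as [k [Hk Hf]].
  rewrite Hf, H0, (IH k Hk); [ring| | |lia].
  + intros; apply Hp; lia.
  + intros i Hi; assert (H := H0 i ltac:(lia)); rewrite Hf, H0 in H by lia.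
    assert (p i <> p (S d)) by (apply Hp; lia).
    apply Rmult_eq_reg_l with (p i - p (S d)); lra.
Qed.

Lemma poly_on_polyn (d : nat) (a b : R) (f : R -> R) :
  poly_on (S d) a b f <-> exists g, polyn d g /\ forall x, a <= x <= b -> f x = g x.
Proof.
unfold poly_on; replace (S d - 1)%nat with d by lia; split.
- intros [c Hc]; exists (fun x => sum_n (fun j => c j * x ^ j) d); split; [clear|exact Hc].
  induction d as [|d IH].
  + exists (c O); intros; rewrite sum_O; simpl; ring.
  + apply (polyn_ext _ (fun x => sum_n (fun j => c j * x ^ j) d + c (S d) * x ^ S d)).
    * intros; rewrite sum_Sn; reflexivity.
    * exists (fun x => sum_n (fun j => c j * x ^ j) d), (c (S d)); split; [exact IH|reflexivity].
- intros [g [Hg Hf]].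
  assert (H : exists c : nat -> R, forall x, g x = sum_n (fun j => c j * x ^ j) d).
  { clear f Hf; revert g Hg; induction d as [|d IH]; intros g.
    - intros [c Hc]; exists (fun _ => c); intros; rewrite sum_O, Hc; simpl; ring.
    - intros [k [c [Hk Hc]]]; destruct (IH k Hk) as [c' Hc'].
      exists (fun j => if Nat.eq_dec j (S d) then c else c' j); intros x.
      rewrite sum_Sn, Hc, Hc'; destruct (Nat.eq_dec (S d) (S d)); [|congruence].
      change plus with Rplus; f_equal; apply sum_n_ext_loc.
      intros n Hn; destruct (Nat.eq_dec n (S d)); [lia|reflexivity]. }
  destruct H as [c Hc]; exists c; intros x Hx; rewrite Hf, Hc by assumption; reflexivity.
Qed.

(** * Riemann integrals of continuous functions *)

Lemma locally_open (a b x : R) (Q : R -> Prop) : a < x < b ->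
  (forall z, a < z < b -> Q z) -> locally x Q.
Proof. intros [H1 H2] H; apply (locally_interval Q x a b H1 H2); auto. Qed.

Lemma continuous_ex_RInt (f : R -> R) (a b : R) :
  (forall x, continuous f x) -> ex_RInt f a b.
Proof. intros H; apply (@ex_RInt_continuous R_CompleteNormedModule); intros; apply H. Qed.

Lemma continuous_mult_R (f g : R -> R) (x : R) :
  continuous f x -> continuous g x -> continuous (fun y => f y * g y) x.
Proof. apply (@continuous_mult R_UniformSpace R_AbsRing). Qed.

Lemma continuous_plus_R (f g : R -> R) (x : R) :
  continuous f x -> continuous g x -> continuous (fun y => f y + g y) x.
Proof. apply (@continuous_plus R_UniformSpace R_AbsRing R_NormedModule). Qed.

Lemma RInt_Chasles_R (f : R -> R) (a b c : R) :
  ex_RInt f a b -> ex_RInt f b c -> @eq R (RInt f a b + RInt f b c) (RInt f a c).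
Proof. apply (@RInt_Chasles R_CompleteNormedModule). Qed.

Lemma RInt_ext_R (f g : R -> R) (a b : R) : a <= b ->
  (forall x, a < x < b -> f x = g x) -> @eq R (RInt f a b) (RInt g a b).
Proof.
intros Hab H; apply (@RInt_ext R_CompleteNormedModule).
intros x; rewrite Rmin_left, Rmax_right by assumption; apply H.
Qed.

Lemma RInt_const_R (a b c : R) : @eq R (RInt (fun _ => c) a b) ((b - a) * c).
Proof. apply (@RInt_const R_CompleteNormedModule). Qed.

Lemma RInt_lin (f g : R -> R) (a b c : R) : ex_RInt f a b -> ex_RInt g a b ->
  @eq R (RInt (fun x => f x + c * g x) a b) (RInt f a b + c * RInt g a b).
Proof.
intros Hf Hg; apply is_RInt_unique.
apply (is_RInt_plus f (fun x => c * g x)); [|apply (is_RInt_scal g)];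
  apply @RInt_correct; assumption.
Qed.

Lemma ex_RInt_lin (f g : R -> R) (a b c : R) : ex_RInt f a b -> ex_RInt g a b ->
  ex_RInt (fun x => f x + c * g x) a b.
Proof.
intros Hf Hg; apply (@ex_RInt_plus R_NormedModule f (fun x => c * g x)); [assumption|].
apply (@ex_RInt_scal R_NormedModule g); assumption.
Qed.

Lemma RInt_sqr_zero (f : R -> R) (a b : R) : a < b ->
  (forall x, a <= x <= b -> continuous f x) -> RInt (fun x => f x * f x) a b = 0 ->
  forall x, a <= x <= b -> f x = 0.
Proof.
intros Hab Hf H0.
assert (Hin : forall x, a < x < b -> f x = 0).
{ intros x Hx; apply NNPP; intros Hn.
  assert (He : 0 < Rabs (f x) / 2) by (assert (0 < Rabs (f x)) by (apply Rabs_pos_lt; assumption); lra).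
  destruct (Hf x ltac:(lra) (ball (f x) (mkposreal _ He)) (locally_ball _ _)) as [e0 Hd].
  assert (He0 := cond_pos e0).
  set (e := Rmin (e0 / 2) (Rmin (x - a) (b - x))).
  assert (e <= e0 / 2) by apply Rmin_l.
  assert (e <= x - a) by (eapply Rle_trans; [apply Rmin_r|apply Rmin_l]).
  assert (e <= b - x) by (eapply Rle_trans; [apply Rmin_r|apply Rmin_r]).
  assert (0 < e) by (repeat apply Rmin_glb_lt; lra).
  assert (Hex : forall p q, a <= p -> p <= q -> q <= b -> ex_RInt (fun x => f x * f x) p q).
  { intros p q H1' H2' H3'; apply (@ex_RInt_continuous R_CompleteNormedModule).
    intros z; rewrite Rmin_left, Rmax_right by lra; intros Hz.
    apply continuous_mult_R; apply Hf; lra. }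
  assert (Hge : forall p q, a <= p -> p <= q -> q <= b -> 0 <= RInt (fun x => f x * f x) p q).
  { intros p q H1' H2' H3'; apply RInt_ge_0; [lra|apply Hex; assumption|].
    intros; apply Rle_0_sqr. }
  assert (Hm : 0 < RInt (fun x => f x * f x) (x - e / 2) (x + e / 2)).
  { apply RInt_gt_0; [lra| |].
    - intros y Hy.
      assert (Hb : Rabs (f y - f x) < Rabs (f x) / 2).
      { apply Hd; change (Rabs (y - x) < e0); apply Rabs_def1; lra. }
      apply Rlt_0_sqr; intros Hy0; rewrite Hy0 in Hb.
      replace (0 - f x) with (- f x) in Hb by ring; rewrite Rabs_Ropp in Hb; lra.
    - intros y Hy; apply continuous_mult_R; apply Hf; lra. }
  assert (H5 := Hge a (x - e / 2) ltac:(lra) ltac:(lra) ltac:(lra)).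
  assert (H6 := Hge (x + e / 2) b ltac:(lra) ltac:(lra) ltac:(lra)).
  assert (H7 : RInt (fun x => f x * f x) a (x - e / 2)
    + RInt (fun x => f x * f x) (x - e / 2) (x + e / 2) = RInt (fun x => f x * f x) a (x + e / 2))
    by (apply RInt_Chasles_R; apply Hex; lra).
  assert (H8 : RInt (fun x => f x * f x) a (x + e / 2)
    + RInt (fun x => f x * f x) (x + e / 2) b = RInt (fun x => f x * f x) a b)
    by (apply RInt_Chasles_R; apply Hex; lra).
  assert (H9 : RInt (fun x => f x * f x) a b <= 0) by (rewrite H0; apply Rle_refl).
  lra. }
(* The end points follow by continuity: every neighbourhood of [x] contains interior points, where
   [f] vanishes. *)
intros x Hx; apply NNPP; intros Hn.
assert (He : 0 < Rabs (f x)) by (apply Rabs_pos_lt; assumption).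
destruct (Hf x Hx (ball (f x) (mkposreal _ He)) (locally_ball _ _)) as [e0 Hd].
assert (He0 := cond_pos e0).
assert (Hy : exists y, a < y < b /\ Rabs (y - x) < e0).
{ set (e := Rmin (e0 / 2) ((b - a) / 2)).
  assert (e <= e0 / 2) by apply Rmin_l; assert (e <= (b - a) / 2) by apply Rmin_r.
  assert (0 < e) by (apply Rmin_glb_lt; lra).
  destruct (Rle_dec x ((a + b) / 2)).
  - exists (x + e / 2); split; [lra|apply Rabs_def1; lra].
  - exists (x - e / 2); split; [lra|apply Rabs_def1; lra]. }
destruct Hy as [y [Hy1 Hy2]].
assert (Hb : Rabs (f y - f x) < Rabs (f x)) by (apply Hd; exact Hy2).
rewrite Hin in Hb by assumption.
replace (0 - f x) with (- f x) in Hb by ring; rewrite Rabs_Ropp in Hb; lra.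
Qed.

(** * The inverse inequality for polynomials *)

Lemma is_derive_rsum (n : nat) (f df : nat -> R -> R) (x : R) :
  (forall i, (i < n)%nat -> is_derive (f i) x (df i x)) ->
  is_derive (fun y => rsum n (fun i => f i y)) x (rsum n (fun i => df i x)).
Proof.
induction n as [|n IH]; intros H; simpl.
- apply @is_derive_const.
- apply (@is_derive_plus R_AbsRing R_NormedModule); [apply IH; intros|]; apply H; lia.
Qed.

(* All norms on the finite-dimensional space of polynomials are equivalent:
   expand in an orthonormal basis and apply Cauchy-Schwarz. *)
Lemma polyn_inverse_unit (d : nat) : exists K, 0 <= K /\
  forall g dg, polyn d g -> (forall x, is_derive g x (dg x)) ->
  forall y, 0 < y < 1 ->
    g y ^ 2 <= K * RInt (fun x => g x * g x) 0 1 /\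
    dg y ^ 2 <= K * RInt (fun x => g x * g x) 0 1.
Proof.
set (B := fun v w : R -> R => RInt (fun x => v x * w x) 0 1).
(* Evaluations at these [d + 1] distinct points of [0, 1] determine a polynomial of degree [d]; they
   are the functionals handed to [orthonormal_basis]. *)
set (p := fun i => INR i / INR (S d)).
assert (Hp : forall i, (i <= d)%nat -> 0 <= p i <= 1).
{ intros i Hi; unfold p; assert (0 < INR (S d)) by (apply lt_0_INR; lia).
  assert (0 <= INR i) by apply pos_INR.
  assert (INR i <= INR (S d)) by (apply le_INR; lia); split.
  - apply Rdiv_le_0_compat; assumption.
  - apply Rle_div_l; lra. }
assert (Hex : forall v w, polyn d v -> polyn d w -> ex_RInt (fun x => v x * w x) 0 1).
{ intros v w Hv Hw; apply continuous_ex_RInt; intros x.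
  apply continuous_mult_R; eapply polyn_continuous; eassumption. }
assert (Hz : forall v, polyn d v -> B v v = 0 -> forall x, 0 <= x <= 1 -> v x = 0).
{ intros v Hv H0; apply RInt_sqr_zero; [lra| |exact H0].
  intros x _; eapply polyn_continuous, Hv. }
assert (HB : inner_space (polyn d) B).
{ constructor.
  - apply polyn_const.
  - intros; apply polyn_axpy; assumption.
  - intros v w z a Hv Hw Hz'; unfold B.
    rewrite <- RInt_lin by (apply Hex; assumption).
    apply RInt_ext_R; [lra|intros; ring].
  - intros; apply RInt_ext_R; [lra|intros; ring].
  - intros v Hv; apply RInt_ge_0; [lra|apply Hex; assumption|intros; apply Rle_0_sqr]. }
destruct (orthonormal_basis B (map (fun i v => v (p i)) (List.seq 0 (S d))) (polyn d) HB)
  as [n [E [HO [HC _]]]].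
- intros f Hf v w a _ _; apply in_map_iff in Hf; destruct Hf as [i [<- _]]; reflexivity.
- intros v Hv H0 f Hf; apply in_map_iff in Hf; destruct Hf as [i [<- Hi]].
  apply in_seq in Hi; apply Hz; [assumption..|apply Hp; lia].
- intros v Hv Hf; unfold B; rewrite (RInt_ext_R _ (fun _ => 0)); [|lra|].
  + rewrite RInt_const_R; ring.
  + intros x _; rewrite (polyn_roots d p v Hv); [ring| |].
    * intros i j Hij; unfold p; intros H.
      assert (0 < INR (S d)) by (apply lt_0_INR; lia).
      apply Rmult_eq_reg_r in H; [apply INR_eq in H; lia|apply Rinv_neq_0_compat; lra].
    * intros i Hi; apply (Hf (fun v => v (p i))); apply in_map_iff; exists i; split; [reflexivity|].
      apply in_seq; lia.
- assert (HD : forall i, exists dE, (i < n)%nat -> polyn d dE /\ forall x, is_derive (E i) x (dE x)).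
  { intros i; destruct (Compare_dec.le_lt_dec n i); [exists (fun _ => 0); lia|].
    destruct (polyn_derive d (E i)) as [dE HdE]; [apply HO; assumption|].
    exists dE; intros _; exact HdE. }
  set (dE := fun i => proj1_sig (constructive_indefinite_description _ (HD i))).
  assert (HdE : forall i, (i < n)%nat -> polyn d (dE i) /\ forall x, is_derive (E i) x (dE i x)).
  { intros i; unfold dE; destruct (constructive_indefinite_description _ (HD i)); assumption. }
  assert (Hbd : forall f : nat -> R -> R, (forall i, (i < n)%nat -> polyn d (f i)) ->
    exists K, 0 <= K /\ forall y, 0 <= y <= 1 -> rsum n (fun i => f i y ^ 2) <= K).
  { intros f Hf; clear - Hf; induction n as [|n IH]; [exists 0; split; [|intros]; simpl; lra|].
    destruct IH as [K [HK0 HK]]; [intros; apply Hf; lia|].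
    destruct (continuity_ab_maj (fun y => f n y ^ 2) 0 1) as [M [HM _]]; [lra| |].
    - intros c _; apply continuity_pt_filterlim.
      apply (continuous_ext (fun y => f n y * f n y)); [intros; simpl; ring|].
      apply continuous_mult_R; apply (polyn_continuous d); apply Hf; lia.
    - exists (K + f n M ^ 2); split; [assert (H := pow2_ge_0 (f n M)); lra|].
      intros y Hy; apply Rplus_le_compat; [apply HK|apply HM]; assumption. }
  destruct (Hbd E) as [K1 [HK10 HK1]]; [apply HO|].
  destruct (Hbd dE) as [K2 [HK20 HK2]]; [apply HdE|].
  exists (K1 + K2); split; [lra|].
  intros g dg Hg Hdg y Hy.
  set (c := coords B E g).
  assert (Hl : polyn d (lcomb n c E)).
  { apply lcomb_closed; [apply polyn_const|intros; apply polyn_axpy; assumption|apply HO]. }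
  assert (Heq : forall x, 0 <= x <= 1 -> g x = lcomb n c E x).
  { intros x Hx.
    assert (H := Hz _ (polyn_axpy d g _ (-1) Hg Hl) (HC g Hg) x Hx); cbv beta in H; lra. }
  (* Parseval, obtained by expanding only one of the two factors [g]. *)
  assert (Hc : rsum n (fun i => c i ^ 2) = RInt (fun x => g x * g x) 0 1).
  { rewrite (RInt_ext_R _ (fun x => lcomb n c E x * g x)); [|lra|].
    - change (RInt (fun x => lcomb n c E x * g x) 0 1) with (B (lcomb n c E) g).
      rewrite (linear_on_lcomb (polyn d) (fun v => B v g) n c E); cbv beta.
      + apply rsum_ext; intros i Hi; unfold c, coords.
        rewrite (inner_space_sym _ B HB (E i) g) by (first [assumption|apply HO; assumption]); ring.
      + apply polyn_const.
      + intros; apply polyn_axpy; assumption.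
      + apply inner_space_linear; assumption.
      + apply HO.
    - intros x Hx; rewrite (Heq x) at 1 by lra; ring. }
  assert (Hi0 : 0 <= RInt (fun x => g x * g x) 0 1).
  { rewrite <- Hc; apply rsum_ge0; intros; apply pow2_ge_0. }
  split.
  + rewrite Heq by lra; eapply Rle_trans; [apply rsum_cauchy_schwarz|].
    rewrite Hc, Rmult_comm; apply Rmult_le_compat_r; [assumption|].
    assert (H := HK1 y ltac:(lra)); lra.
  + assert (HdL : is_derive (lcomb n c E) y (rsum n (fun i => c i * dE i y))).
    { apply (is_derive_rsum n (fun i x => c i * E i x) (fun i x => c i * dE i x)).
      intros i Hi; apply (is_derive_scal (E i)); apply HdE, Hi. }
    assert (Hdy : dg y = rsum n (fun i => c i * dE i y)).
    { rewrite <- (is_derive_unique _ _ _ HdL); symmetry; apply is_derive_unique.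
      apply (is_derive_ext_loc g); [|apply Hdg].
      apply (locally_open 0 1); [assumption|]; intros x Hx; apply Heq; lra. }
    rewrite Hdy; eapply Rle_trans; [apply rsum_cauchy_schwarz|].
    rewrite Hc, Rmult_comm; apply Rmult_le_compat_r; [assumption|].
    assert (H := HK2 y ltac:(lra)); lra.
Qed.

(** Rescaling from the unit interval: the integral of the square contributes a factor [1 / l] and
    the derivative, once squared, another [1 / l ^ 2], whence the powers 1 and 3. *)
Lemma polyn_inverse (d : nat) : exists K, 0 <= K /\
  forall a l g dg, 0 < l -> polyn d g -> (forall x, is_derive g x (dg x)) ->
  forall y, a < y < a + l ->
    g y ^ 2 <= K / l * RInt (fun x => g x * g x) a (a + l) /\
    dg y ^ 2 <= K / l ^ 3 * RInt (fun x => g x * g x) a (a + l).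
Proof.
destruct (polyn_inverse_unit d) as [K [HK0 HK]]; exists K; split; [assumption|].
intros a l g dg Hl Hg Hdg y Hy.
destruct (HK (fun x => g (a + l * x)) (fun x => l * dg (a + l * x))
             (polyn_affine d g a l Hg)) with (y := (y - a) / l) as [H1 H2].
- intros x; auto_derive; [exists (dg (a + l * x)); apply Hdg|].
  replace (Derive (fun x => g x) (a + l * x)) with (dg (a + l * x))
    by (symmetry; apply is_derive_unique, Hdg); ring.
- split; [apply Rdiv_lt_0_compat; lra|apply Rlt_div_l; lra].
- replace (a + l * ((y - a) / l)) with y in H1, H2 by (field; lra).
  assert (Hs : @eq R (RInt (fun x => g (a + l * x) * g (a + l * x)) 0 1)
                 (/ l * RInt (fun x => g x * g x) a (a + l))).
  { assert (Hc : forall x, continuous (fun x => g (a + l * x)) x)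
      by (intros x; apply (polyn_continuous d (fun x => g (a + l * x))), polyn_affine, Hg).
    assert (H : RInt (fun x => g x * g x) a (a + l)
                = RInt (fun x => 0 + l * (g (a + l * x) * g (a + l * x))) 0 1).
    { assert (H0 := RInt_comp_lin (fun x => g x * g x) l a 0 1).
      replace (l * 0 + a) with a in H0 by ring; replace (l * 1 + a) with (a + l) in H0 by ring.
      rewrite <- H0.
      - apply RInt_ext_R; [lra|]; intros x _; change scal with Rmult; cbv beta.
        rewrite (Rplus_comm (l * x) a); symmetry; apply Rplus_0_l.
      - apply continuous_ex_RInt; intros x; apply continuous_mult_R; apply (polyn_continuous d), Hg. }
    rewrite H, RInt_lin, RInt_const_R; [|apply @ex_RInt_const|].
    { symmetry; field; lra. }
    apply continuous_ex_RInt; intros; apply continuous_mult_R; apply Hc. }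
  rewrite Hs in H1, H2; split.
  + unfold Rdiv; rewrite Rmult_assoc; exact H1.
  + apply Rmult_le_reg_l with (l ^ 2); [apply pow_lt, Hl|].
    replace (l ^ 2 * (K / l ^ 3 * RInt (fun x => g x * g x) a (a + l)))
      with (K * (/ l * RInt (fun x => g x * g x) a (a + l))) by (field; lra).
    rewrite <- Rpow_mult_distr; exact H2.
Qed.

(** * Calculus on [0, 1] and on partitions *)

Definition clamp (a b x : R) : R := Rmax a (Rmin b x).

Lemma clamp_bounds (a b x : R) : a <= b -> a <= clamp a b x <= b.
Proof.
intros H; unfold clamp; split; [apply Rmax_l|].
apply Rmax_lub; [assumption|apply Rmin_l].
Qed.

Lemma clamp_id (a b x : R) : a <= x <= b -> clamp a b x = x.
Proof. intros H; unfold clamp; rewrite Rmin_right, Rmax_right; lra. Qed.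

Lemma clamp_lipschitz (a b x y : R) : Rabs (clamp a b x - clamp a b y) <= Rabs (x - y).
Proof.
unfold clamp, Rmax, Rmin; repeat destruct Rle_dec; unfold Rabs; repeat destruct Rcase_abs; lra.
Qed.

Lemma clamp_continuous (a b x : R) : continuous (clamp a b) x.
Proof.
intros P [e He]; exists e; intros y Hy; apply He.
change (Rabs (clamp a b y - clamp a b x) < e).
eapply Rle_lt_trans; [apply clamp_lipschitz|exact Hy].
Qed.

(** Freezing [f] at its boundary values outside [a, b] turns continuity relative to the interval
    into continuity on R, where the usual calculus applies. *)
Lemma continuous_on_clamp (a b : R) (f : R -> R) : a <= b ->
  continuous_on (fun x => a <= x <= b) f <-> (forall x, continuous (fun y => f (clamp a b y)) x).
Proof.
intros Hab; split; intros H x.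
- apply (filterlim_comp _ _ _ (clamp a b) f (locally x)
           (within (fun y => a <= y <= b) (locally (clamp a b x)))).
  + intros P HP; assert (HP' := clamp_continuous a b x _ HP).
    unfold filtermap in *; revert HP'; apply filter_imp; intros y Hy; apply Hy, clamp_bounds, Hab.
  + apply H, clamp_bounds, Hab.
- intros Hx; apply (filterlim_within_ext (fun y => a <= y <= b) (fun y => f (clamp a b y))).
  + intros y Hy; rewrite clamp_id by assumption; reflexivity.
  + apply (filterlim_filter_le_1 (F := locally x)).
    * apply filter_le_within.
    * assert (Hc := H x); unfold continuous in Hc; rewrite (clamp_id a b x Hx) in Hc; exact Hc.
Qed.

Lemma continuous_continuous_on (a b : R) (f g : R -> R) : a <= b ->
  (forall x, a <= x <= b -> continuous g x) -> (forall x, a <= x <= b -> f x = g x) ->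
  continuous_on (fun x => a <= x <= b) f.
Proof.
intros Hab Hg Hfg; apply continuous_on_clamp; [assumption|]; intros x.
assert (Hc := clamp_bounds a b x Hab).
apply (continuous_ext (fun y => g (clamp a b y))).
- intros y; symmetry; apply Hfg, clamp_bounds, Hab.
- apply (continuous_comp (clamp a b) g); [apply clamp_continuous|apply Hg, Hc].
Qed.

Lemma is_derive_is_derive_on (a b : R) (f : R -> R) (x l : R) :
  a < b -> a <= x <= b -> is_derive f x l -> is_derive_on a b f x l.
Proof.
intros Hab Hx H.
assert (PF := within_interval_proper a b x Hab Hx).
apply (filterdiff_locally f x); [|exact H].
intros P HP; apply filter_le_within, HP.
Qed.

Lemma is_derive_on_interior (a b : R) (f : R -> R) (x l : R) :
  a < x < b -> is_derive_on a b f x l -> is_derive f x l.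
Proof.
intros Hx [Hl H]; split; [exact Hl|].
intros y Hy e; specialize (H y).
assert (Hin : locally x (fun y => a <= y <= b))
  by (apply (locally_open a b); [assumption|intros; lra]).
assert (Hlim : is_filter_lim (within (fun y => a <= y <= b) (locally x)) y).
{ intros P HP; apply filter_le_within, Hy, HP. }
specialize (H Hlim e); unfold within in H.
generalize (filter_and _ _ Hin H); apply filter_imp; intros z [Hz1 Hz2]; apply Hz2, Hz1.
Qed.

Lemma is_derive_on_ext (a b : R) (f g : R -> R) (x l : R) :
  a <= x <= b -> (forall y, a <= y <= b -> f y = g y) ->
  is_derive_on a b f x l -> is_derive_on a b g x l.
Proof.
intros Hx Hfg; apply filterdiff_ext_loc.
- exists (mkposreal 1 Rlt_0_1); intros y _ Hy; apply Hfg, Hy.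
- intros y Hy.
  (* [x] belongs to every set of the filter, so a limit [y] different from [x] would be separated
     from it by a ball. *)
  assert (Hxy : x = y).
  { apply NNPP; intros Hn.
    assert (He : 0 < Rabs (y - x) / 2) by (assert (0 < Rabs (y - x)) by (apply Rabs_pos_lt; lra); lra).
    destruct (Hy (ball y (mkposreal _ He)) (locally_ball _ _)) as [e He'].
    assert (Hb := He' x (ball_center _ _) Hx).
    assert (Hb' : Rabs (x - y) < Rabs (y - x) / 2) by exact Hb.
    rewrite Rabs_minus_sym in Hb'; lra. }
  subst y; apply Hfg, Hx.
Qed.

Lemma Derive_on_ext (a b : R) (f g : R -> R) (x : R) :
  a <= x <= b -> (forall y, a <= y <= b -> f y = g y) ->
  Derive_on a b f x = Derive_on a b g x.
Proof.
intros Hx Hfg; unfold Derive_on; f_equal.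
extensionality l; apply propositional_extensionality.
split; apply is_derive_on_ext; try assumption.
intros; symmetry; apply Hfg; assumption.
Qed.

Lemma Derive_on_correct (a b : R) (f : R -> R) (x : R) :
  a < b -> a <= x <= b -> ex_derive_on a b f x -> is_derive_on a b f x (Derive_on a b f x).
Proof.
intros Hab Hx [l Hl].
replace (Derive_on a b f x) with l; [assumption|].
symmetry; apply is_derive_on_unique; assumption.
Qed.

Lemma is_derive_on_axpy (a b : R) (f g : R -> R) (x l m c : R) :
  is_derive_on a b f x l -> is_derive_on a b g x m ->
  is_derive_on a b (fun y => f y + c * g y) x (l + c * m).
Proof.
intros Hf Hg; unfold is_derive_on.
assert (FF : Filter (within (fun y => a <= y <= b) (locally x)))
  by (apply within_filter, locally_filter).
apply (filterdiff_ext_lin _ (fun y : R => plus (scal y l) (scal c (scal y m)))).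
- apply (filterdiff_plus_fct f (fun y => scal c (g y))); [exact Hf|].
  apply (filterdiff_scal_r_fct c g); [exact Rmult_comm|exact Hg].
- intros y; unfold plus, scal; simpl; unfold mult; simpl; ring.
Qed.

Lemma is_derive_on_const (a b c x : R) : is_derive_on a b (fun _ => c) x 0.
Proof.
unfold is_derive_on.
assert (FF : Filter (within (fun y => a <= y <= b) (locally x)))
  by (apply within_filter, locally_filter).
apply (filterdiff_ext_lin _ (fun _ : R => zero)); [apply filterdiff_const|].
intros y; unfold zero, scal; simpl; unfold mult; simpl; ring.
Qed.

Lemma is_derive_RInt_continuous (f : R -> R) (a x : R) :
  (forall y, continuous f y) -> is_derive (fun y => RInt f a y) x (f x).
Proof.
intros Hf; apply (is_derive_RInt f (fun y => RInt f a y) a x); [|apply Hf].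
exists (mkposreal 1 Rlt_0_1); intros y _; apply @RInt_correct, continuous_ex_RInt, Hf.
Qed.

(** The mean value theorem needs derivatives only in the open interval and continuity at its ends,
    which is what relative derivatives provide; it is applied to [f] minus the primitive, whose
    derivative vanishes inside. *)
Lemma FTC_one_sided (a b : R) (f df : R -> R) : a < b ->
  continuous_on (fun x => a <= x <= b) f ->
  continuous_on (fun x => a <= x <= b) df ->
  (forall x, a <= x <= b -> is_derive_on a b f x (df x)) ->
  forall x, a <= x <= b -> f x = f a + RInt (fun y => df (clamp a b y)) a x.
Proof.
intros Hab Hf Hdf Hd x Hx.
assert (Hcd := proj1 (continuous_on_clamp a b df (Rlt_le _ _ Hab)) Hdf).
assert (Hcf := proj1 (continuous_on_clamp a b f (Rlt_le _ _ Hab)) Hf).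
set (G := fun x => RInt (fun y => df (clamp a b y)) a x).
assert (HG : forall y, is_derive G y (df (clamp a b y)))
  by (intros; apply (is_derive_RInt_continuous (fun y => df (clamp a b y))); assumption).
destruct (Req_dec a x) as [<-|Hax].
{ unfold G; rewrite RInt_point; unfold zero; simpl; ring. }
destruct (MVT_gen (fun y => f (clamp a b y) - G y) a x (fun _ => 0)) as [c [_ Hc]].
- intros y; rewrite Rmin_left, Rmax_right by lra; intros Hy.
  replace 0 with (df y - df y) by ring.
  apply (is_derive_minus (V := R_NormedModule)).
  + apply (is_derive_ext_loc f).
    * apply (locally_open a b); [lra|]; intros z Hz; rewrite clamp_id by lra; reflexivity.
    * apply (is_derive_on_interior a b); [lra|]; apply Hd; lra.
  + assert (H := HG y); rewrite clamp_id in H by lra; exact H.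
- intros y _; apply continuity_pt_filterlim.
  apply (@continuous_minus R_UniformSpace R_AbsRing R_NormedModule (fun y => f (clamp a b y)) G);
    [apply Hcf|].
  apply (@ex_derive_continuous R_AbsRing R_NormedModule); eexists; apply HG.
- unfold G in Hc at 2; rewrite RInt_point, !clamp_id in Hc by lra.
  unfold zero in Hc; simpl in Hc; lra.
Qed.

(** Smoothness up to the end points is encoded by a C^1 extension to the whole line, so that sums
    and products are those of the extensions and one-sided derivatives do not appear. *)
Definition C1_on (a b : R) (f : R -> R) : Prop :=
  exists g dg, (forall x, is_derive g x (dg x)) /\ (forall x, continuous dg x) /\
    forall x, a <= x <= b -> f x = g x.

Definition C0_in (a b : R) (f : R -> R) : Prop :=
  exists g, (forall x, continuous g x) /\ forall x, a < x < b -> f x = g x.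

(** The extension is the primitive of the clamped derivative: affine outside [0, 1]. *)
Lemma Ck_on_C1_on (f : R -> R) : Ck_on 1 0 1 f -> C1_on 0 1 f.
Proof.
intros [Hf [Hd [Hdf _]]].
assert (Hcd := proj1 (continuous_on_clamp 0 1 _ Rle_0_1) Hdf).
exists (fun x => f 0 + RInt (fun y => Derive_on 0 1 f (clamp 0 1 y)) 0 x),
  (fun y => Derive_on 0 1 f (clamp 0 1 y)); split; [|split; [exact Hcd|]].
- intros x.
  replace (Derive_on 0 1 f (clamp 0 1 x)) with (0 + Derive_on 0 1 f (clamp 0 1 x)) by ring.
  apply (is_derive_plus (V := R_NormedModule)); [apply @is_derive_const|].
  apply (is_derive_RInt_continuous (fun y => Derive_on 0 1 f (clamp 0 1 y)) 0 x Hcd).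
- intros x Hx; apply (FTC_one_sided 0 1); try assumption; [lra|].
  intros y Hy; apply Derive_on_correct; [lra|assumption|apply Hd, Hy].
Qed.

Lemma C1_on_sub (a b a' b' : R) (f : R -> R) : a <= a' -> b' <= b -> C1_on a b f -> C1_on a' b' f.
Proof.
intros Ha Hb [g [dg [H1 [H2 H3]]]]; exists g, dg; split; [assumption|split; [assumption|]].
intros; apply H3; lra.
Qed.

Lemma C1_on_const (a b c : R) : C1_on a b (fun _ => c).
Proof.
exists (fun _ => c), (fun _ => 0); split; [|split; [|reflexivity]]; intros.
- apply @is_derive_const.
- apply continuous_const.
Qed.

Lemma is_derive_mult_R (f g : R -> R) (x l m : R) : is_derive f x l -> is_derive g x m ->
  is_derive (fun y => f y * g y) x (l * g x + f x * m).
Proof. intros Hf Hg; apply (is_derive_mult f g x l m Hf Hg Rmult_comm). Qed.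

Lemma C1_on_mult (a b : R) (f g : R -> R) :
  C1_on a b f -> C1_on a b g -> C1_on a b (fun x => f x * g x).
Proof.
intros [f1 [df [Hf1 [Hf2 Hf3]]]] [g1 [dg [Hg1 [Hg2 Hg3]]]].
exists (fun x => f1 x * g1 x), (fun x => df x * g1 x + f1 x * dg x); split; [|split].
- intros x; apply is_derive_mult_R; auto.
- intros x; apply continuous_plus_R; apply continuous_mult_R; auto;
    apply (@ex_derive_continuous R_AbsRing R_NormedModule); eexists; auto.
- intros x Hx; rewrite Hf3, Hg3 by assumption; reflexivity.
Qed.

Lemma C1_on_plus (a b : R) (f g : R -> R) :
  C1_on a b f -> C1_on a b g -> C1_on a b (fun x => f x + g x).
Proof.
intros [f1 [df [Hf1 [Hf2 Hf3]]]] [g1 [dg [Hg1 [Hg2 Hg3]]]].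
exists (fun x => f1 x + g1 x), (fun x => df x + dg x); split; [|split].
- intros x; apply (is_derive_plus (V := R_NormedModule)); auto.
- intros x; apply continuous_plus_R; auto.
- intros x Hx; rewrite Hf3, Hg3 by assumption; reflexivity.
Qed.

Lemma C1_on_ext (a b : R) (f g : R -> R) :
  (forall x, a <= x <= b -> f x = g x) -> C1_on a b f -> C1_on a b g.
Proof.
intros H [f1 [df [Hf1 [Hf2 Hf3]]]]; exists f1, df; split; [assumption|split; [assumption|]].
intros x Hx; rewrite <- H by assumption; auto.
Qed.

Lemma C0_in_mult (a b : R) (f g : R -> R) :
  C0_in a b f -> C0_in a b g -> C0_in a b (fun x => f x * g x).
Proof.
intros [f1 [H1 H2]] [g1 [H3 H4]]; exists (fun x => f1 x * g1 x); split.
- intros; apply continuous_mult_R; auto.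
- intros; rewrite H2, H4 by assumption; reflexivity.
Qed.

Lemma C0_in_plus (a b : R) (f g : R -> R) :
  C0_in a b f -> C0_in a b g -> C0_in a b (fun x => f x + g x).
Proof.
intros [f1 [H1 H2]] [g1 [H3 H4]]; exists (fun x => f1 x + g1 x); split.
- intros; apply continuous_plus_R; auto.
- intros; rewrite H2, H4 by assumption; reflexivity.
Qed.

Lemma C0_in_ext (a b : R) (f g : R -> R) :
  (forall x, a < x < b -> f x = g x) -> C0_in a b f -> C0_in a b g.
Proof.
intros H [f1 [H1 H2]]; exists f1; split; [assumption|].
intros; rewrite <- H by assumption; auto.
Qed.

Lemma C1_on_C0_in (a b : R) (f : R -> R) : C1_on a b f -> C0_in a b f.
Proof.
intros [g [dg [H1 [H2 H3]]]]; exists g; split.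
- intros; apply (@ex_derive_continuous R_AbsRing R_NormedModule); eexists; auto.
- intros; apply H3; lra.
Qed.

Lemma C1_on_interior (a b : R) (f g dg : R -> R) (x : R) :
  0 <= a -> b <= 1 -> (forall x, is_derive g x (dg x)) ->
  (forall x, a <= x <= b -> f x = g x) -> a < x < b ->
  is_derive f x (Derive_on 0 1 f x) /\ Derive_on 0 1 f x = dg x.
Proof.
intros Ha Hb Hg Hfg Hx.
assert (H : is_derive f x (dg x)).
{ apply (is_derive_ext_loc g); [|apply Hg].
  apply (locally_open a b); [assumption|]; intros z Hz; symmetry; apply Hfg; lra. }
assert (HD : Derive_on 0 1 f x = dg x).
{ apply is_derive_on_unique; [lra|lra|]; apply is_derive_is_derive_on; [lra|lra|assumption]. }
rewrite HD; split; [assumption|reflexivity].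
Qed.

Lemma C1_on_Derive_C0_in (a b : R) (f : R -> R) :
  0 <= a -> b <= 1 -> C1_on a b f -> C0_in a b (Derive_on 0 1 f).
Proof.
intros Ha Hb [g [dg [H1 [H2 H3]]]]; exists dg; split; [assumption|].
intros x Hx; apply (C1_on_interior a b f g dg x Ha Hb H1 H3 Hx).
Qed.

Lemma C1_on_FTC (a b : R) (f : R -> R) :
  0 <= a -> a <= b -> b <= 1 -> C1_on a b f -> RInt (Derive_on 0 1 f) a b = f b - f a.
Proof.
intros Ha Hab Hb [g [dg [H1 [H2 H3]]]].
rewrite (RInt_ext_R _ dg a b Hab).
- rewrite !H3 by lra; apply is_RInt_unique, (is_RInt_derive g dg); auto.
- intros x Hx; apply (C1_on_interior a b f g dg x Ha Hb H1 H3 Hx).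
Qed.

(** * Partitions and piecewise smooth functions *)

Lemma node_mono (P : partition) (i j : nat) : (i <= j <= ncells P)%nat -> node P i <= node P j.
Proof.
intros [H1 H2]; induction j as [|j IH]; [replace i with O by lia; lra|].
destruct (Nat.eq_dec i (S j)) as [->|Hn]; [lra|].
assert (H := node_incr P j ltac:(lia)); assert (H' : node P i <= node P j) by (apply IH; lia); lra.
Qed.

Lemma node_bounds (P : partition) (i : nat) : (i <= ncells P)%nat -> 0 <= node P i <= 1.
Proof.
intros H; split.
- rewrite <- (node_first P); apply node_mono; lia.
- rewrite <- (node_last P); apply node_mono; lia.
Qed.

Lemma cell_cover (P : partition) (n : nat) (x : R) : (n <= ncells P)%nat -> 0 <= x <= node P n ->
  n = O \/ exists i, (i < n)%nat /\ node P i <= x <= node P (S i).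
Proof.
induction n as [|n IH]; intros Hn Hx; [left; reflexivity|right].
destruct (Rle_dec (node P n) x) as [H|H]; [exists n; split; [lia|lra]|].
destruct IH as [->|[i [Hi Hx']]]; [lia|lra| |].
- rewrite node_first in H; lra.
- exists i; split; [lia|assumption].
Qed.

Lemma ncells_pos (P : partition) : (0 < ncells P)%nat.
Proof.
destruct (ncells P) as [|n] eqn:E; [|lia].
assert (H1 := node_first P); assert (H2 := node_last P); rewrite E in H2; lra.
Qed.

Lemma in_some_cell (P : partition) (x : R) : 0 <= x <= 1 ->
  exists i, (i < ncells P)%nat /\ node P i <= x <= node P (S i).
Proof.
intros Hx; destruct (cell_cover P (ncells P) x (Nat.le_refl _)) as [H|H].
- rewrite node_last; assumption.
- assert (H' := ncells_pos P); lia.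
- assumption.
Qed.

Lemma mesh_cell (P : partition) (i : nat) : (i < ncells P)%nat -> 0 < cell P i <= mesh P.
Proof.
intros Hi; split; [assert (H := node_incr P i Hi); unfold cell; lra|].
unfold mesh.
assert (Hin : In i (List.seq 0 (ncells P))) by (apply in_seq; lia).
induction (List.seq 0 (ncells P)) as [|j s IH]; [destruct Hin|simpl].
destruct Hin as [->|Hin]; [apply Rmax_l|].
eapply Rle_trans; [apply IH, Hin|apply Rmax_r].
Qed.

Lemma mesh_pos (P : partition) : 0 < mesh P.
Proof. destruct (mesh_cell P O (ncells_pos P)); lra. Qed.

Definition off_nodes (P : partition) (x : R) : Prop :=
  exists i, (i < ncells P)%nat /\ node P i < x < node P (S i).

Lemma off_nodes_bounds (P : partition) (x : R) : off_nodes P x -> 0 < x < 1.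
Proof.
intros [i [Hi Hx]]; assert (H1 := node_bounds P i ltac:(lia)).
assert (H2 := node_bounds P (S i) ltac:(lia)); lra.
Qed.

(* The extension of each piece to the whole line encodes continuity up to
   the nodes, where the value of [f] is irrelevant for [pwc]. *)
Definition pwc (P : partition) (f : R -> R) : Prop :=
  forall i, (i < ncells P)%nat -> C0_in (node P i) (node P (S i)) f.

Definition pc1 (P : partition) (f : R -> R) : Prop :=
  forall i, (i < ncells P)%nat -> C1_on (node P i) (node P (S i)) f.

Create HintDb pw.

Lemma pwc_mult P f g : pwc P f -> pwc P g -> pwc P (fun x => f x * g x).
Proof. intros Hf Hg i Hi; apply C0_in_mult; auto. Qed.
Lemma pwc_plus P f g : pwc P f -> pwc P g -> pwc P (fun x => f x + g x).
Proof. intros Hf Hg i Hi; apply C0_in_plus; auto. Qed.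
Lemma pwc_continuous P f : (forall x, continuous f x) -> pwc P f.
Proof. intros Hf i Hi; exists f; split; [assumption|reflexivity]. Qed.
Lemma pwc_const P c : pwc P (fun _ => c).
Proof. apply pwc_continuous; intros; apply continuous_const. Qed.
Lemma pwc_ext P f g : (forall x, off_nodes P x -> f x = g x) -> pwc P f -> pwc P g.
Proof.
intros H Hf i Hi; apply (C0_in_ext _ _ f); [|apply Hf, Hi].
intros x Hx; apply H; exists i; split; assumption.
Qed.
Lemma pwc_opp P f : pwc P f -> pwc P (fun x => - f x).
Proof.
intros H; apply (pwc_ext P (fun x => (-1) * f x)); [intros; ring|].
apply pwc_mult; [apply pwc_const|assumption].
Qed.
Lemma pwc_minus P f g : pwc P f -> pwc P g -> pwc P (fun x => f x - g x).
Proof. intros Hf Hg; apply pwc_plus; [|apply pwc_opp]; assumption. Qed.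
Lemma pwc_pow2 P f : pwc P f -> pwc P (fun x => f x ^ 2).
Proof.
intros H; apply (pwc_ext P (fun x => f x * f x)); [intros; ring|].
apply pwc_mult; assumption.
Qed.
Lemma pc1_pwc P f : pc1 P f -> pwc P f.
Proof. intros H i Hi; apply C1_on_C0_in, H, Hi. Qed.
Lemma pc1_Derive P f : pc1 P f -> pwc P (Derive_on 0 1 f).
Proof.
intros H i Hi; apply C1_on_Derive_C0_in; [| |apply H, Hi]; apply node_bounds; lia.
Qed.
Lemma pc1_mult P f g : pc1 P f -> pc1 P g -> pc1 P (fun x => f x * g x).
Proof. intros Hf Hg i Hi; apply C1_on_mult; auto. Qed.
Lemma pc1_plus P f g : pc1 P f -> pc1 P g -> pc1 P (fun x => f x + g x).
Proof. intros Hf Hg i Hi; apply C1_on_plus; auto. Qed.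
Lemma pc1_const P c : pc1 P (fun _ => c).
Proof. intros i Hi; apply C1_on_const. Qed.
Lemma pc1_ext P f g : (forall x, 0 <= x <= 1 -> f x = g x) -> pc1 P f -> pc1 P g.
Proof.
intros H Hf i Hi; apply (C1_on_ext _ _ f); [|apply Hf, Hi].
intros x Hx; assert (H1 := node_bounds P i ltac:(lia)).
assert (H2 := node_bounds P (S i) ltac:(lia)); apply H; lra.
Qed.
Lemma pc1_opp P f : pc1 P f -> pc1 P (fun x => - f x).
Proof.
intros H; apply (pc1_ext P (fun x => (-1) * f x)); [intros; ring|].
apply pc1_mult; [apply pc1_const|assumption].
Qed.
Lemma pc1_minus P f g : pc1 P f -> pc1 P g -> pc1 P (fun x => f x - g x).
Proof. intros Hf Hg; apply pc1_plus; [|apply pc1_opp]; assumption. Qed.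
Lemma C1_on_pc1 P f : C1_on 0 1 f -> pc1 P f.
Proof.
intros H i Hi; apply (C1_on_sub 0 1); [| |assumption]; apply node_bounds; lia.
Qed.

#[export] Hint Resolve pwc_mult pwc_plus pwc_const pwc_opp pwc_minus pwc_pow2 pc1_pwc pc1_Derive
  pc1_mult pc1_plus pc1_const pc1_opp pc1_minus : pw.

Lemma pc1_is_derive P f x : pc1 P f -> off_nodes P x -> is_derive f x (Derive_on 0 1 f x).
Proof.
intros H [i [Hi Hx]]; destruct (H i Hi) as [g [dg [H1 [H2 H3]]]].
apply (C1_on_interior (node P i) (node P (S i)) f g dg x); try assumption;
  apply node_bounds; lia.
Qed.

Lemma Derive_on_is_derive (f : R -> R) (x l : R) : 0 < x < 1 -> is_derive f x l ->
  Derive_on 0 1 f x = l.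
Proof.
intros Hx H; apply is_derive_on_unique; [lra|lra|].
apply is_derive_is_derive_on; [lra|lra|assumption].
Qed.

Lemma Derive_on_mult P f g x : pc1 P f -> pc1 P g -> off_nodes P x ->
  Derive_on 0 1 (fun y => f y * g y) x = Derive_on 0 1 f x * g x + f x * Derive_on 0 1 g x.
Proof.
intros Hf Hg Hx; apply Derive_on_is_derive; [apply (off_nodes_bounds P), Hx|].
assert (H1 := pc1_is_derive P f x Hf Hx); assert (H2 := pc1_is_derive P g x Hg Hx).
apply is_derive_mult_R; assumption.
Qed.

Lemma Derive_on_plus P f g x : pc1 P f -> pc1 P g -> off_nodes P x ->
  Derive_on 0 1 (fun y => f y + g y) x = Derive_on 0 1 f x + Derive_on 0 1 g x.
Proof.
intros Hf Hg Hx; apply Derive_on_is_derive; [apply (off_nodes_bounds P), Hx|].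
apply (is_derive_plus (V := R_NormedModule)); apply (pc1_is_derive P); assumption.
Qed.

Lemma Derive_on_minus P f g x : pc1 P f -> pc1 P g -> off_nodes P x ->
  Derive_on 0 1 (fun y => f y - g y) x = Derive_on 0 1 f x - Derive_on 0 1 g x.
Proof.
intros Hf Hg Hx; apply Derive_on_is_derive; [apply (off_nodes_bounds P), Hx|].
apply (is_derive_minus (V := R_NormedModule)); apply (pc1_is_derive P); assumption.
Qed.

Lemma Derive_on_axpy P f g a x : pc1 P f -> pc1 P g -> off_nodes P x ->
  Derive_on 0 1 (fun y => f y + a * g y) x = Derive_on 0 1 f x + a * Derive_on 0 1 g x.
Proof.
intros Hf Hg Hx; apply Derive_on_is_derive; [apply (off_nodes_bounds P), Hx|].
apply (is_derive_plus (V := R_NormedModule)).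
- apply (pc1_is_derive P); assumption.
- apply (is_derive_scal g); apply (pc1_is_derive P); assumption.
Qed.

(** * Integrals of piecewise continuous functions *)

Definition int01 (f : R -> R) : R := RInt f 0 1.

Lemma pwc_ex_RInt_cell P f i : pwc P f -> (i < ncells P)%nat ->
  ex_RInt f (node P i) (node P (S i)).
Proof.
intros H Hi; destruct (H i Hi) as [g [H1 H2]].
assert (Hn := node_incr P i Hi).
apply (ex_RInt_ext g).
- intros x; rewrite Rmin_left, Rmax_right by lra; intros; symmetry; auto.
- apply continuous_ex_RInt; assumption.
Qed.

Lemma pwc_RInt_nodes P f n : pwc P f -> (n <= ncells P)%nat ->
  ex_RInt f 0 (node P n) /\
  @eq R (RInt f 0 (node P n)) (rsum n (fun i => RInt f (node P i) (node P (S i)))).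
Proof.
intros Hf; induction n as [|n IH]; intros Hn.
- rewrite node_first; split; [apply @ex_RInt_point|apply (@RInt_point R_CompleteNormedModule)].
- destruct IH as [H1 H2]; [lia|].
  assert (H3 := pwc_ex_RInt_cell P f n Hf ltac:(lia)); split.
  + apply (@ex_RInt_Chasles R_NormedModule) with (node P n); assumption.
  + rewrite <- (RInt_Chasles_R f 0 (node P n)) by assumption.
    simpl rsum; rewrite H2; reflexivity.
Qed.

Lemma int01_cells P f : pwc P f ->
  int01 f = rsum (ncells P) (fun i => RInt f (node P i) (node P (S i))).
Proof.
intros Hf; unfold int01; rewrite <- (node_last P).
apply pwc_RInt_nodes; [assumption|lia].
Qed.

Lemma pwc_ex_RInt P f : pwc P f -> ex_RInt f 0 1.
Proof.
intros Hf; rewrite <- (node_last P); apply (pwc_RInt_nodes P f (ncells P) Hf (Nat.le_refl _)).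
Qed.

Lemma int01_ext P f g : pwc P f -> (forall x, off_nodes P x -> f x = g x) -> int01 f = int01 g.
Proof.
intros Hf H; rewrite (int01_cells P f), (int01_cells P g) by (eauto using pwc_ext).
apply rsum_ext; intros i Hi; apply RInt_ext_R.
- apply Rlt_le, node_incr, Hi.
- intros x Hx; apply H; exists i; split; assumption.
Qed.

Lemma int01_le P f g : pwc P f -> pwc P g -> (forall x, off_nodes P x -> f x <= g x) ->
  int01 f <= int01 g.
Proof.
intros Hf Hg H; rewrite (int01_cells P f), (int01_cells P g) by assumption.
apply rsum_le; intros i Hi; apply RInt_le.
- apply Rlt_le, node_incr, Hi.
- apply pwc_ex_RInt_cell; assumption.
- apply pwc_ex_RInt_cell; assumption.
- intros x Hx; apply H; exists i; split; assumption.
Qed.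

Lemma int01_axpy P f g a : pwc P f -> pwc P g ->
  int01 (fun x => f x + a * g x) = int01 f + a * int01 g.
Proof. intros Hf Hg; apply RInt_lin; eapply pwc_ex_RInt; eassumption. Qed.

Lemma int01_const c : int01 (fun _ => c) = c.
Proof. unfold int01; rewrite RInt_const_R; ring. Qed.

Lemma int01_ge0 P f : pwc P f -> (forall x, off_nodes P x -> 0 <= f x) -> 0 <= int01 f.
Proof.
intros Hf H; rewrite <- (int01_const 0); apply (int01_le P); [apply pwc_const|assumption..].
Qed.

Lemma int01_scal P f a : pwc P f -> int01 (fun x => a * f x) = a * int01 f.
Proof.
intros Hf.
rewrite (int01_ext P _ (fun x => 0 + a * f x)) by (intros; try ring; eauto with pw).
rewrite (int01_axpy P), int01_const by (eauto with pw); ring.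
Qed.

Lemma int01_plus P f g : pwc P f -> pwc P g ->
  int01 (fun x => f x + g x) = int01 f + int01 g.
Proof.
intros Hf Hg.
rewrite (int01_ext P _ (fun x => f x + 1 * g x)) by (intros; try ring; eauto with pw).
rewrite (int01_axpy P) by assumption; ring.
Qed.

Lemma int01_minus P f g : pwc P f -> pwc P g ->
  int01 (fun x => f x - g x) = int01 f - int01 g.
Proof.
intros Hf Hg.
rewrite (int01_ext P _ (fun x => f x + (-1) * g x)) by (intros; try ring; eauto with pw).
rewrite (int01_axpy P) by assumption; ring.
Qed.

Lemma rsum_telescope (n : nat) (f : nat -> R) : rsum n (fun i => f (S i) - f i) = f n - f O.
Proof. induction n as [|n IH]; simpl; [ring|rewrite IH; ring]. Qed.

(** [pc1] prescribes [f] on closed cells, so [f] is continuous across the nodes and the cellwise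
    increments telescope. Every integration by parts below rests on this. *)
Lemma int01_Derive P f : pc1 P f -> int01 (Derive_on 0 1 f) = f 1 - f 0.
Proof.
intros Hf; rewrite (int01_cells P) by (eauto with pw).
rewrite (rsum_ext _ _ (fun i => f (node P (S i)) - f (node P i))).
- rewrite (rsum_telescope _ (fun i => f (node P i))), node_first, node_last; reflexivity.
- intros i Hi; apply C1_on_FTC; [| | |apply Hf, Hi].
  + apply node_bounds; lia.
  + apply Rlt_le, node_incr, Hi.
  + apply node_bounds; lia.
Qed.

(** * The finite element spaces *)

Lemma continuous_on_axpy (a b : R) (f g : R -> R) (c : R) : a <= b ->
  continuous_on (fun x => a <= x <= b) f -> continuous_on (fun x => a <= x <= b) g ->
  continuous_on (fun x => a <= x <= b) (fun x => f x + c * g x).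
Proof.
intros Hab Hf Hg; rewrite !continuous_on_clamp in * by assumption; intros x.
apply continuous_plus_R; [apply Hf|].
apply continuous_mult_R; [apply continuous_const|apply Hg].
Qed.

Lemma continuous_on_ext (a b : R) (f g : R -> R) : a <= b -> (forall x, a <= x <= b -> f x = g x) ->
  continuous_on (fun x => a <= x <= b) f -> continuous_on (fun x => a <= x <= b) g.
Proof.
intros Hab H Hf; rewrite !continuous_on_clamp in * by assumption; intros x.
apply (continuous_ext (fun y => f (clamp a b y))); [|apply Hf].
intros y; apply H, clamp_bounds, Hab.
Qed.

Lemma Ck_on_ext (k : nat) (a b : R) (f g : R -> R) : a < b ->
  (forall x, a <= x <= b -> f x = g x) -> Ck_on k a b f -> Ck_on k a b g.
Proof.
intros Hab; revert f g; induction k as [|k IH]; intros f g H [Hf Hk].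
- split; [|exact I]; apply (continuous_on_ext a b f); [lra|assumption..].
- split; [apply (continuous_on_ext a b f); [lra|assumption..]|]; destruct Hk as [Hd Hk]; split.
  + intros x Hx; destruct (Hd x Hx) as [l Hl]; exists l.
    apply (is_derive_on_ext a b f); assumption.
  + apply (IH (Derive_on a b f)); [|assumption].
    intros x Hx; apply Derive_on_ext; assumption.
Qed.

Lemma Ck_on_axpy (k : nat) (a b : R) (f g : R -> R) (c : R) : a < b ->
  Ck_on k a b f -> Ck_on k a b g -> Ck_on k a b (fun x => f x + c * g x).
Proof.
intros Hab; revert f g; induction k as [|k IH]; intros f g [Hf Hfk] [Hg Hgk].
- split; [|exact I]; apply continuous_on_axpy; [lra|assumption..].
- split; [apply continuous_on_axpy; [lra|assumption..]|].
  destruct Hfk as [Hfd Hfk]; destruct Hgk as [Hgd Hgk].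
  assert (HD : forall x, a <= x <= b -> is_derive_on a b (fun x => f x + c * g x) x
                 (Derive_on a b f x + c * Derive_on a b g x)).
  { intros x Hx; apply is_derive_on_axpy; apply Derive_on_correct; auto. }
  split; [intros x Hx; eexists; apply HD, Hx|].
  apply (Ck_on_ext k a b (fun x => Derive_on a b f x + c * Derive_on a b g x)); [assumption| |auto].
  intros x Hx; symmetry; apply is_derive_on_unique; auto.
Qed.

Lemma Ck_on_const (k : nat) (a b c : R) : a < b -> Ck_on k a b (fun _ => c).
Proof.
intros Hab; revert c; induction k as [|k IH]; intros c.
- split; [|exact I]; apply (continuous_continuous_on a b _ (fun _ => c)); [lra| |reflexivity].
  intros; apply continuous_const.
- split; [apply (continuous_continuous_on a b _ (fun _ => c)); [lra| |reflexivity];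
    intros; apply continuous_const|split].
  + intros x Hx; exists 0; apply is_derive_on_const.
  + apply (Ck_on_ext k a b (fun _ => 0)); [assumption| |apply IH].
    intros x Hx; symmetry; apply is_derive_on_unique; [assumption..|apply is_derive_on_const].
Qed.

Lemma Ck_on_le (j k : nat) (a b : R) (f : R -> R) : (j <= k)%nat -> Ck_on k a b f -> Ck_on j a b f.
Proof.
revert k f; induction j as [|j IH]; intros k f Hjk H.
- destruct k; split; try exact I; apply H.
- destruct k as [|k]; [lia|]; destruct H as [H1 [H2 H3]]; split; [assumption|split; [assumption|]].
  apply (IH k); [lia|assumption].
Qed.

Lemma Sh_zero (d k : nat) (P : partition) : Sh (S d) k P (fun _ => 0).
Proof.
split; [apply Ck_on_const; lra|].
intros i Hi; apply poly_on_polyn; exists (fun _ => 0); split; [apply polyn_const|reflexivity].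
Qed.

Lemma Sh_axpy (d k : nat) (P : partition) (f g : R -> R) (c : R) :
  Sh (S d) k P f -> Sh (S d) k P g -> Sh (S d) k P (fun x => f x + c * g x).
Proof.
intros [Hf1 Hf2] [Hg1 Hg2]; split; [apply Ck_on_axpy; [lra|assumption..]|].
intros i Hi; apply poly_on_polyn.
destruct (proj1 (poly_on_polyn _ _ _ _) (Hf2 i Hi)) as [f1 [H1 H2]].
destruct (proj1 (poly_on_polyn _ _ _ _) (Hg2 i Hi)) as [g1 [H3 H4]].
exists (fun x => f1 x + c * g1 x); split; [apply polyn_axpy; assumption|].
intros x Hx; rewrite H2, H4 by assumption; reflexivity.
Qed.

Lemma Sh0_zero (d k : nat) (P : partition) : Sh0 (S d) k P (fun _ => 0).
Proof. split; [apply Sh_zero|split; reflexivity]. Qed.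

Lemma Sh0_axpy (d k : nat) (P : partition) (f g : R -> R) (c : R) :
  Sh0 (S d) k P f -> Sh0 (S d) k P g -> Sh0 (S d) k P (fun x => f x + c * g x).
Proof.
intros [Hf [Hf0 Hf1]] [Hg [Hg0 Hg1]]; split; [apply Sh_axpy; assumption|].
rewrite Hf0, Hf1, Hg0, Hg1; split; ring.
Qed.

Lemma Sh_le (d j k : nat) (P : partition) (f : R -> R) : (j <= k)%nat ->
  Sh (S d) k P f -> Sh (S d) j P f.
Proof. intros Hjk [H1 H2]; split; [apply (Ck_on_le j k); assumption|assumption]. Qed.

Lemma Sh_cell (d k : nat) (P : partition) (f : R -> R) (i : nat) :
  Sh (S d) k P f -> (i < ncells P)%nat ->
  exists g dg, polyn d g /\ polyn d dg /\ (forall x, is_derive g x (dg x)) /\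
    (forall x, node P i <= x <= node P (S i) -> f x = g x) /\
    (forall x, node P i < x < node P (S i) -> Derive_on 0 1 f x = dg x).
Proof.
intros [_ H] Hi; destruct (proj1 (poly_on_polyn _ _ _ _) (H i Hi)) as [g [Hg Hf]].
destruct (polyn_derive d g Hg) as [dg [Hdg Hd]].
exists g, dg; split; [assumption|split; [assumption|split; [assumption|split; [assumption|]]]].
intros x Hx; apply (C1_on_interior (node P i) (node P (S i)) f g dg x); try assumption;
  apply node_bounds; lia.
Qed.

Lemma Sh_pc1 (d k : nat) (P : partition) (f : R -> R) : Sh (S d) k P f -> pc1 P f.
Proof.
intros H i Hi; destruct (Sh_cell d k P f i H Hi) as [g [dg [Hg [Hdg [H1 [H2 _]]]]]].
exists g, dg; split; [assumption|split; [|assumption]].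
intros x; apply (polyn_continuous d), Hdg.
Qed.

Lemma Sh0_pc1 (d k : nat) (P : partition) (f : R -> R) : Sh0 (S d) k P f -> pc1 P f.
Proof. intros [H _]; apply (Sh_pc1 d k), H. Qed.

#[export] Hint Resolve Sh_pc1 Sh0_pc1 : pw.

(** Cell by cell from [polyn_inverse], with [1 / cell P i <= q / mesh P] by quasiuniformity. The
    second bound is the first half of [polyn_inverse] for the derivative, again a polynomial of
    degree at most [d]. [K] depends on the degree alone; the dependence on [q] is explicit. *)
Lemma Sh_inverse (d : nat) : exists K, 0 <= K /\
  forall k P q v, quasiuniform q P -> Sh (S d) k P v ->
    mesh P ^ 2 * int01 (fun x => Derive_on 0 1 v x * Derive_on 0 1 v x)
      <= K * q ^ 2 * int01 (fun x => v x * v x) /\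
    forall x, off_nodes P x ->
      Derive_on 0 1 v x ^ 2
      <= K * q / mesh P * int01 (fun x => Derive_on 0 1 v x * Derive_on 0 1 v x).
Proof.
destruct (polyn_inverse d) as [K [HK0 HK]]; exists K; split; [assumption|].
intros k P q v Hq Hv; assert (Hm := mesh_pos P); assert (Hp := Sh_pc1 d k P v Hv).
assert (Hl : forall i, (i < ncells P)%nat -> 0 < cell P i /\ / cell P i <= q / mesh P /\ 0 < q).
{ intros i Hi; destruct (mesh_cell P i Hi) as [H1 H2]; assert (H := Hq i Hi).
  assert (H0 : 0 < mesh P / cell P i) by (apply Rdiv_lt_0_compat; lra).
  split; [assumption|split; [|lra]].
  apply Rmult_le_reg_l with (mesh P); [assumption|].
  replace (mesh P * (q / mesh P)) with q by (field; lra); exact H. }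
assert (Hsum : forall f, pwc P f -> (forall x, off_nodes P x -> 0 <= f x) -> forall i, (i < ncells P)%nat ->
  0 <= RInt f (node P i) (node P (S i)) <= int01 f).
{ intros f Hf H0.
  assert (H1 : forall i, (i < ncells P)%nat -> 0 <= RInt f (node P i) (node P (S i))).
  { intros i Hi; apply RInt_ge_0; [apply Rlt_le, node_incr, Hi|apply pwc_ex_RInt_cell; assumption|].
    intros x Hx; apply H0; exists i; split; assumption. }
  intros i Hi; split; [apply H1, Hi|].
  rewrite (int01_cells P f Hf).
  apply (rsum_term_le _ (fun i => RInt f (node P i) (node P (S i)))); assumption. }
split.
- rewrite !(int01_cells P), <- !rsum_scal by (eauto 6 with pw).
  apply rsum_le; intros i Hi.
  destruct (Hl i Hi) as [Hc [Hcq Hq0]].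
  destruct (Sh_cell d k P v i Hv Hi) as [g [dg [Hg [Hdg [Hd [H1 H2]]]]]].
  assert (Hn : node P (S i) = node P i + cell P i) by (unfold cell; ring).
  set (Iv := RInt (fun x => v x * v x) (node P i) (node P (S i))).
  assert (Hv0 : 0 <= Iv).
  { apply Hsum; [eauto with pw| |assumption]; intros; apply Rle_0_sqr. }
  assert (Hc3 : 0 < cell P i ^ 3) by (apply pow_lt, Hc).
  apply Rle_trans with (mesh P ^ 2 * (cell P i * (K / cell P i ^ 3 * Iv))).
  (* The pointwise bound [K / cell ^ 3] integrated over the cell leaves [K / cell ^ 2], matched by
     [mesh P ^ 2] up to [q ^ 2]. *)
  + apply Rmult_le_compat_l; [apply pow2_ge_0|].
    unfold cell at 1; rewrite <- (RInt_const_R (node P i) (node P (S i)) (K / cell P i ^ 3 * Iv)).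
    apply RInt_le; [lra|apply (pwc_ex_RInt_cell P); eauto with pw|apply @ex_RInt_const|].
    intros x Hx; rewrite H2 by assumption.
    assert (H3 := proj2 (HK (node P i) (cell P i) g dg Hc Hg Hd x ltac:(lra))).
    rewrite <- Hn in H3.
    rewrite (RInt_ext_R _ (fun x => v x * v x)) in H3;
      [fold Iv in H3; lra|lra|intros y Hy; rewrite H1 by lra; reflexivity].
  + replace (mesh P ^ 2 * (cell P i * (K / cell P i ^ 3 * Iv)))
      with (K * (mesh P * / cell P i) ^ 2 * Iv) by (field; lra).
    apply Rmult_le_compat_r; [assumption|]; apply Rmult_le_compat_l; [assumption|].
    apply pow_incr; split; [apply Rlt_le, Rdiv_lt_0_compat; lra|apply Hq, Hi].
- intros x [i [Hi Hx]]; destruct (Hl i Hi) as [Hc [Hcq Hq0]].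
  destruct (Sh_cell d k P v i Hv Hi) as [g [dg [Hg [Hdg [Hd [H1 H2]]]]]].
  assert (Hn : node P (S i) = node P i + cell P i) by (unfold cell; ring).
  destruct (polyn_derive d dg Hdg) as [ddg [_ Hdd]].
  rewrite H2 by assumption.
  assert (H3 := proj1 (HK (node P i) (cell P i) dg ddg Hc Hdg Hdd x ltac:(lra))).
  rewrite <- Hn in H3.
  destruct (Hsum (fun x => Derive_on 0 1 v x * Derive_on 0 1 v x)) with (i := i) as [H4 H5];
    [eauto with pw|intros; apply Rle_0_sqr|assumption|].
  rewrite (RInt_ext_R _ (fun x => Derive_on 0 1 v x * Derive_on 0 1 v x)) in H3;
    [|lra|intros y Hy; rewrite H2 by lra; reflexivity].
  eapply Rle_trans; [exact H3|].
  unfold Rdiv in *; rewrite (Rmult_assoc K q).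
  apply Rmult_le_compat; [|assumption| |assumption].
  + apply Rmult_le_pos; [assumption|apply Rlt_le, Rinv_0_lt_compat, Hc].
  + apply Rmult_le_compat_l; assumption.
Qed.

Lemma continuous_on_sqr_zero (f : R -> R) : continuous_on (fun x => 0 <= x <= 1) f ->
  int01 (fun x => f x * f x) = 0 -> forall x, 0 <= x <= 1 -> f x = 0.
Proof.
intros Hf H0 x Hx; rewrite continuous_on_clamp in Hf by lra.
rewrite <- (clamp_id 0 1 x Hx).
apply (RInt_sqr_zero (fun y => f (clamp 0 1 y)) 0 1); [lra|intros; apply Hf| |assumption].
rewrite (RInt_ext_R _ (fun x => f x * f x)); [exact H0|lra|].
intros y Hy; rewrite clamp_id by lra; reflexivity.
Qed.

Lemma int01_zero (f : R -> R) : (forall x, 0 < x < 1 -> f x = 0) -> int01 f = 0.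
Proof.
intros H; unfold int01; rewrite (RInt_ext_R _ (fun _ => 0)); [|lra|assumption].
rewrite RInt_const_R; ring.
Qed.

(** * Pairs of functions and the energy form *)

Definition fstf (v : bool * R -> R) : R -> R := fun x => v (true, x).
Definition sndf (v : bool * R -> R) : R -> R := fun x => v (false, x).
Definition pairf (z u : R -> R) : bool * R -> R :=
  fun p => if fst p then z (snd p) else u (snd p).

(** A pair is a single function on [bool * R], the Boolean selecting the component; the product
    space then falls under [orthonormal_basis], and one set of coordinates describes both
    unknowns. *)
Definition pair_space (d k : nat) (P : partition) (v : bool * R -> R) : Prop :=
  Sh (S d) k P (fstf v) /\ Sh0 (S d) k P (sndf v).

Definition pair_pc1 (P : partition) (v : bool * R -> R) : Prop :=
  pc1 P (fstf v) /\ pc1 P (sndf v).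

Definition energy_form (mu beta : R) (b : R -> R) (v w : bool * R -> R) : R :=
  inner (fstf v) (fstf w) + formA mu beta b (sndf v) (sndf w).

(** The two lower bounds of the theorem together with one common upper bound [M] on the
    coefficients. All constants of the estimates are expressed through these numbers, hence fixed
    before any partition. *)
Record bottom (mu beta : R) (b : R -> R) (c1 c2 M : R) : Prop := {
  bottom_mu : 0 < mu;
  bottom_c1 : 0 < c1;
  bottom_c2 : 0 < c2;
  bottom_eta_C1 : C1_on 0 1 (eta_b beta b);
  bottom_mass_pwc : forall P, pwc P (mass_coef mu beta b);
  bottom_eta_ge : forall x, 0 <= x <= 1 -> c1 <= eta_b beta b x;
  bottom_mass_ge : forall x, 0 <= x <= 1 -> c2 <= mass_coef mu beta b x;
  bottom_eta_le : forall x, 0 <= x <= 1 -> eta_b beta b x <= M;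
  bottom_deta_le : forall x, 0 <= x <= 1 -> Rabs (Derive_on 0 1 (eta_b beta b) x) <= M;
  bottom_mass_le : forall x, 0 <= x <= 1 -> mass_coef mu beta b x <= M
}.

Arguments bottom_mu {mu beta b c1 c2 M}.
Arguments bottom_c1 {mu beta b c1 c2 M}.
Arguments bottom_c2 {mu beta b c1 c2 M}.
Arguments bottom_eta_C1 {mu beta b c1 c2 M}.
Arguments bottom_mass_pwc {mu beta b c1 c2 M}.
Arguments bottom_eta_ge {mu beta b c1 c2 M}.
Arguments bottom_mass_ge {mu beta b c1 c2 M}.
Arguments bottom_eta_le {mu beta b c1 c2 M}.
Arguments bottom_deta_le {mu beta b c1 c2 M}.
Arguments bottom_mass_le {mu beta b c1 c2 M}.

Lemma bottom_M_pos mu beta b c1 c2 M : bottom mu beta b c1 c2 M -> 0 < M.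
Proof.
intros H; assert (H1 := bottom_eta_ge H 0 ltac:(lra)).
assert (H2 := bottom_eta_le H 0 ltac:(lra)); assert (H3 := bottom_c1 H); lra.
Qed.

Lemma bottom_bound_pos mu beta b c1 c2 M : bottom mu beta b c1 c2 M -> 0 <= M + mu / 3 * M ^ 3.
Proof.
intros H; assert (HM := bottom_M_pos _ _ _ _ _ _ H); assert (Hmu := bottom_mu H).
assert (0 <= mu / 3 * M ^ 3) by (apply Rmult_le_pos; [lra|apply pow_le; lra]); lra.
Qed.

Lemma bottom_eta_pc1 mu beta b c1 c2 M P : bottom mu beta b c1 c2 M -> pc1 P (eta_b beta b).
Proof. intros H; apply C1_on_pc1, H. Qed.

Lemma bottom_eta3_pwc mu beta b c1 c2 M P : bottom mu beta b c1 c2 M ->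
  pwc P (fun x => eta_b beta b x ^ 3).
Proof.
intros H; assert (H1 := bottom_eta_pc1 mu beta b c1 c2 M P H).
apply (pwc_ext P (fun x => eta_b beta b x * (eta_b beta b x * eta_b beta b x)));
  [intros; ring|eauto with pw].
Qed.

Lemma inner_axpy_l P f g h a : pwc P f -> pwc P g -> pwc P h ->
  inner (fun x => f x + a * g x) h = inner f h + a * inner g h.
Proof.
intros Hf Hg Hh; change (int01 (fun x => (f x + a * g x) * h x)
  = int01 (fun x => f x * h x) + a * int01 (fun x => g x * h x)).
rewrite <- (int01_axpy P) by (eauto with pw).
apply (int01_ext P); [eauto 6 with pw|intros; ring].
Qed.

Lemma inner_comm f g : inner f g = inner g f.
Proof. apply RInt_ext_R; [lra|intros; ring]. Qed.

Lemma inner_ext P f g f' g' : pwc P f -> pwc P g ->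
  (forall x, off_nodes P x -> f x = f' x) -> (forall x, off_nodes P x -> g x = g' x) ->
  inner f g = inner f' g'.
Proof.
intros Hf Hg H1 H2; apply (int01_ext P (fun x => f x * g x)); [eauto with pw|].
intros x Hx; rewrite H1, H2 by assumption; reflexivity.
Qed.

Lemma formA_axpy_l mu beta b c1 c2 M P f g h a : bottom mu beta b c1 c2 M ->
  pc1 P f -> pc1 P g -> pc1 P h ->
  formA mu beta b (fun x => f x + a * g x) h = formA mu beta b f h + a * formA mu beta b g h.
Proof.
intros HB Hf Hg Hh; unfold formA.
assert (Hm := bottom_mass_pwc HB P); assert (He := bottom_eta3_pwc _ _ _ _ _ _ P HB).
assert (pwc P (Derive_on 0 1 f)) by (eauto with pw).
assert (pwc P (Derive_on 0 1 g)) by (eauto with pw).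
rewrite (inner_ext P (fun x => mass_coef mu beta b x * (f x + a * g x)) h
  (fun x => mass_coef mu beta b x * f x + a * (mass_coef mu beta b x * g x)) h)
  by (intros; try ring; eauto 8 with pw).
rewrite (inner_ext P (fun x => eta_b beta b x ^ 3 * Derive_on 0 1 (fun y => f y + a * g y) x) (Derive_on 0 1 h)
  (fun x => eta_b beta b x ^ 3 * Derive_on 0 1 f x + a * (eta_b beta b x ^ 3 * Derive_on 0 1 g x))
  (Derive_on 0 1 h)).
- rewrite !(inner_axpy_l P) by (eauto 8 with pw); ring.
- eauto 10 with pw.
- eauto with pw.
- intros x Hx; rewrite (Derive_on_axpy P) by assumption; ring.
- reflexivity.
Qed.

Lemma formA_comm mu beta b f g : formA mu beta b f g = formA mu beta b g f.
Proof.
unfold formA, inner; f_equal; [|f_equal]; apply RInt_ext_R; try lra; intros; ring.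
Qed.

Lemma inner_weight P f m m' : pwc P f -> pwc P m -> pwc P m' ->
  (forall x, 0 < x < 1 -> m' x <= m x) ->
  inner (fun x => m' x * f x) f <= inner (fun x => m x * f x) f.
Proof.
intros Hf Hm Hm' H; apply (int01_le P); [auto with pw..|]; intros x Hx.
rewrite !Rmult_assoc; apply Rmult_le_compat_r; [apply Rle_0_sqr|].
apply H, (off_nodes_bounds P), Hx.
Qed.

Lemma inner_scal_l P a f g : pwc P f -> pwc P g -> inner (fun x => a * f x) g = a * inner f g.
Proof.
intros Hf Hg; change (int01 (fun x => a * f x * g x) = a * int01 (fun x => f x * g x)).
rewrite <- (int01_scal P) by (auto with pw).
apply (int01_ext P); [auto with pw|intros; ring].
Qed.

(** The zero-order weight is at least [c2] and the derivative weight at least [mu / 3 * c1 ^ 3]; the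
    smaller of the two serves both terms. Through this the energy controls the H^1 norm of the
    second component. *)
Lemma formA_coercive mu beta b c1 c2 M P f : bottom mu beta b c1 c2 M -> pc1 P f ->
  Rmin c2 (mu / 3 * c1 ^ 3) * (inner f f + inner (Derive_on 0 1 f) (Derive_on 0 1 f))
  <= formA mu beta b f f.
Proof.
intros HB Hf; unfold formA.
assert (Hm := bottom_mass_pwc HB P); assert (He := bottom_eta3_pwc _ _ _ _ _ _ P HB).
assert (Hmu := bottom_mu HB); assert (Hc1 := bottom_c1 HB).
assert (HD : pwc P (Derive_on 0 1 f)) by (eauto with pw).
assert (H1 : c2 * inner f f <= inner (fun x => mass_coef mu beta b x * f x) f).
{ rewrite <- (inner_scal_l P) by (auto with pw); apply (inner_weight P f _ (fun _ => c2)); auto with pw; intros x Hx; apply HB; lra. }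
assert (H2 : c1 ^ 3 * inner (Derive_on 0 1 f) (Derive_on 0 1 f)
  <= inner (fun x => eta_b beta b x ^ 3 * Derive_on 0 1 f x) (Derive_on 0 1 f)).
{ rewrite <- (inner_scal_l P) by (auto with pw); apply (inner_weight P (Derive_on 0 1 f) _ (fun _ => c1 ^ 3)); auto with pw.
  intros x Hx; apply pow_incr; split; [lra|apply HB; lra]. }
assert (H3 : 0 <= inner f f) by (apply (int01_ge0 P); [eauto with pw|intros; apply Rle_0_sqr]).
assert (H4 : 0 <= inner (Derive_on 0 1 f) (Derive_on 0 1 f))
  by (apply (int01_ge0 P); [eauto with pw|intros; apply Rle_0_sqr]).
assert (H5 := Rmin_l c2 (mu / 3 * c1 ^ 3)); assert (H6 := Rmin_r c2 (mu / 3 * c1 ^ 3)).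
set (al := Rmin _ _) in *.
assert (al * inner f f <= c2 * inner f f) by (apply Rmult_le_compat_r; assumption).
assert (al * inner (Derive_on 0 1 f) (Derive_on 0 1 f)
  <= mu / 3 * c1 ^ 3 * inner (Derive_on 0 1 f) (Derive_on 0 1 f)) by (apply Rmult_le_compat_r; assumption).
assert (mu / 3 * (c1 ^ 3 * inner (Derive_on 0 1 f) (Derive_on 0 1 f))
  <= mu / 3 * inner (fun x => eta_b beta b x ^ 3 * Derive_on 0 1 f x) (Derive_on 0 1 f))
  by (apply Rmult_le_compat_l; lra).
lra.
Qed.

Lemma formA_bounded mu beta b c1 c2 M P f : bottom mu beta b c1 c2 M -> pc1 P f ->
  formA mu beta b f f
  <= (M + mu / 3 * M ^ 3) * (inner f f + inner (Derive_on 0 1 f) (Derive_on 0 1 f)).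
Proof.
intros HB Hf; unfold formA.
assert (Hm := bottom_mass_pwc HB P); assert (He := bottom_eta3_pwc _ _ _ _ _ _ P HB).
assert (Hmu := bottom_mu HB); assert (Hc1 := bottom_c1 HB).
assert (HD : pwc P (Derive_on 0 1 f)) by (eauto with pw).
assert (H1 : inner (fun x => mass_coef mu beta b x * f x) f <= M * inner f f).
{ rewrite <- (inner_scal_l P) by (auto with pw); apply (inner_weight P f (fun _ => M)); auto with pw; intros x Hx; apply HB; lra. }
assert (H2 : inner (fun x => eta_b beta b x ^ 3 * Derive_on 0 1 f x) (Derive_on 0 1 f)
  <= M ^ 3 * inner (Derive_on 0 1 f) (Derive_on 0 1 f)).
{ rewrite <- (inner_scal_l P) by (auto with pw); apply (inner_weight P (Derive_on 0 1 f) (fun _ => M ^ 3)); auto with pw.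
  intros x Hx; assert (H := bottom_eta_ge HB x ltac:(lra)).
  apply pow_incr; split; [lra|apply HB; lra]. }
assert (H3 : 0 <= inner f f) by (apply (int01_ge0 P); [eauto with pw|intros; apply Rle_0_sqr]).
assert (H4 : 0 <= inner (Derive_on 0 1 f) (Derive_on 0 1 f))
  by (apply (int01_ge0 P); [eauto with pw|intros; apply Rle_0_sqr]).
assert (HM := bottom_M_pos _ _ _ _ _ _ HB).
assert (H7 : 0 < M ^ 3) by (apply pow_lt, HM).
assert (0 <= M * inner (Derive_on 0 1 f) (Derive_on 0 1 f)) by (apply Rmult_le_pos; lra).
assert (0 <= mu / 3 * M ^ 3 * inner f f) by (repeat apply Rmult_le_pos; lra).
assert (mu / 3 * inner (fun x => eta_b beta b x ^ 3 * Derive_on 0 1 f x) (Derive_on 0 1 f)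
  <= mu / 3 * (M ^ 3 * inner (Derive_on 0 1 f) (Derive_on 0 1 f)))
  by (apply Rmult_le_compat_l; lra).
lra.
Qed.

Lemma coercive_pos mu c1 c2 : 0 < mu -> 0 < c1 -> 0 < c2 -> 0 < Rmin c2 (mu / 3 * c1 ^ 3).
Proof.
intros H1 H2 H3; apply Rmin_glb_lt; [assumption|].
apply Rmult_lt_0_compat; [lra|apply pow_lt, H2].
Qed.

Lemma inner_ge0 P f : pwc P f -> 0 <= inner f f.
Proof. intros Hf; apply (int01_ge0 P); [eauto with pw|intros; apply Rle_0_sqr]. Qed.

Lemma formA_ge mu beta b c1 c2 M P f : bottom mu beta b c1 c2 M -> pc1 P f ->
  0 <= formA mu beta b f f.
Proof.
intros HB Hf; eapply Rle_trans; [|apply (formA_coercive _ _ _ _ _ _ P f HB Hf)].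
apply Rmult_le_pos; [apply Rlt_le, coercive_pos; apply HB|].
apply Rplus_le_le_0_compat; apply (inner_ge0 P); eauto with pw.
Qed.

Lemma energy_inner_space mu beta b c1 c2 M P : bottom mu beta b c1 c2 M ->
  inner_space (pair_pc1 P) (energy_form mu beta b).
Proof.
intros HB; constructor.
- split; apply pc1_const.
- intros v w a [Hv1 Hv2] [Hw1 Hw2]; split.
  + apply (pc1_plus P (fstf v)); [assumption|apply pc1_mult; [apply pc1_const|assumption]].
  + apply (pc1_plus P (sndf v)); [assumption|apply pc1_mult; [apply pc1_const|assumption]].
- intros v w z a [Hv1 Hv2] [Hw1 Hw2] [Hz1 Hz2]; unfold energy_form.
  change (fstf (fun p => v p + a * w p)) with (fun x => fstf v x + a * fstf w x).
  change (sndf (fun p => v p + a * w p)) with (fun x => sndf v x + a * sndf w x).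
  rewrite (inner_axpy_l P), (formA_axpy_l mu beta b c1 c2 M P) by (eauto with pw); ring.
- intros; unfold energy_form; rewrite inner_comm, formA_comm; reflexivity.
- intros v [Hv1 Hv2]; apply Rplus_le_le_0_compat.
  + apply (inner_ge0 P); eauto with pw.
  + apply (formA_ge mu beta b c1 c2 M P); assumption.
Qed.

Lemma inner_space_sub {I : Type} (V W : (I -> R) -> Prop) B : inner_space W B ->
  (forall v, V v -> W v) -> V (fun _ => 0) ->
  (forall v w a, V v -> V w -> V (fun p => v p + a * w p)) -> inner_space V B.
Proof.
intros H HVW H0 H1; constructor; [assumption|assumption| | |].
- intros; apply (inner_space_lin W B H); auto.
- intros; apply (inner_space_sym W B H); auto.
- intros; apply (inner_space_ge0 W B H); auto.
Qed.

Lemma pair_space_pc1 d k P v : pair_space d k P v -> pair_pc1 P v.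
Proof. intros [H1 H2]; split; eauto with pw. Qed.

Lemma pair_space_zero d k P : pair_space d k P (fun _ => 0).
Proof. split; [apply Sh_zero|apply Sh0_zero]. Qed.

Lemma pair_space_axpy d k P v w a : pair_space d k P v -> pair_space d k P w ->
  pair_space d k P (fun p => v p + a * w p).
Proof.
intros [Hv1 Hv2] [Hw1 Hw2]; split;
  [apply (Sh_axpy d k P (fstf v) (fstf w))|apply (Sh0_axpy d k P (sndf v) (sndf w))]; assumption.
Qed.

Lemma energy_inner_space_pair mu beta b c1 c2 M d k P : bottom mu beta b c1 c2 M ->
  inner_space (pair_space d k P) (energy_form mu beta b).
Proof.
intros HB; apply (inner_space_sub _ (pair_pc1 P)).
- apply (energy_inner_space mu beta b c1 c2 M), HB.
- apply pair_space_pc1.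
- apply pair_space_zero.
- intros; apply pair_space_axpy; assumption.
Qed.

(** On each cell the spline is a polynomial of degree [d] with [d + 1] distinct roots. *)
Lemma Sh_zero_points d k P f : Sh (S d) k P f ->
  (forall i j, (i < ncells P)%nat -> (j <= d)%nat ->
     f (node P i + cell P i * (INR j / INR (S d))) = 0) ->
  forall x, 0 <= x <= 1 -> f x = 0.
Proof.
intros Hf H0 x Hx; destruct (in_some_cell P x Hx) as [i [Hi Hxi]].
destruct (Sh_cell d k P f i Hf Hi) as [g [dg [Hg [_ [_ [H1 _]]]]]].
assert (Hc := mesh_cell P i Hi).
assert (Hd : 0 < INR (S d)) by (apply lt_0_INR; lia).
rewrite H1 by assumption.
apply (polyn_roots d (fun j => node P i + cell P i * (INR j / INR (S d))) g Hg).
- intros j1 j2 Hj Heq.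
  assert (Heq' : cell P i * (INR j1 / INR (S d)) = cell P i * (INR j2 / INR (S d))) by lra.
  apply Rmult_eq_reg_l in Heq'; [|lra].
  apply Rmult_eq_reg_r in Heq'; [apply INR_eq in Heq'; lia|apply Rinv_neq_0_compat; lra].
- intros j Hj; rewrite <- H1; [apply H0; assumption|].
  assert (Hj0 : 0 <= INR j / INR (S d)) by (apply Rdiv_le_0_compat; [apply pos_INR|assumption]).
  assert (Hj1 : INR j / INR (S d) <= 1).
  { apply Rle_div_l; [assumption|]; rewrite Rmult_1_l; apply le_INR; lia. }
  assert (0 <= cell P i * (INR j / INR (S d))) by (apply Rmult_le_pos; lra).
  assert (cell P i * (INR j / INR (S d)) <= cell P i * 1) by (apply Rmult_le_compat_l; lra).
  replace (node P (S i)) with (node P i + cell P i) by (unfold cell; ring); lra.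
Qed.

(** Null L^2 norms force vanishing at every point of [0, 1] because splines are continuous already
    for [k = 0]. *)
Lemma pair_space_definite mu beta b c1 c2 M d k P v : bottom mu beta b c1 c2 M ->
  pair_space d k P v -> energy_form mu beta b v v = 0 ->
  forall p, 0 <= snd p <= 1 -> v p = 0.
Proof.
intros HB [H1 H2] H0; unfold energy_form in H0.
assert (HA := formA_coercive mu beta b c1 c2 M P (sndf v) HB ltac:(eauto with pw)).
assert (Hal := coercive_pos mu c1 c2 (bottom_mu HB) (bottom_c1 HB) (bottom_c2 HB)).
assert (I1 : 0 <= inner (fstf v) (fstf v)) by (apply (inner_ge0 P); eauto with pw).
assert (I2 : 0 <= inner (sndf v) (sndf v)) by (apply (inner_ge0 P); eauto with pw).
assert (I3 : 0 <= inner (Derive_on 0 1 (sndf v)) (Derive_on 0 1 (sndf v)))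
  by (apply (inner_ge0 P); eauto with pw).
set (al := Rmin _ _) in *.
assert (I4 : 0 <= al * inner (sndf v) (sndf v)) by (apply Rmult_le_pos; lra).
assert (I5 : 0 <= al * inner (Derive_on 0 1 (sndf v)) (Derive_on 0 1 (sndf v))) by (apply Rmult_le_pos; lra).
assert (I6 : al * inner (sndf v) (sndf v) = 0) by lra.
assert (I7 : inner (fstf v) (fstf v) = 0) by lra.
apply Rmult_integral in I6; destruct I6 as [I6|I6]; [lra|].
intros [[] x] Hx; simpl in Hx.
- apply (continuous_on_sqr_zero (fstf v)); [|exact I7|assumption].
  destruct H1 as [H1 _]; destruct k; apply H1.
- apply (continuous_on_sqr_zero (sndf v)); [|exact I6|assumption].
  destruct H2 as [[H2 _] _]; destruct k; apply H2.
Qed.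

(** The last clause passes properties of point values, such as differentiability in time, on to the
    coordinates. *)
Lemma pair_space_basis mu beta b c1 c2 M d k P : bottom mu beta b c1 c2 M ->
  exists (n : nat) (E : nat -> bool * R -> R),
    orthonormal (pair_space d k P) (energy_form mu beta b) n E /\
    (forall v, pair_space d k P v -> forall p, 0 <= snd p <= 1 ->
       v p = lcomb n (coords (energy_form mu beta b) E v) E p) /\
    (forall Q : ((bool * R -> R) -> R) -> Prop,
       Q (fun _ => 0) ->
       (forall f g a, Q f -> Q g -> Q (fun v => f v + a * g v)) ->
       (forall f g, (forall v, pair_space d k P v -> f v = g v) -> Q f -> Q g) ->
       (forall p, 0 <= snd p <= 1 -> Q (fun v => v p)) ->
       forall i, (i < n)%nat -> Q (fun v => energy_form mu beta b v (E i))).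
Proof.
intros HB.
(* Finitely many points: evaluations of both components there determine a pair, so they can serve as
   the list of functionals. *)
set (pts := flat_map (fun i => map (fun j => node P i + cell P i * (INR j / INR (S d)))
                                 (List.seq 0 (S d))) (List.seq 0 (ncells P))).
assert (Hpts : forall x, In x pts <-> exists i j, (i < ncells P)%nat /\ (j <= d)%nat /\
  x = node P i + cell P i * (INR j / INR (S d))).
{ intros x; unfold pts; rewrite in_flat_map; split.
  - intros [i [Hi Hj]]; apply in_map_iff in Hj; destruct Hj as [j [Hj1 Hj2]].
    apply in_seq in Hi, Hj2; exists i, j; split; [lia|split; [lia|symmetry; assumption]].
  - intros [i [j [Hi [Hj ->]]]]; exists i; split; [apply in_seq; lia|].
    apply in_map_iff; exists j; split; [reflexivity|apply in_seq; lia]. }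
assert (Hpts01 : forall x, In x pts -> 0 <= x <= 1).
{ intros x Hx; apply Hpts in Hx; destruct Hx as [i [j [Hi [Hj ->]]]].
  assert (Hc := mesh_cell P i Hi).
  assert (Hd : 0 < INR (S d)) by (apply lt_0_INR; lia).
  assert (Hj0 : 0 <= INR j / INR (S d)) by (apply Rdiv_le_0_compat; [apply pos_INR|assumption]).
  assert (Hj1 : INR j / INR (S d) <= 1).
  { apply Rle_div_l; [assumption|]; rewrite Rmult_1_l; apply le_INR; lia. }
  assert (0 <= cell P i * (INR j / INR (S d))) by (apply Rmult_le_pos; lra).
  assert (cell P i * (INR j / INR (S d)) <= cell P i * 1) by (apply Rmult_le_compat_l; lra).
  assert (node P (S i) = node P i + cell P i) by (unfold cell; ring).
  assert (Hb1 := node_bounds P i ltac:(lia)); assert (Hb2 := node_bounds P (S i) ltac:(lia)); lra. }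
set (ev := fun p (v : bool * R -> R) => v p).
set (l := map (fun x => ev (true, x)) pts ++ map (fun x => ev (false, x)) pts).
assert (Hl : forall f, In f l <-> exists c x, In x pts /\ f = ev (c, x)).
{ intros f; unfold l; rewrite in_app_iff, !in_map_iff; split.
  - intros [[x [<- Hx]]|[x [<- Hx]]]; [exists true, x|exists false, x]; auto.
  - intros [[] [x [Hx ->]]]; [left|right]; exists x; auto. }
assert (HI := energy_inner_space_pair mu beta b c1 c2 M d k P HB).
destruct (orthonormal_basis (energy_form mu beta b) l (pair_space d k P) HI) as [n [E [HO [HC HQ]]]].
- intros f Hf v w a _ _; apply Hl in Hf; destruct Hf as [c [x [_ ->]]]; reflexivity.
- intros v Hv H0 f Hf; apply Hl in Hf; destruct Hf as [c [x [Hx ->]]].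
  apply (pair_space_definite mu beta b c1 c2 M d k P); try assumption; apply Hpts01, Hx.
- intros v [Hv1 Hv2] H0.
  assert (Hz : forall c x, In x pts -> v (c, x) = 0).
  { intros c x Hx; apply (H0 (ev (c, x))), Hl; exists c, x; auto. }
  assert (H1 : forall x, 0 <= x <= 1 -> fstf v x = 0).
  { apply (Sh_zero_points d k P); [assumption|].
    intros i j Hi Hj; apply Hz, Hpts; exists i, j; auto. }
  assert (H2 : forall x, 0 <= x <= 1 -> sndf v x = 0).
  { apply (Sh_zero_points d k P); [apply Hv2|].
    intros i j Hi Hj; apply Hz, Hpts; exists i, j; auto. }
  assert (H3 : forall x, 0 <= x <= 1 -> Derive_on 0 1 (sndf v) x = 0).
  { intros x Hx; rewrite (Derive_on_ext 0 1 _ (fun _ => 0)) by assumption.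
    apply is_derive_on_unique; [lra|assumption|apply is_derive_on_const]. }
  assert (Z : forall f g, (forall x, 0 <= x <= 1 -> g x = 0) -> inner f g = 0).
  { intros f g H; apply int01_zero; intros x Hx; rewrite H by lra; ring. }
  unfold energy_form, formA; rewrite !Z by assumption; ring.
- exists n, E; split; [assumption|split].
  + intros v Hv p Hp.
    assert (Hl' : pair_space d k P (lcomb n (coords (energy_form mu beta b) E v) E)).
    { apply lcomb_closed; [apply pair_space_zero|intros; apply pair_space_axpy; assumption|apply HO]. }
    assert (H := pair_space_definite mu beta b c1 c2 M d k P _ HB
      (pair_space_axpy d k P _ _ (-1) Hv Hl') (HC v Hv) p Hp).
    cbv beta in H; lra.
  + intros Q Q0 Q1 Q2 Q3; apply HQ; try assumption.
    intros f Hf; apply Hl in Hf; destruct Hf as [c [x [Hx ->]]]; apply Q3, Hpts01, Hx.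
Qed.

(** * Approximation by splines *)

Definition prim (s : R -> R) (x : R) : R := RInt (fun y => s (clamp 0 1 y)) 0 x.

Lemma prim_derive (s : R -> R) (x : R) : continuous_on (fun x => 0 <= x <= 1) s ->
  is_derive (prim s) x (s (clamp 0 1 x)).
Proof.
intros Hs; rewrite continuous_on_clamp in Hs by lra.
apply (is_derive_RInt_continuous (fun y => s (clamp 0 1 y))), Hs.
Qed.

Lemma prim_zero (s : R -> R) : prim s 0 = 0.
Proof. unfold prim; apply (@RInt_point R_CompleteNormedModule). Qed.

Lemma ex_RInt_clamp (s : R -> R) (a b : R) : continuous_on (fun x => 0 <= x <= 1) s ->
  ex_RInt (fun y => s (clamp 0 1 y)) a b.
Proof. intros Hs; rewrite continuous_on_clamp in Hs by lra; apply continuous_ex_RInt, Hs. Qed.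

Lemma prim_minus (s : R -> R) (x y : R) : continuous_on (fun x => 0 <= x <= 1) s ->
  prim s y - prim s x = RInt (fun z => s (clamp 0 1 z)) x y.
Proof.
intros Hs; unfold prim.
rewrite <- (RInt_Chasles_R _ 0 x y) by (apply ex_RInt_clamp, Hs); ring.
Qed.

Lemma prim_one (s : R -> R) : prim s 1 = int01 s.
Proof. apply RInt_ext_R; [lra|]; intros x Hx; rewrite clamp_id by lra; reflexivity. Qed.

Lemma Ck_on_0 (k : nat) (a b : R) (f : R -> R) : Ck_on k a b f ->
  continuous_on (fun x => a <= x <= b) f.
Proof. destruct k; intros H; apply H. Qed.

(** Integration raises degree and smoothness together and thereby keeps their difference; it is the
    step from one degree to the next in both inductions below. *)
Lemma Sh_integrate (d k : nat) (P : partition) (s : R -> R) (c : R) :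
  Sh (S d) k P s -> Sh (S (S d)) (S k) P (fun x => c + prim s x).
Proof.
intros Hs; assert (Hc := Ck_on_0 _ _ _ _ (proj1 Hs)).
assert (Hd : forall x, is_derive (fun x => c + prim s x) x (s (clamp 0 1 x))).
{ intros x; replace (s (clamp 0 1 x)) with (0 + s (clamp 0 1 x)) by ring.
  apply (is_derive_plus (V := R_NormedModule)); [apply @is_derive_const|apply prim_derive, Hc]. }
assert (Hd' : forall x, 0 <= x <= 1 -> is_derive_on 0 1 (fun x => c + prim s x) x (s x)).
{ intros x Hx; apply is_derive_is_derive_on; [lra|assumption|].
  rewrite <- (clamp_id 0 1 x Hx) at 2; apply Hd. }
split.
- split; [|split].
  + apply (continuous_continuous_on 0 1 _ (fun x => c + prim s x)); [lra| |reflexivity].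
    intros x _; apply (@ex_derive_continuous R_AbsRing R_NormedModule); eexists; apply Hd.
  + intros x Hx; eexists; apply Hd', Hx.
  + apply (Ck_on_ext k 0 1 s); [lra| |apply Hs].
    intros x Hx; symmetry; apply is_derive_on_unique; [lra|assumption|apply Hd', Hx].
- intros i Hi; apply poly_on_polyn.
  destruct (Sh_cell d k P s i Hs Hi) as [g [_ [Hg [_ [_ [Hsg _]]]]]].
  destruct (polyn_antiderive d g Hg) as [G [HG HdG]].
  exists (fun x => G x + (c + prim s (node P i) - G (node P i)) * 1); split.
  + apply (polyn_axpy (S d) G (fun _ => 1)); [assumption|apply polyn_const].
  + intros x Hx.
    assert (H : prim s x - prim s (node P i) = G x - G (node P i)); [|lra].
    rewrite prim_minus by assumption.
    assert (H1 := node_bounds P i ltac:(lia)); assert (H2 := node_bounds P (S i) ltac:(lia)).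
    rewrite (RInt_ext_R _ g) by (intros; try rewrite clamp_id; try apply Hsg; lra).
    apply is_RInt_unique, (is_RInt_derive G g); intros; [apply HdG|].
    apply (polyn_continuous d), Hg.
Qed.

Lemma node_diff (P : partition) (i w : nat) : (i + w <= ncells P)%nat ->
  node P (i + w) - node P i <= INR w * mesh P.
Proof.
induction w as [|w IH]; intros H; [rewrite Nat.add_0_r; simpl; lra|].
rewrite S_INR; replace (i + S w)%nat with (S (i + w)) by lia.
assert (H1 := IH ltac:(lia)); destruct (mesh_cell P (i + w) ltac:(lia)) as [_ H2].
unfold cell in H2; lra.
Qed.

(* A spline rising from 0 to 1 across 2^d consecutive cells: the normalized
   primitive of a bump, itself a difference of two such splines of one degree
   less that rise on adjacent blocks of cells. *)
Lemma step_spline (d : nat) : forall P i, (i + 2 ^ d <= ncells P)%nat ->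
  exists H, Sh (S (S d)) d P H /\ (forall x, 0 <= x <= 1 -> 0 <= H x <= 1) /\
    (forall x, 0 <= x <= node P i -> H x = 0) /\
    (forall x, node P (i + 2 ^ d) <= x <= 1 -> H x = 1).
Proof.
induction d as [|d IH]; intros P i Hi.
- simpl in Hi |- *; replace (i + 1)%nat with (S i) in * by lia.
  assert (Hn := node_incr P i ltac:(lia)).
  assert (Hpos : forall x, x <= node P i -> (x - node P i) / (node P (S i) - node P i) <= 0).
  { intros x Hx; apply Rle_div_l; lra. }
  assert (Hbig : forall x, node P (S i) <= x -> 1 <= (x - node P i) / (node P (S i) - node P i)).
  { intros x Hx; apply Rle_div_r; lra. }
  assert (Hl : forall x, x <= node P i -> clamp 0 1 ((x - node P i) / (node P (S i) - node P i)) = 0).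
  { intros x Hx; specialize (Hpos x Hx); unfold clamp; rewrite Rmin_right, Rmax_left; lra. }
  assert (Hr : forall x, node P (S i) <= x -> clamp 0 1 ((x - node P i) / (node P (S i) - node P i)) = 1).
  { intros x Hx; specialize (Hbig x Hx); unfold clamp; rewrite Rmin_left, Rmax_right; lra. }
  (* In degree 1 the step is the affine ramp across a single cell, cut off at 0 and 1. *)
  exists (fun x => clamp 0 1 ((x - node P i) / (node P (S i) - node P i))).
  split; [split|split; [|split]].
  + split; [|exact I].
    apply (continuous_continuous_on 0 1 _ (fun x => clamp 0 1 ((x - node P i) / (node P (S i) - node P i))));
      [lra| |reflexivity].
    intros x _; apply (continuous_comp (fun x => (x - node P i) / (node P (S i) - node P i)) (clamp 0 1));
      [|apply clamp_continuous].
    apply (@ex_derive_continuous R_AbsRing R_NormedModule); auto_derive; exact I.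
  + intros j Hj; apply poly_on_polyn.
    destruct (lt_eq_lt_dec j i) as [[Hji| ->]|Hji].
    * exists (fun _ => 0); split; [apply polyn_const|]; intros x Hx; apply Hl.
      assert (node P (S j) <= node P i) by (apply node_mono; lia); lra.
    * exists (fun x => - node P i / (node P (S i) - node P i) + / (node P (S i) - node P i) * x); split.
      -- apply (polyn_axpy 1 (fun _ => - node P i / (node P (S i) - node P i)) (fun x => x)); [apply polyn_const|].
         apply (polyn_ext 1 (fun x => 1 * x ^ 1)); [intros; ring|apply polyn_monomial].
      -- intros x Hx; rewrite clamp_id; [field; lra|]; split.
         ++ apply Rdiv_le_0_compat; lra.
         ++ apply Rle_div_l; lra.
    * exists (fun _ => 1); split; [apply polyn_const|]; intros x Hx; apply Hr.
      assert (node P (S i) <= node P j) by (apply node_mono; lia); lra.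
  + intros; apply clamp_bounds; lra.
  + intros x Hx; apply Hl, Hx.
  + intros x Hx; apply Hr, Hx.
- set (w := (2 ^ d)%nat) in *.
  assert (Hw : (2 ^ S d = w + w)%nat) by (simpl; unfold w; lia).
  rewrite Hw in *.
  destruct (IH P i ltac:(lia)) as [Ha [HaS [Ha01 [Ha0 Ha1]]]].
  destruct (IH P (i + w)%nat ltac:(lia)) as [Hb [HbS [Hb01 [Hb0 Hb1]]]].
  replace (i + w + w)%nat with (i + (w + w))%nat in Hb1 by lia.
  set (bump := fun x => Ha x + (-1) * Hb x).
  assert (HB : Sh (S (S d)) d P bump) by (apply Sh_axpy; assumption).
  assert (HBc := Ck_on_0 _ _ _ _ (proj1 HB)).
  assert (N0 := node_bounds P i ltac:(lia)).
  assert (N1 := node_bounds P (i + w) ltac:(lia)).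
  assert (N2 := node_bounds P (i + (w + w)) ltac:(lia)).
  assert (HB01 : forall x, 0 <= x <= 1 -> 0 <= bump x <= 1).
  { intros x Hx; unfold bump; assert (H1 := Ha01 x Hx); assert (H2 := Hb01 x Hx).
    destruct (Rle_dec x (node P (i + w))) as [H|H].
    - rewrite (Hb0 x) by lra; lra.
    - rewrite (Ha1 x) by lra; lra. }
  assert (HBl : forall x, 0 <= x <= node P i -> bump x = 0).
  { intros x Hx; assert (node P i <= node P (i + w)) by (apply node_mono; lia).
    unfold bump; rewrite Ha0, Hb0 by lra; ring. }
  assert (HBr : forall x, node P (i + (w + w)) <= x <= 1 -> bump x = 0).
  { intros x Hx; assert (node P (i + w) <= node P (i + (w + w))) by (apply node_mono; lia).
    unfold bump; rewrite Ha1, Hb1 by lra; ring. }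
  assert (Hpb : pwc P bump) by (apply pc1_pwc, (Sh_pc1 (S d) d), HB).
  set (m := int01 bump).
  assert (Hm0 : 0 <= m).
  { apply (int01_ge0 P); [assumption|]; intros x Hx; apply off_nodes_bounds in Hx; apply HB01; lra. }
  (* A bump of integral zero would vanish identically, but it equals 1 at the node between the two
     blocks, where the first step is complete and the second has not begun. *)
  assert (Hm : 0 < m).
  { destruct Hm0 as [H|H]; [assumption|exfalso].
    assert (Hz : int01 (fun x => bump x * bump x) = 0).
    { apply Rle_antisym.
      - rewrite H; apply (int01_le P); [eauto with pw|assumption|].
        intros x Hx; apply off_nodes_bounds in Hx; assert (H1 := HB01 x ltac:(lra)).
        rewrite <- (Rmult_1_r (bump x)) at 3; apply Rmult_le_compat_l; lra.
      - apply (int01_ge0 P); [eauto with pw|intros; apply Rle_0_sqr]. }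
    assert (H1 := continuous_on_sqr_zero bump HBc Hz (node P (i + w)) N1).
    unfold bump in H1; rewrite Ha1, Hb0 in H1 by lra; lra. }
  assert (Hge : forall x y, 0 <= x -> x <= y -> y <= 1 -> 0 <= prim bump y - prim bump x).
  { intros x y Hx Hxy Hy; rewrite prim_minus by assumption.
    apply RInt_ge_0; [assumption|apply ex_RInt_clamp; assumption|].
    intros z Hz; apply HB01, clamp_bounds; lra. }
  assert (Heq : forall x y, 0 <= x -> x <= y -> y <= 1 -> (forall z, x <= z <= y -> bump z = 0) ->
    prim bump y = prim bump x).
  { intros x y Hx Hxy Hy Hz; apply Rminus_diag_uniq; rewrite prim_minus by assumption.
    rewrite (RInt_ext_R _ (fun _ => 0)) by (intros; try rewrite clamp_id; try apply Hz; lra).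
    rewrite RInt_const_R; ring. }
  assert (H1 : prim bump 1 = m) by apply prim_one.
  assert (H0 := prim_zero bump).
  exists (fun x => 0 + / m * (0 + prim bump x)); split; [|split; [|split]].
  + apply Sh_axpy; [apply Sh_zero|apply Sh_integrate, HB].
  + intros x Hx.
    assert (A1 := Hge 0 x ltac:(lra) ltac:(lra) ltac:(lra)).
    assert (A2 := Hge x 1 ltac:(lra) ltac:(lra) ltac:(lra)).
    replace (0 + / m * (0 + prim bump x)) with (prim bump x / m) by (field; lra); split.
    * apply Rdiv_le_0_compat; lra.
    * apply Rle_div_l; lra.
  + intros x Hx; rewrite (Heq 0 x); [rewrite H0; ring|lra|lra|lra|].
    intros z Hz; apply HBl; lra.
  + intros x Hx; rewrite <- (Heq x 1); [rewrite H1; field; lra|lra|lra|lra|].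
    intros z Hz; apply HBr; lra.
Qed.

(** A sum of steps, one per block of [2^d] cells, weighted by the increments of [g]: it agrees with
    [g] at the block ends and is constant after the last one. Within a block [g] and [s] each stay
    within [2^d * mesh P * eps] of the value at its left end, whence the factor 2. *)
Lemma step_interpolant (d : nat) (P : partition) (g : R -> R) (eps : R) : 0 <= eps ->
  (forall x y, 0 <= x -> x <= y -> y <= 1 -> Rabs (g y - g x) <= eps * (y - x)) ->
  forall J, (J * 2 ^ d <= ncells P)%nat ->
  exists s, Sh (S (S d)) d P s /\
    (forall x, 0 <= x <= node P (J * 2 ^ d) ->
       Rabs (g x - s x) <= 2 * INR (2 ^ d) * mesh P * eps) /\
    (forall x, node P (J * 2 ^ d) <= x <= 1 -> s x = g (node P (J * 2 ^ d))) /\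
    (forall j, (j <= J)%nat -> s (node P (j * 2 ^ d)) = g (node P (j * 2 ^ d))).
Proof.
intros He Hg; set (w := (2 ^ d)%nat); assert (Hh := mesh_pos P).
assert (Hw0 : 0 <= INR w) by apply pos_INR.
assert (Hwh : 0 <= INR w * mesh P * eps) by (repeat apply Rmult_le_pos; lra).
induction J as [|J IH]; intros HJ.
- exists (fun _ => 0 + g 0 * 1); simpl; rewrite node_first; split; [|split; [|split]].
  + apply (Sh_axpy (S d) d P (fun _ => 0) (fun _ => 1)); [apply Sh_zero|].
    split; [apply Ck_on_const; lra|]; intros i Hi; apply poly_on_polyn.
    exists (fun _ => 1); split; [apply polyn_const|reflexivity].
  + intros x Hx; replace x with 0 by lra.
    replace (g 0 - (0 + g 0 * 1)) with 0 by ring; rewrite Rabs_R0; lra.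
  + intros; ring.
  + intros j Hj; replace j with O by lia; simpl; rewrite node_first; ring.
- destruct (IH ltac:(lia)) as [s [Hs [Hs1 [Hs2 Hs3]]]].
  assert (HJw : (S J * w = J * w + w)%nat) by lia; rewrite HJw in *.
  destruct (step_spline d P (J * w) HJ) as [H [HS [H01 [H0 H1]]]].
  assert (N0 := node_bounds P (J * w) ltac:(lia)).
  assert (N1 := node_bounds P (J * w + w) ltac:(lia)).
  assert (N2 : node P (J * w) <= node P (J * w + w)) by (apply node_mono; lia).
  assert (N3 := node_diff P (J * w) w HJ).
  set (a := node P (J * w)) in *; set (c := node P (J * w + w)) in *.
  fold w in H1; fold c in H1.
  assert (Hb : forall x, a <= x <= c -> Rabs (g x - g a) <= INR w * mesh P * eps).
  { intros x Hx; eapply Rle_trans; [apply Hg; lra|].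
    rewrite Rmult_comm; apply Rmult_le_compat_r; lra. }
  exists (fun x => s x + (g c - g a) * H x); split; [apply Sh_axpy; assumption|split; [|split]].
  + intros x Hx; destruct (Rle_dec x a) as [Hxa|Hxa].
    * rewrite (H0 x) by lra; replace (g x - (s x + (g c - g a) * 0)) with (g x - s x) by ring.
      apply Hs1; lra.
    * rewrite (Hs2 x) by lra.
      replace (g x - (g a + (g c - g a) * H x)) with ((g x - g a) + - ((g c - g a) * H x)) by ring.
      eapply Rle_trans; [apply Rabs_triang|].
      rewrite Rabs_Ropp, Rabs_mult, (Rabs_pos_eq (H x)) by (apply H01; lra).
      assert (B1 := Hb x ltac:(lra)); assert (B2 := Hb c ltac:(lra)).
      assert (B3 : Rabs (g c - g a) * H x <= INR w * mesh P * eps * 1).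
      { apply Rmult_le_compat; try assumption; [apply Rabs_pos|apply H01; lra|apply H01; lra]. }
      lra.
  + intros x Hx; rewrite Hs2, H1 by lra; ring.
  + intros j Hj; destruct (Nat.eq_dec j (S J)) as [->|Hn].
    * rewrite HJw; fold c; rewrite Hs2, H1 by lra; ring.
    * rewrite Hs3 by lia.
      assert (node P (j * w) <= a) by (apply node_mono; split; [apply Nat.mul_le_mono_r|]; lia).
      assert (0 <= node P (j * w)) by (apply node_bounds; assert (j * w <= J * w)%nat by (apply Nat.mul_le_mono_r; lia); lia).
      rewrite H0 by lra; ring.
Qed.

Lemma step_approx (d : nat) (P : partition) (g : R -> R) (eps : R) : 0 <= eps ->
  (forall x y, 0 <= x -> x <= y -> y <= 1 -> Rabs (g y - g x) <= eps * (y - x)) ->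
  exists s, Sh (S (S d)) d P s /\
    forall x, 0 <= x <= 1 -> Rabs (g x - s x) <= 2 * INR (2 ^ d) * mesh P * eps.
Proof.
intros He Hg; set (w := (2 ^ d)%nat).
assert (Hw : (w <> 0)%nat) by (apply Nat.pow_nonzero; lia).
(* Only whole blocks carry steps. Fewer than [2^d] cells remain at the right end; there [s] is
   constant and the Lipschitz bound on [g] suffices. *)
set (J := (ncells P / w)%nat).
assert (HJ1 : (J * w <= ncells P)%nat) by (rewrite Nat.mul_comm; apply Nat.Div0.mul_div_le).
assert (HJ2 : (ncells P < S J * w)%nat) by (rewrite Nat.mul_comm; apply Nat.mul_succ_div_gt, Hw).
destruct (step_interpolant d P g eps He Hg J HJ1) as [s [Hs [H1 [H2 _]]]].
fold w in H1, H2; exists s; split; [assumption|]; intros x Hx.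
destruct (Rle_dec x (node P (J * w))) as [H|H]; [apply H1; lra|].
rewrite H2 by (fold w; lra).
assert (N0 := node_bounds P (J * w) ltac:(lia)); assert (Hh := mesh_pos P).
eapply Rle_trans; [apply Hg; fold w; lra|].
assert (Hd := node_diff P (J * w) (ncells P - J * w) ltac:(lia)).
replace (J * w + (ncells P - J * w))%nat with (ncells P) in Hd by lia.
rewrite node_last in Hd.
assert (INR (ncells P - J * w) <= INR w) by (apply le_INR; lia).
assert (INR (ncells P - J * w) * mesh P <= INR w * mesh P) by (apply Rmult_le_compat_r; lra).
assert (0 <= INR w) by apply pos_INR.
assert (0 <= INR w * mesh P) by (apply Rmult_le_pos; lra).
rewrite (Rmult_comm eps); apply Rmult_le_compat_r; [assumption|]; fold w; lra.
Qed.

Fixpoint Dn (n : nat) (f : R -> R) : R -> R :=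
  match n with O => f | S m => Dn m (Derive_on 0 1 f) end.

(** The mean value theorem on each cell, chained at the nodes by continuity. *)
Lemma pc1_lipschitz (P : partition) (g : R -> R) (eps : R) : 0 <= eps -> pc1 P g ->
  (forall x, off_nodes P x -> Rabs (Derive_on 0 1 g x) <= eps) ->
  forall x y, 0 <= x -> x <= y -> y <= 1 -> Rabs (g y - g x) <= eps * (y - x).
Proof.
intros He Hg Hd.
assert (Hcell : forall i x y, (i < ncells P)%nat -> node P i <= x -> x <= y -> y <= node P (S i) ->
  Rabs (g y - g x) <= eps * (y - x)).
{ intros i x y Hi Hx Hxy Hy; destruct (Req_dec x y) as [<-|Hn].
  - rewrite !Rminus_diag, Rabs_R0; lra.
  - destruct (Hg i Hi) as [g1 [dg [H1 [H2 H3]]]].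
    destruct (MVT_cor2 g1 dg x y) as [c [Hc1 Hc2]]; [lra| |].
    + intros c _; apply is_derive_Reals, H1.
    + rewrite !H3, Hc1, Rabs_mult, (Rabs_pos_eq (y - x)) by lra.
      apply Rmult_le_compat_r; [lra|].
      assert (Hc : node P i < c < node P (S i)) by lra.
      destruct (C1_on_interior (node P i) (node P (S i)) g g1 dg c) as [_ <-]; try assumption.
      * apply node_bounds; lia.
      * apply node_bounds; lia.
      * apply Hd; exists i; split; assumption. }
assert (H : forall n, (n <= ncells P)%nat -> forall x y, 0 <= x -> x <= y -> y <= node P n ->
  Rabs (g y - g x) <= eps * (y - x)).
{ induction n as [|n IH]; intros Hn x y Hx Hxy Hy.
  - rewrite node_first in Hy; replace y with x by lra; rewrite !Rminus_diag, Rabs_R0; lra.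
  - destruct (Rle_dec y (node P n)) as [H1|H1]; [apply IH; try lia; assumption|].
    destruct (Rle_dec (node P n) x) as [H2|H2]; [apply (Hcell n); try lia; assumption|].
    replace (g y - g x) with ((g y - g (node P n)) + (g (node P n) - g x)) by ring.
    eapply Rle_trans; [apply Rabs_triang|].
    assert (H3 := Hcell n (node P n) y ltac:(lia) ltac:(lra) ltac:(lra) Hy).
    assert (H4 := IH ltac:(lia) x (node P n) Hx ltac:(lra) ltac:(lra)); lra. }
intros x y Hx Hxy Hy; apply (H (ncells P)); [lia|assumption..|rewrite node_last; assumption].
Qed.

Lemma Ck_on_pc1 (k : nat) (P : partition) (f : R -> R) : Ck_on (S k) 0 1 f -> pc1 P f.
Proof. intros H; apply C1_on_pc1, Ck_on_C1_on, (Ck_on_le 1 (S k)); [lia|assumption]. Qed.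

Lemma Ck_on_lipschitz (f : R -> R) (M : R) : Ck_on 1 0 1 f ->
  (forall x, 0 <= x <= 1 -> Rabs (Derive_on 0 1 f x) <= M) ->
  forall x y, 0 < x < 1 -> 0 < y < 1 -> Rabs (f y - f x) <= M * Rabs (y - x).
Proof.
intros Hf HM.
assert (H : forall x y, 0 < x -> x < y -> y < 1 -> Rabs (f y - f x) <= M * (y - x)).
{ intros x y Hx Hxy Hy; destruct Hf as [_ [Hd _]].
  destruct (MVT_cor2 f (Derive_on 0 1 f) x y Hxy) as [c [Hc1 Hc2]].
  - intros c Hc; apply is_derive_Reals, (is_derive_on_interior 0 1); [lra|].
    apply Derive_on_correct; [lra|lra|apply Hd; lra].
  - rewrite Hc1, Rabs_mult, (Rabs_pos_eq (y - x)) by lra.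
    apply Rmult_le_compat_r; [lra|apply HM; lra]. }
intros x y Hx Hy; destruct (Rtotal_order x y) as [Hxy|[ ->|Hxy]].
- rewrite (Rabs_pos_eq (y - x)) by lra; apply H; lra.
- rewrite !Rminus_diag, Rabs_R0; lra.
- rewrite (Rabs_minus_sym y x), (Rabs_minus_sym (f y)), (Rabs_pos_eq (x - y)) by lra; apply H; lra.
Qed.

(** Degree [d + 1] with smoothness [C^d], the extreme case [k = r - 2] for [r = d + 2]. This
    statement and [approx_value] are proved in alternation, each feeding the other. The clause on
    [s 0] anchors the correction of the boundary values later on. *)
Definition approx_deriv (d : nat) : Prop := exists C, 0 <= C /\
  forall P f M, Ck_on (S (S d)) 0 1 f -> 0 <= M ->
    (forall x, 0 <= x <= 1 -> Rabs (Dn (S (S d)) f x) <= M) ->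
    exists s, Sh (S (S d)) d P s /\ s 0 = f 0 /\
      forall x, off_nodes P x ->
        Rabs (Derive_on 0 1 f x - Derive_on 0 1 s x) <= C * M * mesh P ^ S d.

Definition approx_value (d : nat) : Prop := exists C, 0 <= C /\
  forall P f M, Ck_on (S (S d)) 0 1 f -> 0 <= M ->
    (forall x, 0 <= x <= 1 -> Rabs (Dn (S (S d)) f x) <= M) ->
    exists s, Sh (S (S d)) d P s /\
      forall x, 0 <= x <= 1 -> Rabs (f x - s x) <= C * M * mesh P ^ S (S d).

(** The piecewise linear interpolant: on each cell its slope is the derivative of [f] at some point
    of that cell, hence within [M * mesh P] of the derivative at any other. *)
Lemma approx_deriv_0 : approx_deriv 0.
Proof.
exists 1; split; [lra|]; intros P f M Hf HM0 HM.
assert (Hp := Ck_on_pc1 1 P f Hf).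
(* The maximum of the derivative is the Lipschitz constant requested by [step_interpolant]. For
   [d = 0] the blocks are single cells, so the result interpolates at all nodes. *)
destruct (continuity_ab_maj (fun x => Rabs (Derive_on 0 1 f (clamp 0 1 x))) 0 1) as [xm [Hxm _]]; [lra| |].
{ intros c _; apply continuity_pt_filterlim.
  apply (continuous_comp (fun x => Derive_on 0 1 f (clamp 0 1 x)) Rabs); [|apply continuous_Rabs].
  assert (Hf1 : Ck_on 1 0 1 (Derive_on 0 1 f)) by apply Hf; assert (H := Ck_on_0 _ _ _ _ Hf1); rewrite continuous_on_clamp in H by lra; apply H. }
set (eps := Rabs (Derive_on 0 1 f (clamp 0 1 xm))) in *.
destruct (step_interpolant 0 P f eps) with (J := ncells P) as [s [Hs [_ [_ Hn]]]].
- apply Rabs_pos.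
- apply (pc1_lipschitz P); [apply Rabs_pos|assumption|].
  intros x Hx; apply off_nodes_bounds in Hx.
  assert (H := Hxm x ltac:(lra)); rewrite clamp_id in H by lra; exact H.
- simpl; lia.
- exists s; split; [assumption|split].
  + assert (H := Hn O ltac:(lia)); simpl in H; rewrite node_first in H; exact H.
  + intros x [i [Hi Hx]].
    destruct (Sh_cell 1 0 P s i Hs Hi) as [g [dg [Hg [_ [Hd [H1 H2]]]]]].
    destruct Hg as [k0 [c [[c0 Hk0] Hg]]].
    assert (Hslope : forall y, dg y = c).
    { intros y; rewrite <- (is_derive_unique _ _ _ (Hd y)).
      apply is_derive_unique, (is_derive_ext (fun x => c0 + c * x)).
      - intros t; rewrite Hg, Hk0; simpl; rewrite Rmult_1_r; reflexivity.
      - auto_derive; [exact I|ring]. }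
    assert (Hinc := node_incr P i Hi).
    assert (E1 := Hn i ltac:(lia)); assert (E2 := Hn (S i) ltac:(lia)).
    change (2 ^ 0)%nat with 1%nat in E1, E2; rewrite Nat.mul_1_r in E1, E2.
    rewrite H1, Hg, Hk0 in E1, E2 by lra.
    rewrite H2, Hslope by assumption.
    destruct (Hp i Hi) as [g1 [dg1 [G1 [G2 G3]]]].
    destruct (MVT_cor2 g1 dg1 (node P i) (node P (S i)) Hinc) as [z [Hz1 Hz2]].
    { intros; apply is_derive_Reals, G1. }
    assert (Hc : c = Derive_on 0 1 f z).
    { destruct (C1_on_interior (node P i) (node P (S i)) f g1 dg1 z) as [_ ->]; try assumption;
        [apply node_bounds; lia|apply node_bounds; lia|].
      rewrite <- !G3 in Hz1 by lra; rewrite <- E1, <- E2 in Hz1.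
      apply Rmult_eq_reg_r with (node P (S i) - node P i); lra. }
    rewrite Hc.
    assert (B1 := node_bounds P i ltac:(lia)); assert (B2 := node_bounds P (S i) ltac:(lia)).
    eapply Rle_trans.
    * apply (Ck_on_lipschitz (Derive_on 0 1 f) M); [apply Hf|exact HM|lra|lra].
    * destruct (mesh_cell P i Hi) as [_ Hm]; unfold cell in Hm.
      rewrite pow_1, Rmult_1_l; apply Rmult_le_compat_l; [assumption|].
      apply Rabs_le; lra.
Qed.

(** The error [f - s] has Lipschitz constant [C * M * h^(d+1)]; approximating it in turn by steps
    gains one more power of [h]. *)
Lemma approx_deriv_value (d : nat) : approx_deriv d -> approx_value d.
Proof.
intros [C [HC0 HC]]; exists (2 * INR (2 ^ d) * C); split.
{ assert (0 <= INR (2 ^ d)) by apply pos_INR; repeat apply Rmult_le_pos; lra. }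
intros P f M Hf HM0 HM; destruct (HC P f M Hf HM0 HM) as [s [Hs [_ Hd]]].
assert (Hh := mesh_pos P).
assert (Hp := Ck_on_pc1 (S d) P f Hf); assert (Hps := Sh_pc1 (S d) d P s Hs).
assert (He : 0 <= C * M * mesh P ^ S d).
{ apply Rmult_le_pos; [apply Rmult_le_pos; lra|apply pow_le; lra]. }
destruct (step_approx d P (fun x => f x - s x) (C * M * mesh P ^ S d) He) as [s' [Hs' H']].
- apply (pc1_lipschitz P); [assumption|auto with pw|].
  intros x Hx; rewrite (Derive_on_minus P) by assumption; apply Hd, Hx.
- exists (fun x => s x + 1 * s' x); split; [apply Sh_axpy; assumption|].
  intros x Hx; replace (f x - (s x + 1 * s' x)) with (f x - s x - s' x) by ring.
  eapply Rle_trans; [apply H', Hx|]; right.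
  change (mesh P ^ S (S d)) with (mesh P * mesh P ^ S d); ring.
Qed.

(** A primitive of an approximation of the derivative has, for its own derivative, the same
    error. *)
Lemma approx_value_deriv (d : nat) : approx_value d -> approx_deriv (S d).
Proof.
intros [C [HC0 HC]]; exists C; split; [assumption|].
intros P f M Hf HM0 HM.
destruct (HC P (Derive_on 0 1 f) M (proj2 (proj2 Hf)) HM0 HM) as [s [Hs Hv]].
exists (fun x => f 0 + prim s x); split; [apply Sh_integrate, Hs|split].
- rewrite prim_zero; ring.
- intros x Hx; assert (Hx' := off_nodes_bounds P x Hx).
  replace (Derive_on 0 1 (fun x => f 0 + prim s x) x) with (s x); [apply Hv; lra|].
  symmetry; apply Derive_on_is_derive; [assumption|].
  replace (s x) with (0 + s x) by ring.
  apply (is_derive_plus (V := R_NormedModule)); [apply @is_derive_const|].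
  rewrite <- (clamp_id 0 1 x) at 2 by lra; apply prim_derive, (Ck_on_0 _ _ _ _ (proj1 Hs)).
Qed.

Lemma spline_approx_deriv (d : nat) : approx_deriv d.
Proof.
induction d as [|d IH]; [exact approx_deriv_0|].
apply approx_value_deriv, approx_deriv_value, IH.
Qed.

Lemma spline_approx_value (d : nat) : approx_value d.
Proof. apply approx_deriv_value, spline_approx_deriv. Qed.

Lemma Sh_id (d k : nat) (P : partition) : Sh (S (S d)) k P (fun x => x).
Proof.
split.
- destruct k as [|k]; split; try exact I.
  1, 2: apply (continuous_continuous_on 0 1 _ (fun x => x)); [lra| |reflexivity];
    intros; apply continuous_id.
  split.
  + intros x Hx; exists 1; apply is_derive_is_derive_on; [lra|assumption|apply @is_derive_id].
  + apply (Ck_on_ext k 0 1 (fun _ => 1)); [lra| |apply Ck_on_const; lra].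
    intros x Hx; symmetry; apply is_derive_on_unique; [lra|assumption|].
    apply is_derive_is_derive_on; [lra|assumption|apply @is_derive_id].
- intros i Hi; apply poly_on_polyn; exists (fun x => 0 + 1 * (x * 1)); split.
  + apply (polyn_axpy (S d) (fun _ => 0) (fun x => x * 1)); [apply polyn_const|].
    apply (polyn_mulx d (fun _ => 1)), polyn_const.
  + intros; ring.
Qed.

(* A linear function restores the boundary values. *)
Lemma spline_approx_deriv0 (d : nat) : exists C, 0 <= C /\
  forall P f M, Ck_on (S (S d)) 0 1 f -> 0 <= M ->
    (forall x, 0 <= x <= 1 -> Rabs (Dn (S (S d)) f x) <= M) -> f 0 = 0 -> f 1 = 0 ->
    exists s, Sh0 (S (S d)) d P s /\
      (forall x, 0 <= x <= 1 -> Rabs (f x - s x) <= C * M * mesh P ^ S d) /\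
      forall x, off_nodes P x ->
        Rabs (Derive_on 0 1 f x - Derive_on 0 1 s x) <= C * M * mesh P ^ S d.
Proof.
destruct (spline_approx_deriv d) as [C [HC0 HC]]; exists (2 * C); split; [lra|].
intros P f M Hf HM0 HM Hf0 Hf1; destruct (HC P f M Hf HM0 HM) as [s [Hs [Hs0 Hd]]].
assert (Hh := mesh_pos P).
assert (Hp := Ck_on_pc1 (S d) P f Hf); assert (Hps := Sh_pc1 (S d) d P s Hs).
assert (He : 0 <= C * M * mesh P ^ S d).
{ apply Rmult_le_pos; [apply Rmult_le_pos; lra|apply pow_le; lra]. }
set (e := C * M * mesh P ^ S d) in *.
assert (Hlip : forall x y, 0 <= x -> x <= y -> y <= 1 ->
  Rabs ((f y - s y) - (f x - s x)) <= e * (y - x)).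
{ apply (pc1_lipschitz P (fun x => f x - s x)); [assumption|auto with pw|].
  intros x Hx; rewrite (Derive_on_minus P) by assumption; apply Hd, Hx. }
assert (Hval : forall x, 0 <= x <= 1 -> Rabs (f x - s x) <= e).
{ intros x Hx; assert (H := Hlip 0 x ltac:(lra) ltac:(lra) ltac:(lra)).
  rewrite Hs0, Rminus_diag, Rminus_0_r in H.
  eapply Rle_trans; [exact H|].
  assert (e * (x - 0) <= e * 1) by (apply Rmult_le_compat_l; lra); lra. }
assert (Hs1 : Rabs (s 1) <= e).
{ assert (H := Hval 1 ltac:(lra)); rewrite Hf1 in H.
  replace (0 - s 1) with (- s 1) in H by ring; rewrite Rabs_Ropp in H; exact H. }
(* As [f 1 = 0], the value [s 1] is itself no larger than the error, so the correction only doubles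
   the constant. *)
exists (fun x => s x + - s 1 * x); split; [split|split].
- apply Sh_axpy; [assumption|apply Sh_id].
- rewrite Hs0, Hf0; split; ring.
- intros x Hx; replace (f x - (s x + - s 1 * x)) with ((f x - s x) + s 1 * x) by ring.
  eapply Rle_trans; [apply Rabs_triang|].
  rewrite Rabs_mult, (Rabs_pos_eq x) by lra.
  assert (H := Hval x Hx).
  assert (Rabs (s 1) * x <= e * 1) by (apply Rmult_le_compat; [apply Rabs_pos|lra..]).
  fold e; unfold e in *; lra.
- intros x Hx.
  rewrite (Derive_on_axpy P) by (first [assumption|apply (Sh_pc1 (S d) d), Sh_id]).
  replace (Derive_on 0 1 (fun y => y) x) with 1.
  + replace (Derive_on 0 1 f x - (Derive_on 0 1 s x + - s 1 * 1))
      with ((Derive_on 0 1 f x - Derive_on 0 1 s x) + s 1) by ring.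
    eapply Rle_trans; [apply Rabs_triang|].
    assert (H := Hd x Hx); unfold e in *; lra.
  + symmetry; apply Derive_on_is_derive; [apply (off_nodes_bounds P), Hx|apply @is_derive_id].
Qed.

(** * Ordinary differential equations *)

Lemma lipschitz_continuous (f : R -> R) (K t : R) :
  (forall s, Rabs (f s - f t) <= K * Rabs (s - t)) -> continuous f t.
Proof.
intros H; apply continuity_pt_filterlim; intros e He.
assert (HK : 0 < Rabs K + 1) by (assert (H0 := Rabs_pos K); lra).
exists (e / (Rabs K + 1)); split; [apply Rdiv_lt_0_compat; assumption|].
intros s [_ Hs]; simpl in *; unfold R_dist in *.
eapply Rle_lt_trans; [apply H|].
apply Rle_lt_trans with ((Rabs K + 1) * Rabs (s - t)).
- apply Rmult_le_compat_r; [apply Rabs_pos|]; assert (H0 := Rle_abs K); lra.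
- apply Rmult_lt_compat_l with (r := Rabs K + 1) in Hs; [|assumption].
  replace ((Rabs K + 1) * (e / (Rabs K + 1))) with e in Hs by (field; lra); exact Hs.
Qed.

Lemma half_pow_vanish (x K : R) : (forall k : nat, x <= K * (1 / 2) ^ k) -> x <= 0.
Proof.
intros H; apply Rnot_lt_le; intros Hx.
assert (HK : 0 < K) by (specialize (H O); simpl in H; lra).
destruct (pow_lt_1_zero (1 / 2)) with (y := x / K) as [n Hn].
- rewrite Rabs_pos_eq; lra.
- apply Rdiv_lt_0_compat; assumption.
- specialize (Hn n (Nat.le_refl _)); rewrite Rabs_pos_eq in Hn by (apply pow_le; lra).
  specialize (H n); apply Rmult_lt_compat_l with (r := K) in Hn; [|assumption].
  replace (K * (x / K)) with x in Hn by (field; lra); lra.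
Qed.

(** With [p k = K / 2^k] the intervals from [a k - 2 p k] to [a k + 2 p k] are nested, and the
    supremum of their lower ends lies in all of them. *)
Lemma geometric_limit (a : nat -> R) (K : R) :
  (forall k, Rabs (a (S k) - a k) <= K * (1 / 2) ^ k) ->
  exists l, forall k, Rabs (a k - l) <= 2 * K * (1 / 2) ^ k.
Proof.
intros H.
assert (HK : 0 <= K) by (specialize (H O); simpl in H; assert (H0 := Rabs_pos (a 1%nat - a O)); lra).
set (p := fun k : nat => K * (1 / 2) ^ k) in *.
assert (Hp : forall k, 0 <= p k) by (intros; apply Rmult_le_pos; [lra|apply pow_le; lra]).
assert (HpS : forall k, p (S k) = p k / 2) by (intros; unfold p; simpl; field).
assert (Hk : forall k, - p k <= a (S k) - a k <= p k)
  by (intros k; apply Rabs_le_between, H).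
assert (Hlow : forall n k, a k - 2 * p k <= a (k + n)%nat - 2 * p (k + n)%nat).
{ induction n as [|n IH]; intros k; [rewrite Nat.add_0_r; lra|].
  rewrite Nat.add_succ_r; specialize (IH k); specialize (Hk (k + n)%nat); rewrite HpS; lra. }
assert (Hup : forall n k, a (k + n)%nat + 2 * p (k + n)%nat <= a k + 2 * p k).
{ induction n as [|n IH]; intros k; [rewrite Nat.add_0_r; lra|].
  rewrite Nat.add_succ_r; specialize (IH k); specialize (Hk (k + n)%nat); rewrite HpS; lra. }
assert (Hlu : forall j k, a j - 2 * p j <= a k + 2 * p k).
{ intros j k; assert (H1 := Hlow k j); assert (H2 := Hup j k).
  rewrite (Nat.add_comm k j) in H2; specialize (Hp (j + k)%nat); lra. }
destruct (completeness (fun x => exists j, x = a j - 2 * p j)) as [l [Hl1 Hl2]].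
- exists (a O + 2 * p O); intros x [j ->]; apply Hlu.
- exists (a O - 2 * p O), O; reflexivity.
- exists l; intros k; apply Rabs_le; split.
  + assert (l <= a k + 2 * p k) by (apply Hl2; intros x [j ->]; apply Hlu).
    unfold p in *; lra.
  + assert (a k - 2 * p k <= l) by (apply Hl1; exists k; reflexivity).
    unfold p in *; lra.
Qed.

Lemma abs_RInt_le_primitive (f h dh : R -> R) (t : R) : 0 <= t ->
  (forall s, continuous f s) -> (forall s, is_derive h s (dh s)) -> (forall s, continuous dh s) ->
  (forall s, 0 <= s <= t -> Rabs (f s) <= dh s) -> Rabs (RInt f 0 t) <= h t - h 0.
Proof.
intros Ht Hf Hh Hdh H.
assert (Hi : is_RInt dh 0 t (h t - h 0)) by (apply (is_RInt_derive h dh); auto).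
rewrite <- (is_RInt_unique _ _ _ _ Hi).
apply Rle_trans with (RInt (fun s => Rabs (f s)) 0 t).
- apply abs_RInt_le; [assumption|apply continuous_ex_RInt, Hf].
- apply RInt_le; [assumption| |exists (h t - h 0); exact Hi|intros; apply H; lra].
  apply continuous_ex_RInt; intros s; apply (continuous_comp f Rabs); [apply Hf|apply continuous_Rabs].
Qed.

Definition l1 (N : nat) (y : nat -> R) : R := rsum N (fun j => Rabs (y j)).

Lemma l1_ge0 N y : 0 <= l1 N y.
Proof. apply rsum_ge0; intros; apply Rabs_pos. Qed.

(** Picard iteration on the whole half-line. Measured against the weight [exp (2 * La * t)], each
    iteration halves the distance of consecutive iterates, which gives a global solution without
    continuing local ones. *)
Lemma picard_lindeloef (N : nat) (G : (nat -> R) -> nat -> R) (B L : R) (y0 : nat -> R) :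
  (forall y i, (i < N)%nat -> Rabs (G y i) <= B) ->
  (forall y z i, (i < N)%nat -> Rabs (G y i - G z i) <= L * l1 N (fun j => y j - z j)) ->
  0 <= B -> 0 <= L ->
  exists Y : nat -> R -> R,
    forall i, (i < N)%nat -> Y i 0 = y0 i /\
      forall t, 0 <= t -> is_derive (Y i) t (G (fun j => Y j t) i).
Proof.
intros HB HL HB0 HL0.
(* Integrating up to [pos t] makes the iterates constant for negative times, hence Lipschitz on the
   whole line. *)
set (pos := fun t => Rmax 0 t).
assert (Hpos : forall t, 0 <= pos t) by (intros; apply Rmax_l).
assert (Hposid : forall t, 0 <= t -> pos t = t) by (intros; apply Rmax_right; assumption).
assert (HposL : forall s t, Rabs (pos s - pos t) <= Rabs (s - t)).
{ intros s t; unfold pos, Rmax, Rabs; repeat destruct Rle_dec; repeat destruct Rcase_abs; lra. }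
set (it := fix it k := match k with
  | O => fun (i : nat) (t : R) => y0 i
  | S k' => fun (i : nat) (t : R) => y0 i + RInt (fun s => G (fun j => it k' j s) i) 0 (pos t) end).
assert (HGc : forall y : nat -> R -> R,
  (forall i s t, (i < N)%nat -> Rabs (y i s - y i t) <= B * Rabs (s - t)) ->
  forall i t, (i < N)%nat -> continuous (fun s => G (fun j => y j s) i) t).
{ intros y Hy i t Hi; apply (lipschitz_continuous _ (L * (INR N * B))); intros s.
  eapply Rle_trans; [apply HL, Hi|].
  rewrite Rmult_assoc; apply Rmult_le_compat_l; [assumption|].
  unfold l1; rewrite Rmult_assoc, <- rsum_const; apply rsum_le; intros j Hj; apply Hy, Hj. }
assert (HPhi : forall y : nat -> R -> R,
  (forall i s t, (i < N)%nat -> Rabs (y i s - y i t) <= B * Rabs (s - t)) ->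
  forall i s t, (i < N)%nat ->
    Rabs (RInt (fun s => G (fun j => y j s) i) 0 (pos s) - RInt (fun s => G (fun j => y j s) i) 0 (pos t))
    <= B * Rabs (s - t)).
{ intros y Hy i s t Hi.
  assert (Hex : forall a b, ex_RInt (fun s => G (fun j => y j s) i) a b)
    by (intros; apply continuous_ex_RInt; intros; apply HGc; assumption).
  assert (Hw : forall a b, a <= b -> Rabs (RInt (fun s => G (fun j => y j s) i) a b) <= (b - a) * B).
  { intros a b Hab; apply abs_RInt_le_const; [assumption|apply Hex|intros; apply HB, Hi]. }
  assert (Hv : forall a b, Rabs (RInt (fun s => G (fun j => y j s) i) 0 a
    - RInt (fun s => G (fun j => y j s) i) 0 b) <= B * Rabs (a - b)).
  { intros a b; destruct (Rle_dec b a) as [H|H].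
    - rewrite <- (RInt_Chasles_R _ 0 b a), Rplus_minus_l by apply Hex.
      rewrite (Rabs_pos_eq (a - b)) by lra; rewrite Rmult_comm; apply Hw, H.
    - rewrite Rabs_minus_sym, (Rabs_minus_sym a).
      rewrite <- (RInt_Chasles_R _ 0 a b), Rplus_minus_l by apply Hex.
      rewrite (Rabs_pos_eq (b - a)) by lra; rewrite Rmult_comm; apply Hw; lra. }
  eapply Rle_trans; [apply Hv|]; apply Rmult_le_compat_l; [assumption|apply HposL]. }
assert (HitL : forall k i s t, (i < N)%nat -> Rabs (it k i s - it k i t) <= B * Rabs (s - t)).
{ induction k as [|k IH]; intros i s t Hi; simpl.
  - rewrite Rminus_diag, Rabs_R0; apply Rmult_le_pos; [assumption|apply Rabs_pos].
  - replace (_ - _) with (RInt (fun s => G (fun j => it k j s) i) 0 (pos s)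
      - RInt (fun s => G (fun j => it k j s) i) 0 (pos t)) by ring.
    apply HPhi; assumption. }
(* [INR N * L <= La] gives the factor one half after integrating the weight. The added 1 keeps [La]
   positive and makes the weight dominate the first increment, which is at most [INR N * B * t]. *)
set (La := INR N * L + 1).
assert (HN : 0 <= INR N) by apply pos_INR.
assert (HNL : 0 <= INR N * L) by (apply Rmult_le_pos; assumption).
assert (HNB : 0 <= INR N * B) by (apply Rmult_le_pos; assumption).
set (K := fun t => INR N * B * exp (2 * La * pos t)).
assert (HK0 : forall t, 0 <= K t)
  by (intros; apply Rmult_le_pos; [assumption|apply Rlt_le, exp_pos]).
assert (Hdiff : forall k t, l1 N (fun j => it (S k) j t - it k j t) <= K t * (1 / 2) ^ k).
{ induction k as [|k IH]; intros t.
  - unfold K; rewrite pow_O, Rmult_1_r.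
    apply Rle_trans with (INR N * (B * pos t)).
    + unfold l1; rewrite <- rsum_const; apply rsum_le; intros i Hi; simpl.
      rewrite Rplus_minus_l.
      eapply Rle_trans; [apply abs_RInt_le_const; [apply Hpos|apply @ex_RInt_const|intros; apply HB, Hi]|].
      right; ring.
    + rewrite <- Rmult_assoc; apply Rmult_le_compat_l; [assumption|].
      assert (H := exp_ineq1_le (2 * La * pos t)).
      assert (H1 : 1 * pos t <= 2 * La * pos t) by (apply Rmult_le_compat_r; [apply Hpos|unfold La; lra]).
      lra.
  - set (h := fun s => L * (INR N * B * (1 / 2) ^ k) / (2 * La) * exp (2 * La * s)).
    assert (HLa : 0 < La) by (unfold La; lra).
    assert (Hi : forall i, (i < N)%nat ->
      Rabs (it (S (S k)) i t - it (S k) i t) <= h (pos t) - h 0).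
    { intros i Hi.
      assert (Hd : it (S (S k)) i t - it (S k) i t
        = RInt (fun s => G (fun j => it (S k) j s) i + -1 * G (fun j => it k j s) i) 0 (pos t)).
      { rewrite RInt_lin.
        - change (it (S (S k)) i t) with (y0 i + RInt (fun s => G (fun j => it (S k) j s) i) 0 (pos t)).
          change (it (S k) i t) with (y0 i + RInt (fun s => G (fun j => it k j s) i) 0 (pos t)); ring.
        - apply continuous_ex_RInt; intros; apply HGc; [apply HitL|assumption].
        - apply continuous_ex_RInt; intros; apply HGc; [apply HitL|assumption]. }
      rewrite Hd; clear Hd.
      apply (abs_RInt_le_primitive _ h (fun s => L * (INR N * B * exp (2 * La * s) * (1 / 2) ^ k))).
      - apply Hpos.
      - intros s; apply continuous_plus_R; [apply HGc; [apply HitL|assumption]|].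
        apply continuous_mult_R; [apply continuous_const|apply HGc; [apply HitL|assumption]].
      - intros s; unfold h; auto_derive; [exact I|field; lra].
      - intros s; apply (@ex_derive_continuous R_AbsRing R_NormedModule); auto_derive; exact I.
      - intros s Hs.
        replace (G (fun j => it (S k) j s) i + -1 * G (fun j => it k j s) i)
          with (G (fun j => it (S k) j s) i - G (fun j => it k j s) i) by ring.
        eapply Rle_trans; [apply HL, Hi|]; apply Rmult_le_compat_l; [assumption|].
        assert (H := IH s); unfold K in H; rewrite Hposid in H by lra; exact H. }
    unfold l1; eapply Rle_trans; [apply rsum_le; exact Hi|]; rewrite rsum_const.
    assert (Hh0 : 0 <= h 0).
    { apply Rmult_le_pos; [|apply Rlt_le, exp_pos].
      apply Rdiv_le_0_compat; [|lra].
      apply Rmult_le_pos; [assumption|apply Rmult_le_pos; [assumption|apply pow_le; lra]]. }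
    apply Rle_trans with (INR N * h (pos t)); [apply Rmult_le_compat_l; lra|].
    unfold h, K; simpl pow.
    replace (INR N * (L * (INR N * B * (1 / 2) ^ k) / (2 * La) * exp (2 * La * pos t)))
      with ((INR N * L / La) * (INR N * B * exp (2 * La * pos t) * (1 / 2 * (1 / 2) ^ k))) by (field; lra).
    rewrite <- (Rmult_1_l (INR N * B * exp (2 * La * pos t) * (1 / 2 * (1 / 2) ^ k))) at 2.
    apply Rmult_le_compat_r.
    + apply Rmult_le_pos; [apply HK0|]; apply Rmult_le_pos; [lra|apply pow_le; lra].
    + apply Rle_div_l; unfold La; lra. }
assert (Hlim : forall i t, exists l, (i < N)%nat -> forall k, Rabs (it k i t - l) <= 2 * K t * (1 / 2) ^ k).
{ intros i t; destruct (Nat.lt_ge_cases i N) as [Hi|Hi]; [|exists 0; lia].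
  destruct (geometric_limit (fun k => it k i t) (K t)) as [l Hl].
  - intros k; eapply Rle_trans; [|apply Hdiff].
    apply (rsum_term_le N (fun j => Rabs (it (S k) j t - it k j t))); [intros; apply Rabs_pos|assumption].
  - exists l; intros _; exact Hl. }
set (y := fun i t => proj1_sig (constructive_indefinite_description _ (Hlim i t))).
assert (Hy : forall i t, (i < N)%nat -> forall k, Rabs (it k i t - y i t) <= 2 * K t * (1 / 2) ^ k).
{ intros i t; unfold y; destruct (constructive_indefinite_description _ (Hlim i t)); assumption. }
assert (HyL : forall i s t, (i < N)%nat -> Rabs (y i s - y i t) <= B * Rabs (s - t)).
{ intros i s t Hi; apply Rminus_le, (half_pow_vanish _ (2 * K s + 2 * K t)); intros k.
  replace (y i s - y i t) with (- (it k i s - y i s) + (it k i t - y i t) + (it k i s - it k i t)) by ring.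
  assert (H1 := Hy i s Hi k); assert (H2 := Hy i t Hi k); assert (H3 := HitL k i s t Hi).
  assert (H4 := Rabs_triang (- (it k i s - y i s) + (it k i t - y i t)) (it k i s - it k i t)).
  assert (H5 := Rabs_triang (- (it k i s - y i s)) (it k i t - y i t)).
  rewrite Rabs_Ropp in H5; lra. }
assert (Hint : forall i t, (i < N)%nat -> 0 <= t ->
  y i t = y0 i + RInt (fun s => G (fun j => y j s) i) 0 t).
{ intros i t Hi Ht; apply Rminus_diag_uniq, Rabs_eq_0.
  apply Rle_antisym; [|apply Rabs_pos].
  apply (half_pow_vanish _ (2 * K t + t * (L * (INR N * (2 * K t))))); intros k.
  assert (HKm : forall s, 0 <= s <= t -> K s <= K t).
  { intros s Hs; unfold K; apply Rmult_le_compat_l; [assumption|].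
    rewrite !Hposid by lra; destruct (Req_dec s t) as [->|Hn]; [lra|].
    apply Rlt_le, exp_increasing, Rmult_lt_compat_l; unfold La; lra. }
  assert (H1 := Hy i t Hi (S k)).
  assert (H2 : Rabs (RInt (fun s => G (fun j => it k j s) i + -1 * G (fun j => y j s) i) 0 t)
    <= (t - 0) * (L * (INR N * (2 * K t * (1 / 2) ^ k)))).
  { apply abs_RInt_le_const; [assumption| |].
    - apply ex_RInt_lin; apply continuous_ex_RInt; intros; apply HGc; try assumption; apply HitL.
    - intros s Hs.
      replace (G (fun j => it k j s) i + -1 * G (fun j => y j s) i)
        with (G (fun j => it k j s) i - G (fun j => y j s) i) by ring.
      eapply Rle_trans; [apply HL, Hi|]; apply Rmult_le_compat_l; [assumption|].
      unfold l1; rewrite <- rsum_const; apply rsum_le; intros j Hj.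
      eapply Rle_trans; [apply Hy, Hj|].
      apply Rmult_le_compat_r; [apply pow_le; lra|]; specialize (HKm s Hs); lra. }
  rewrite RInt_lin in H2
    by (apply continuous_ex_RInt; intros; apply HGc; try assumption; apply HitL).
  assert (H3 : it (S k) i t = y0 i + RInt (fun s => G (fun j => it k j s) i) 0 t)
    by (simpl; rewrite Hposid by assumption; reflexivity).
  replace (y i t - (y0 i + RInt (fun s => G (fun j => y j s) i) 0 t))
    with (- (it (S k) i t - y i t) + (RInt (fun s => G (fun j => it k j s) i) 0 t
      + -1 * RInt (fun s => G (fun j => y j s) i) 0 t)) by (rewrite H3; ring).
  eapply Rle_trans; [apply Rabs_triang|]; rewrite Rabs_Ropp.
  assert (H4 : 2 * K t * (1 / 2) ^ S k <= 2 * K t * (1 / 2) ^ k).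
  { apply Rmult_le_compat_l; [assert (H := HK0 t); lra|]; simpl.
    assert (0 <= (1 / 2) ^ k) by (apply pow_le; lra); lra. }
  lra. }
(* The limit [y] itself is constant for negative times and may have a corner at 0. Its integral form
   agrees with it for nonnegative times and is differentiable at 0 as well. *)
exists (fun i t => y0 i + RInt (fun s => G (fun j => y j s) i) 0 t); intros i Hi; split.
- rewrite (@RInt_point R_CompleteNormedModule); apply Rplus_0_r.
- intros t Ht.
  replace (G (fun j => y0 j + RInt (fun s => G (fun j0 => y j0 s) j) 0 t) i)
    with (0 + G (fun j => y j t) i).
  + apply (is_derive_plus (V := R_NormedModule)); [apply @is_derive_const|].
    apply (is_derive_RInt_continuous (fun s => G (fun j => y j s) i)).
    intros s; apply HGc; assumption.
  + rewrite Rplus_0_l; apply Rminus_diag_uniq, Rabs_eq_0, Rle_antisym; [|apply Rabs_pos].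
    eapply Rle_trans; [apply HL, Hi|].
    replace (l1 N _) with 0; [lra|symmetry].
    unfold l1; rewrite (rsum_ext N _ (fun _ => 0)), rsum_const; [ring|].
    intros j Hj; rewrite <- Hint by assumption; rewrite Rminus_diag; apply Rabs_R0.
Qed.

(** The continuity argument. Let [tau] be the supremum of the times up to which [F] stays below a
    level [V]. The derivative is nonpositive until then, so [F tau <= F 0 < V], and by continuity
    the bound persists beyond [tau]. *)
Lemma barrier (F : R -> R) (T D : R) : (forall t, continuous F t) -> F 0 < D ->
  (forall t, 0 < t < T -> F t <= D -> exists l, is_derive F t l /\ l <= 0) ->
  forall t, 0 <= t <= T -> F t <= F 0.
Proof.
intros Hc H0 Hd t1 Ht1; apply Rnot_lt_le; intros Hgt.
(* [V <= D] makes the hypothesis on the derivative available up to [tau]; [V <= F t1] prevents [tau]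
   from being [t1]. *)
set (V := Rmin (F t1) D).
assert (HV1 : V <= F t1) by apply Rmin_l; assert (HV2 : V <= D) by apply Rmin_r.
assert (HV0 : F 0 < V) by (apply Rmin_glb_lt; assumption).
assert (Hcont : forall t e, 0 < e -> exists d, 0 < d /\ forall s, Rabs (s - t) < d -> Rabs (F s - F t) < e).
{ intros t e He; destruct (Hc t (ball (F t) (mkposreal e He)) (locally_ball _ _)) as [d Hd'].
  exists d; split; [apply cond_pos|exact Hd']. }
set (S0 := fun s => 0 <= s <= t1 /\ forall r, 0 <= r <= s -> F r <= V).
assert (HS0 : S0 0) by (split; [lra|intros r Hr; replace r with 0 by lra; lra]).
destruct (completeness S0) as [tau [Hub Hlub]].
{ exists t1; intros s [Hs _]; lra. }
{ exists 0; exact HS0. }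
assert (Ht0 : 0 <= tau) by (apply Hub, HS0).
assert (Ht1' : tau <= t1) by (apply Hlub; intros s [Hs _]; lra).
assert (Hlt : forall r, 0 <= r < tau -> F r <= V).
{ intros r Hr; apply NNPP; intros Hn.
  assert (tau <= r); [|lra].
  apply Hlub; intros s [Hs1 Hs2]; apply Rnot_lt_le; intros Hrs; apply Hn, Hs2; lra. }
assert (Htau : F tau <= F 0).
{ destruct Ht0 as [Ht0| <-]; [|lra].
  (* The mean value theorem may return an end point of the interval; with the value 0 there, [df] is
     nonpositive everywhere. *)
  set (df := fun x => if Rlt_dec 0 x then if Rlt_dec x tau then Derive F x else 0 else 0).
  destruct (MVT_gen F 0 tau df) as [c [_ Hc']].
  - intros x; rewrite Rmin_left, Rmax_right by lra; intros Hx; unfold df.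
    destruct (Rlt_dec 0 x); [|lra]; destruct (Rlt_dec x tau); [|lra].
    destruct (Hd x ltac:(lra)) as [l [Hl _]]; [assert (H := Hlt x ltac:(lra)); lra|].
    apply Derive_correct; exists l; exact Hl.
  - intros; apply continuity_pt_filterlim, Hc.
  - assert (df c <= 0).
    { unfold df; destruct (Rlt_dec 0 c); [|lra]; destruct (Rlt_dec c tau); [|lra].
      destruct (Hd c ltac:(lra)) as [l [Hl Hl0]]; [assert (H := Hlt c ltac:(lra)); lra|].
      rewrite (is_derive_unique _ _ _ Hl); assumption. }
    assert (df c * (tau - 0) <= 0 * (tau - 0)) by (apply Rmult_le_compat_r; lra); lra. }
destruct (Hcont tau (V - F tau) ltac:(lra)) as [d [Hd0 Hdd]].
set (s := Rmin (tau + d / 2) t1).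
assert (Hs1 : s <= tau + d / 2) by apply Rmin_l; assert (Hs2 : s <= t1) by apply Rmin_r.
assert (Htt : tau < t1).
{ destruct Ht1' as [H| ->]; [assumption|lra]. }
assert (Hs3 : tau < s) by (apply Rmin_glb_lt; lra).
assert (s <= tau); [|lra].
apply Hub; split; [lra|]; intros r Hr; destruct (Rlt_dec r tau) as [H|H]; [apply Hlt; lra|].
assert (Hr' := Hdd r ltac:(apply Rabs_def1; lra)); apply Rabs_def2 in Hr'; lra.
Qed.

(** Gronwall with a differential inequality that holds only while [E <= D]. [barrier] is applied to
    [(E t + a) * exp (- K * t)] at the level [(D + a) * exp (- K * T)]: below it, [E t <= D] for
    every [t] in the interval. *)
Lemma gronwall_barrier (E dE : R -> R) (T K a D : R) : 0 < T -> 0 <= K -> 0 <= D + a ->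
  continuous_on (fun t => 0 <= t <= T) E ->
  (forall t, 0 < t < T -> is_derive E t (dE t)) ->
  (forall t, 0 < t < T -> E t <= D -> dE t <= K * (E t + a)) ->
  (E 0 + a) * exp (K * T) < D + a ->
  forall t, 0 <= t <= T -> E t + a <= (E 0 + a) * exp (K * t).
Proof.
intros HT HK HDa Hc Hd Hineq H0 t Ht.
set (F := fun s => (E (clamp 0 T s) + a) * exp (- K * clamp 0 T s)).
assert (HF : forall t, 0 <= t <= T -> F t = (E t + a) * exp (- K * t))
  by (intros s Hs; unfold F; rewrite clamp_id by assumption; reflexivity).
assert (HE : forall x, exp (K * x) * exp (- K * x) = 1).
{ intros x; rewrite <- exp_plus; replace (K * x + - K * x) with 0 by ring; apply exp_0. }
assert (HFt : F t <= F 0).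
{ apply (barrier F T ((D + a) * exp (- K * T))); [| | |assumption].
  - intros s; apply continuous_mult_R.
    + apply continuous_plus_R; [|apply continuous_const].
      rewrite continuous_on_clamp in Hc by lra; apply Hc.
    + apply (continuous_comp (clamp 0 T) (fun x => exp (- K * x))); [apply clamp_continuous|].
      apply (@ex_derive_continuous R_AbsRing R_NormedModule); auto_derive; exact I.
  - rewrite HF by lra; replace (- K * 0) with 0 by ring; rewrite exp_0, Rmult_1_r.
    apply Rmult_lt_compat_r with (r := exp (- K * T)) in H0; [|apply exp_pos].
    rewrite Rmult_assoc, HE, Rmult_1_r in H0; exact H0.
  - intros s Hs Hle; exists ((dE s - K * (E s + a)) * exp (- K * s)); split.
    + apply (is_derive_ext_loc (fun x => (E x + a) * exp (- K * x))).
      * apply (locally_open 0 T); [assumption|]; intros z Hz; symmetry; apply HF; lra.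
      * assert (H1 : is_derive (fun x => E x + a) s (dE s + 0)).
        { apply (is_derive_plus (V := R_NormedModule)); [apply Hd, Hs|apply @is_derive_const]. }
        assert (H2 : is_derive (fun x => exp (- K * x)) s (- K * exp (- K * s)))
          by (auto_derive; [exact I|ring]).
        replace ((dE s - K * (E s + a)) * exp (- K * s))
          with ((dE s + 0) * exp (- K * s) + (E s + a) * (- K * exp (- K * s))) by ring.
        apply (is_derive_mult_R (fun x => E x + a) (fun x => exp (- K * x))); assumption.
    + assert (H1 : dE s <= K * (E s + a)).
      { apply Hineq; [assumption|]; rewrite HF in Hle by lra.
        assert (H1 : exp (- K * T) <= exp (- K * s)).
        { destruct (Req_dec K 0) as [->|Hn]; [right; f_equal; ring|].
          apply Rlt_le, exp_increasing; assert (K * s < K * T) by (apply Rmult_lt_compat_l; lra); lra. }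
        assert (H2 := exp_pos (- K * s)).
        assert (H3 : (D + a) * exp (- K * T) <= (D + a) * exp (- K * s)) by (apply Rmult_le_compat_l; assumption).
        assert (E s + a <= D + a) by (apply Rmult_le_reg_r with (exp (- K * s)); lra); lra. }
      assert (H2 := exp_pos (- K * s)).
      rewrite <- (Rmult_0_l (exp (- K * s))); apply Rmult_le_compat_r; lra. }
rewrite !HF in HFt by lra; replace (- K * 0) with 0 in HFt by ring; rewrite exp_0, Rmult_1_r in HFt.
apply Rmult_le_reg_r with (exp (- K * t)); [apply exp_pos|].
rewrite Rmult_assoc, HE, Rmult_1_r; exact HFt.
Qed.

Lemma continuous_on_rsum (T : R) (N : nat) (f : nat -> R -> R) : 0 <= T ->
  (forall i, (i < N)%nat -> continuous_on (fun t => 0 <= t <= T) (f i)) ->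
  continuous_on (fun t => 0 <= t <= T) (fun t => rsum N (fun i => f i t)).
Proof.
intros HT; induction N as [|N IH]; intros H; rewrite continuous_on_clamp by assumption; intros x; simpl.
- apply continuous_const.
- apply continuous_plus_R.
  + assert (H1 := IH ltac:(intros; apply H; lia)); rewrite continuous_on_clamp in H1 by assumption; apply H1.
  + assert (H1 := H N ltac:(lia)); rewrite continuous_on_clamp in H1 by assumption; apply H1.
Qed.

Lemma continuous_on_sqr_minus (T : R) (f g : R -> R) : 0 <= T ->
  continuous_on (fun t => 0 <= t <= T) f -> continuous_on (fun t => 0 <= t <= T) g ->
  continuous_on (fun t => 0 <= t <= T) (fun t => (f t - g t) * (f t - g t)).
Proof.
intros HT Hf Hg; rewrite continuous_on_clamp in * by assumption; intros x.
assert (H : continuous (fun t => f (clamp 0 T t) + (-1) * g (clamp 0 T t)) x)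
  by (apply continuous_plus_R; [apply Hf|apply continuous_mult_R; [apply continuous_const|apply Hg]]).
apply (continuous_ext (fun t => (f (clamp 0 T t) + (-1) * g (clamp 0 T t)) * (f (clamp 0 T t) + (-1) * g (clamp 0 T t)))).
- intros; apply f_equal2; ring.
- apply continuous_mult_R; exact H.
Qed.

Lemma is_derive_sqr_minus (f g : R -> R) (t l m : R) : is_derive f t l -> is_derive g t m ->
  is_derive (fun t => (f t - g t) * (f t - g t)) t (2 * (f t - g t) * (l - m)).
Proof.
intros Hf Hg.
replace (2 * (f t - g t) * (l - m)) with ((l - m) * (f t - g t) + (f t - g t) * (l - m)) by ring.
apply (is_derive_mult_R (fun t => f t - g t) (fun t => f t - g t));
  apply (is_derive_minus (V := R_NormedModule) f g); assumption.
Qed.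

(** Gronwall for the sum of squared differences, with [l1 ^ 2 <= INR N * E] by Cauchy-Schwarz. It
    starts at zero, so any positive level would do as barrier; 1 is taken. *)
Lemma ode_unique (N : nat) (G : (nat -> R) -> nat -> R) (L T : R) (y z : nat -> R -> R) :
  0 < T -> 0 <= L ->
  (forall y z i, (i < N)%nat -> Rabs (G y i - G z i) <= L * l1 N (fun j => y j - z j)) ->
  (forall i, (i < N)%nat -> y i 0 = z i 0) ->
  (forall i, (i < N)%nat -> continuous_on (fun t => 0 <= t <= T) (y i)) ->
  (forall i, (i < N)%nat -> continuous_on (fun t => 0 <= t <= T) (z i)) ->
  (forall i t, (i < N)%nat -> 0 < t < T -> is_derive (y i) t (G (fun j => y j t) i)) ->
  (forall i t, (i < N)%nat -> 0 < t < T -> is_derive (z i) t (G (fun j => z j t) i)) ->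
  forall i t, (i < N)%nat -> 0 <= t <= T -> y i t = z i t.
Proof.
intros HT HL0 HL H0 Hyc Hzc Hyd Hzd i t Hi Ht.
set (E := fun t => rsum N (fun i => (y i t - z i t) * (y i t - z i t))).
assert (HE0 : E 0 = 0).
{ unfold E; rewrite (rsum_ext N _ (fun _ => 0)), rsum_const; [ring|].
  intros j Hj; rewrite H0 by assumption; ring. }
assert (HEpos : forall t, 0 <= E t) by (intros; apply rsum_ge0; intros; apply Rle_0_sqr).
assert (HE : E t + 0 <= (E 0 + 0) * exp (2 * (L * INR N) * t)).
{ apply (gronwall_barrier E (fun t => rsum N (fun i => 2 * (y i t - z i t)
    * (G (fun j => y j t) i - G (fun j => z j t) i))) T _ 0 1); try assumption; try lra.
  - apply Rmult_le_pos; [lra|]; apply Rmult_le_pos; [assumption|apply pos_INR].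
  - apply continuous_on_rsum; [lra|]; intros j Hj; apply continuous_on_sqr_minus; auto; lra.
  - intros s Hs; apply (is_derive_rsum N (fun i t => (y i t - z i t) * (y i t - z i t))
      (fun i t => 2 * (y i t - z i t) * (G (fun j => y j t) i - G (fun j => z j t) i))).
    intros j Hj; apply is_derive_sqr_minus; [apply Hyd|apply Hzd]; assumption.
  - intros s Hs _; set (d := l1 N (fun j => y j s - z j s)).
    apply Rle_trans with (2 * (L * (d * d))).
    + apply Rle_trans with (rsum N (fun j => (2 * L * d) * Rabs (y j s - z j s))).
      * apply rsum_le; intros j Hj.
        eapply Rle_trans; [apply Rle_abs|]; rewrite !Rabs_mult, (Rabs_pos_eq 2) by lra.
        assert (H := HL (fun j => y j s) (fun j => z j s) j Hj); fold d in H.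
        assert (2 * Rabs (y j s - z j s) * Rabs (G (fun j => y j s) j - G (fun j => z j s) j)
          <= 2 * Rabs (y j s - z j s) * (L * d)).
        { apply Rmult_le_compat_l; [|assumption]; assert (H1 := Rabs_pos (y j s - z j s)); lra. }
        lra.
      * rewrite rsum_scal; fold (l1 N (fun j => y j s - z j s)); fold d; right; ring.
    + assert (H := rsum_cauchy_schwarz N (fun j => Rabs (y j s - z j s)) (fun _ => 1)).
      rewrite (rsum_ext N _ (fun j => Rabs (y j s - z j s))) in H by (intros; ring).
      fold (l1 N (fun j => y j s - z j s)) in H; fold d in H.
      rewrite rsum_const, (rsum_ext N (fun j => Rabs (y j s - z j s) ^ 2)
        (fun j => (y j s - z j s) * (y j s - z j s))) in H
        by (intros; rewrite pow2_abs; ring).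
      fold (E s) in H.
      assert (L * d ^ 2 <= L * (E s * (INR N * 1 ^ 2))) by (apply Rmult_le_compat_l; assumption).
      lra.
  - rewrite HE0; lra. }
rewrite HE0 in HE.
assert (H1 := rsum_term_le N (fun i => (y i t - z i t) * (y i t - z i t)) i
  ltac:(intros; apply Rle_0_sqr) Hi).
assert (H2 := Rle_0_sqr (y i t - z i t)); unfold Rsqr in H2; fold (E t) in H1.
apply Rminus_diag_uniq, Rsqr_0_uniq; unfold Rsqr; lra.
Qed.

(** * Truncated quadratic fields *)

Definition bounded_lipschitz (N : nat) (f : (nat -> R) -> R) : Prop :=
  exists B, 0 <= B /\ (forall y, Rabs (f y) <= B) /\
    forall y z, Rabs (f y - f z) <= B * l1 N (fun j => y j - z j).

Lemma bounded_lipschitz_const N c : bounded_lipschitz N (fun _ => c).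
Proof.
exists (Rabs c); split; [apply Rabs_pos|split; [intros; lra|]].
intros; rewrite Rminus_diag, Rabs_R0; apply Rmult_le_pos; [apply Rabs_pos|apply l1_ge0].
Qed.

Lemma bounded_lipschitz_coord N M j : (j < N)%nat -> 0 <= M ->
  bounded_lipschitz N (fun y => clamp (- M) M (y j)).
Proof.
intros Hj HM; exists (M + 1); split; [lra|split].
- intros y; assert (H := clamp_bounds (- M) M (y j) ltac:(lra)); apply Rabs_le; lra.
- intros y z; eapply Rle_trans; [apply clamp_lipschitz|].
  assert (H := rsum_term_le N (fun j => Rabs (y j - z j)) j ltac:(intros; apply Rabs_pos) Hj).
  fold (l1 N (fun j => y j - z j)) in H; assert (H1 := l1_ge0 N (fun j => y j - z j)).
  assert (0 <= M * l1 N (fun j => y j - z j)) by (apply Rmult_le_pos; assumption); lra.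
Qed.

Lemma bounded_lipschitz_plus N f g : bounded_lipschitz N f -> bounded_lipschitz N g ->
  bounded_lipschitz N (fun y => f y + g y).
Proof.
intros [B [HB [H1 H2]]] [B' [HB' [H3 H4]]]; exists (B + B'); split; [lra|split].
- intros y; eapply Rle_trans; [apply Rabs_triang|]; specialize (H1 y); specialize (H3 y); lra.
- intros y z; replace (f y + g y - (f z + g z)) with ((f y - f z) + (g y - g z)) by ring.
  eapply Rle_trans; [apply Rabs_triang|]; specialize (H2 y z); specialize (H4 y z); lra.
Qed.

(** The bound on one factor multiplies the Lipschitz constant of the other, which is why boundedness
    and Lipschitz continuity are kept together. *)
Lemma bounded_lipschitz_mult N f g : bounded_lipschitz N f -> bounded_lipschitz N g ->
  bounded_lipschitz N (fun y => f y * g y).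
Proof.
intros [B [HB [H1 H2]]] [B' [HB' [H3 H4]]]; exists (2 * (B * B') + B * B').
assert (HBB : 0 <= B * B') by (apply Rmult_le_pos; assumption).
split; [lra|split].
- intros y; rewrite Rabs_mult.
  assert (Rabs (f y) * Rabs (g y) <= B * B')
    by (apply Rmult_le_compat; try apply Rabs_pos; auto); lra.
- intros y z; replace (f y * g y - f z * g z) with ((f y - f z) * g y + f z * (g y - g z)) by ring.
  eapply Rle_trans; [apply Rabs_triang|]; rewrite !Rabs_mult.
  assert (H0 := l1_ge0 N (fun j => y j - z j)); set (d := l1 N _) in *.
  assert (Rabs (f y - f z) * Rabs (g y) <= (B * d) * B')
    by (apply Rmult_le_compat; try apply Rabs_pos; auto).
  assert (Rabs (f z) * Rabs (g y - g z) <= B * (B' * d))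
    by (apply Rmult_le_compat; try apply Rabs_pos; auto).
  assert (0 <= B * B' * d) by (apply Rmult_le_pos; assumption); lra.
Qed.

Lemma bounded_lipschitz_rsum N n (f : nat -> (nat -> R) -> R) :
  (forall i, (i < n)%nat -> bounded_lipschitz N (f i)) ->
  bounded_lipschitz N (fun y => rsum n (fun i => f i y)).
Proof.
induction n as [|n IH]; intros H; simpl; [apply bounded_lipschitz_const|].
apply (bounded_lipschitz_plus N (fun y => rsum n (fun i => f i y))); [apply IH; intros|]; apply H; lia.
Qed.

(** The shape of the Galerkin system: minus the sum of a linear and a quadratic part, [A j i] and
    [Q j k i] being the values of the flux forms on basis elements. *)
Definition quadratic_field (N : nat) (A : nat -> nat -> R) (Q : nat -> nat -> nat -> R)
    (c : nat -> R) (i : nat) : R :=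
  - (rsum N (fun j => c j * A j i) + rsum N (fun j => c j * rsum N (fun k => c k * Q j k i))).

Lemma truncated_field_lipschitz (N : nat) A Q (M : R) : 0 <= M ->
  exists B, 0 <= B /\
    (forall y i, (i < N)%nat ->
       Rabs (quadratic_field N A Q (fun j => clamp (- M) M (y j)) i) <= B) /\
    (forall y z i, (i < N)%nat ->
       Rabs (quadratic_field N A Q (fun j => clamp (- M) M (y j)) i
             - quadratic_field N A Q (fun j => clamp (- M) M (z j)) i)
       <= B * l1 N (fun j => y j - z j)).
Proof.
intros HM.
assert (Hi : forall i, bounded_lipschitz N (fun y => quadratic_field N A Q (fun j => clamp (- M) M (y j)) i)).
{ intros i; destruct (bounded_lipschitz_mult N (fun _ => -1)
    (fun y => rsum N (fun j => clamp (- M) M (y j) * A j i)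
      + rsum N (fun j => clamp (- M) M (y j) * rsum N (fun k => clamp (- M) M (y k) * Q j k i))))
    as [B [HB [H1 H2]]].
  - apply bounded_lipschitz_const.
  - apply bounded_lipschitz_plus; apply bounded_lipschitz_rsum; intros j Hj;
      apply bounded_lipschitz_mult; try (apply bounded_lipschitz_coord; assumption).
    + apply bounded_lipschitz_const.
    + apply bounded_lipschitz_rsum; intros k Hk; apply bounded_lipschitz_mult;
        [apply bounded_lipschitz_coord; assumption|apply bounded_lipschitz_const].
  - exists B; split; [assumption|split].
    + intros y; specialize (H1 y); unfold quadratic_field.
      replace (- _) with (-1 * (rsum N (fun j => clamp (- M) M (y j) * A j i)
        + rsum N (fun j => clamp (- M) M (y j) * rsum N (fun k => clamp (- M) M (y k) * Q j k i)))) by ring.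
      exact H1.
    + intros y z; specialize (H2 y z); unfold quadratic_field.
      eapply Rle_trans; [right|exact H2]; f_equal; ring. }
assert (H : forall n, exists B, 0 <= B /\ forall i, (i < n)%nat ->
  (forall y, Rabs (quadratic_field N A Q (fun j => clamp (- M) M (y j)) i) <= B) /\
  (forall y z, Rabs (quadratic_field N A Q (fun j => clamp (- M) M (y j)) i
             - quadratic_field N A Q (fun j => clamp (- M) M (z j)) i)
       <= B * l1 N (fun j => y j - z j))).
{ induction n as [|n [B [HB0 HB]]]; [exists 0; split; [lra|intros; lia]|].
  destruct (Hi n) as [B' [HB0' [H1 H2]]]; exists (B + B'); split; [lra|].
  intros i Hin.
  assert (Hl : forall y z, 0 <= B * l1 N (fun j => y j - z j) /\ 0 <= B' * l1 N (fun j => y j - z j))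
    by (intros; split; apply Rmult_le_pos; try assumption; apply l1_ge0).
  destruct (Nat.eq_dec i n) as [->|Hn]; split.
  - intros y; specialize (H1 y); lra.
  - intros y z; specialize (H2 y z); specialize (Hl y z); lra.
  - intros y; destruct (HB i ltac:(lia)) as [H3 _]; specialize (H3 y); lra.
  - intros y z; destruct (HB i ltac:(lia)) as [_ H3]; specialize (H3 y z); specialize (Hl y z); lra. }
destruct (H N) as [B [HB0 HB]]; exists B; split; [assumption|split].
- intros y i Hiy; apply HB, Hiy.
- intros y z i Hiy; apply HB, Hiy.
Qed.

(** * Functions of space and time *)

Definition continuous_rect (T : R) (f : R -> R -> R) : Prop :=
  continuous_on (rect T) (fun p => f (fst p) (snd p)).

Lemma continuous_rect_clamp (T : R) (f : R -> R -> R) (x t : R) : 0 < T -> continuous_rect T f ->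
  continuity_2d_pt (fun x t => f (clamp 0 1 x) (clamp 0 T t)) x t.
Proof.
intros HT Hf; apply continuity_2d_pt_filterlim.
apply (filterlim_comp _ _ _ (fun z : R * R => (clamp 0 1 (fst z), clamp 0 T (snd z)))
  (fun p => f (fst p) (snd p)) _ (within (rect T) (locally (clamp 0 1 x, clamp 0 T t)))).
- intros Q [e He]; exists e; intros z [Hz1 Hz2]; apply He.
  + split; simpl.
    * eapply Rle_lt_trans; [apply clamp_lipschitz|exact Hz1].
    * eapply Rle_lt_trans; [apply clamp_lipschitz|exact Hz2].
  + split; apply clamp_bounds; lra.
- apply (Hf (clamp 0 1 x, clamp 0 T t)); split; apply clamp_bounds; lra.
Qed.

Lemma continuous_rect_uniform (T : R) (f : R -> R -> R) (e : R) : 0 < T -> continuous_rect T f -> 0 < e ->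
  exists d, 0 < d /\ forall x y s t, 0 <= x <= 1 -> 0 <= y <= 1 -> 0 <= s <= T -> 0 <= t <= T ->
    Rabs (y - x) < d -> Rabs (t - s) < d -> Rabs (f y t - f x s) < e.
Proof.
intros HT Hf He.
destruct (uniform_continuity_2d (fun x t => f (clamp 0 1 x) (clamp 0 T t)) 0 1 0 T) with (eps := mkposreal e He) as [d Hd].
- intros; apply continuous_rect_clamp; assumption.
- exists d; split; [apply cond_pos|].
  intros x y s t Hx Hy Hs Ht H1 H2; assert (H := Hd x s y t Hx Hs Hy Ht H1 H2).
  simpl in H; rewrite !clamp_id in H by assumption; exact H.
Qed.

(** Walk from the origin to (x, t) along a segment in [n] equal steps, with [n > (1 + T) / d]. Each
    step is shorter than [d] in both coordinates and changes [f] by less than 1. *)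
Lemma continuous_rect_bounded (T : R) (f : R -> R -> R) : 0 < T -> continuous_rect T f ->
  exists M, 0 <= M /\ forall x t, 0 <= x <= 1 -> 0 <= t <= T -> Rabs (f x t) <= M.
Proof.
intros HT Hf; destruct (continuous_rect_uniform T f 1 HT Hf Rlt_0_1) as [d [Hd Hu]].
destruct (INR_unbounded ((1 + T) / d)) as [n Hn].
assert (Hn0 : 0 < INR n).
{ assert (0 < (1 + T) / d) by (apply Rdiv_lt_0_compat; lra); lra. }
assert (Hnd : (1 + T) / INR n < d).
{ apply Rlt_div_l; [assumption|]; apply Rlt_div_l in Hn; [|assumption].
  rewrite Rmult_comm; exact Hn. }
exists (Rabs (f 0 0) + INR n); split; [assert (H := Rabs_pos (f 0 0)); lra|].
intros x t Hx Ht.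
assert (Hstep : forall j, (j <= n)%nat -> Rabs (f (x * (INR j / INR n)) (t * (INR j / INR n))) <= Rabs (f 0 0) + INR j).
{ assert (Hb : forall j, (j <= n)%nat -> 0 <= INR j / INR n <= 1).
  { intros j Hj; split; [apply Rdiv_le_0_compat; [apply pos_INR|assumption]|].
    apply Rle_div_l; [assumption|]; rewrite Rmult_1_l; apply le_INR, Hj. }
  assert (Hsc : forall c y j, 0 <= y <= c -> (j <= n)%nat -> 0 <= y * (INR j / INR n) <= c).
  { intros c y j Hy Hj; specialize (Hb j Hj); split; [apply Rmult_le_pos; lra|].
    assert (y * (INR j / INR n) <= c * 1) by (apply Rmult_le_compat; lra); lra. }
  induction j as [|j IH]; intros Hj.
  - unfold Rdiv; simpl INR; rewrite Rmult_0_l, !Rmult_0_r; lra.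
  - specialize (IH ltac:(lia)); rewrite S_INR.
    assert (Hd1 : forall y, 0 <= y <= 1 + T ->
      Rabs (y * ((INR j + 1) / INR n) - y * (INR j / INR n)) < d).
    { intros y Hy; replace (y * ((INR j + 1) / INR n) - y * (INR j / INR n)) with (y / INR n) by (field; lra).
      rewrite Rabs_pos_eq by (apply Rdiv_le_0_compat; lra).
      eapply Rle_lt_trans; [|exact Hnd].
      apply Rmult_le_compat_r; [apply Rlt_le, Rinv_0_lt_compat, Hn0|lra]. }
    assert (H1 := Hsc 1 x (S j) Hx Hj); assert (H2 := Hsc T t (S j) Ht Hj).
    rewrite S_INR in H1, H2.
    assert (H := Hu (x * (INR j / INR n)) (x * ((INR j + 1) / INR n))
      (t * (INR j / INR n)) (t * ((INR j + 1) / INR n))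
      (Hsc 1 x j Hx ltac:(lia)) H1 (Hsc T t j Ht ltac:(lia)) H2 (Hd1 x ltac:(lra)) (Hd1 t ltac:(lra))).
    set (u := f (x * ((INR j + 1) / INR n)) (t * ((INR j + 1) / INR n))) in *.
    set (v := f (x * (INR j / INR n)) (t * (INR j / INR n))) in *.
    replace u with ((u - v) + v) by ring.
    eapply Rle_trans; [apply Rabs_triang|]; lra. }
specialize (Hstep n (Nat.le_refl _)).
replace (INR n / INR n) with 1 in Hstep by (field; lra); rewrite !Rmult_1_r in Hstep; exact Hstep.
Qed.

Lemma continuous_rect_slice_x (T : R) (f : R -> R -> R) (t : R) : 0 < T -> continuous_rect T f ->
  0 <= t <= T -> continuous_on (fun x => 0 <= x <= 1) (fun x => f x t).
Proof.
intros HT Hf Ht; apply continuous_on_clamp; [lra|]; intros x P [e He].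
destruct (continuous_rect_uniform T f e HT Hf (cond_pos e)) as [d [Hd Hu]].
exists (mkposreal d Hd); intros y Hy; apply He.
apply Hu; try assumption; try (apply clamp_bounds; lra).
- eapply Rle_lt_trans; [apply clamp_lipschitz|exact Hy].
- rewrite Rminus_diag, Rabs_R0; exact Hd.
Qed.

Lemma Cm_rect_continuous m T f : Cm_rect m T f -> continuous_rect T f.
Proof. destruct m; intros H; apply H. Qed.

Lemma Cm_rect_Dx m T f : Cm_rect (S m) T f -> Cm_rect m T (Dx f).
Proof. intros H; apply H. Qed.

Lemma Cm_rect_Dt m T f : Cm_rect (S m) T f -> Cm_rect m T (Dt T f).
Proof. intros H; apply H. Qed.

Lemma Cm_rect_le j m T f : (j <= m)%nat -> Cm_rect m T f -> Cm_rect j T f.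
Proof.
revert m f; induction j as [|j IH]; intros m f Hj H.
- split; [apply (Cm_rect_continuous m), H|exact I].
- destruct m as [|m]; [lia|]; destruct H as [H1 [H2 [H3 H4]]].
  split; [assumption|split; [assumption|split; apply (IH m); try assumption; lia]].
Qed.

Lemma Cm_rect_slice m T f t : 0 < T -> Cm_rect m T f -> 0 <= t <= T -> Ck_on m 0 1 (fun x => f x t).
Proof.
intros HT; revert f; induction m as [|m IH]; intros f Hf Ht.
- split; [apply (continuous_rect_slice_x T); try assumption; apply Hf|exact I].
- split; [apply (continuous_rect_slice_x T); try assumption; apply Hf|split].
  + intros x Hx; apply Hf; assumption.
  + apply (IH (Dx f)); [apply Hf|assumption].
Qed.

Lemma Cm_rect_Dn_bounded m T f : 0 < T -> Cm_rect m T f ->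
  exists M, 0 <= M /\ forall x t, 0 <= x <= 1 -> 0 <= t <= T -> Rabs (Dn m (fun y => f y t) x) <= M.
Proof.
intros HT; revert f; induction m as [|m IH]; intros f Hf.
- apply continuous_rect_bounded; [assumption|apply Hf].
- apply (IH (Dx f)), Hf.
Qed.

Lemma continuous_on_pwc P f : continuous_on (fun x => 0 <= x <= 1) f -> pwc P f.
Proof.
intros Hf; rewrite continuous_on_clamp in Hf by lra.
apply (pwc_ext P (fun x => f (clamp 0 1 x))); [|apply pwc_continuous, Hf].
intros x Hx; apply off_nodes_bounds in Hx; rewrite clamp_id by lra; reflexivity.
Qed.

Lemma continuous_rect_pwc P T f t : 0 < T -> continuous_rect T f -> 0 <= t <= T -> pwc P (fun x => f x t).
Proof. intros HT Hf Ht; apply continuous_on_pwc, (continuous_rect_slice_x T); assumption. Qed.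

(** The pointwise inequality [|w| <= 1 + w^2] takes the place of Cauchy-Schwarz for integrals;
    below, [c] is made arbitrarily small. *)
Lemma int01_small P g w c : pwc P g -> pwc P w -> 0 <= c -> (forall x, off_nodes P x -> Rabs (g x) <= c) ->
  Rabs (int01 (fun x => g x * w x)) <= c * (1 + int01 (fun x => w x * w x)).
Proof.
intros Hg Hw Hc H.
assert (Hww : pwc P (fun x => 1 + w x * w x)) by (eauto with pw).
assert (Hp : forall x, off_nodes P x -> Rabs (g x * w x) <= c * (1 + w x * w x)).
{ intros x Hx; rewrite Rabs_mult; apply Rmult_le_compat; try apply Rabs_pos; [apply H, Hx|].
  apply Rabs_le; split; nra. }
replace (1 + int01 (fun x => w x * w x)) with (int01 (fun x => 1 + w x * w x))
  by (rewrite (int01_plus P), int01_const by (eauto with pw); reflexivity).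
rewrite <- (int01_scal P) by assumption.
apply Rabs_le; split.
- replace (- int01 (fun x => c * (1 + w x * w x))) with (int01 (fun x => -1 * (c * (1 + w x * w x))))
    by (rewrite (int01_scal P) by (eauto with pw); ring).
  apply (int01_le P); [eauto with pw..|].
  intros x Hx; specialize (Hp x Hx); apply Rabs_le_between in Hp; lra.
- apply (int01_le P); [eauto with pw..|].
  intros x Hx; specialize (Hp x Hx); apply Rabs_le_between in Hp; lra.
Qed.

Lemma int01_param_continuous P T f w : 0 < T -> continuous_rect T f -> pwc P w ->
  continuous_on (fun t => 0 <= t <= T) (fun t => int01 (fun x => f x t * w x)).
Proof.
intros HT Hf Hw; apply continuous_on_clamp; [lra|]; intros t Q [e He].
set (W := 1 + int01 (fun x => w x * w x)).
assert (HW : 0 < W).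
{ assert (0 <= int01 (fun x => w x * w x)); [|unfold W; lra].
  apply (int01_ge0 P); [eauto with pw|intros; apply Rle_0_sqr]. }
assert (He' : 0 < e / (2 * W)) by (apply Rdiv_lt_0_compat; [apply cond_pos|lra]).
destruct (continuous_rect_uniform T f _ HT Hf He') as [d [Hd Hu]].
exists (mkposreal d Hd); intros s Hs; apply He.
assert (Hct := clamp_bounds 0 T t ltac:(lra)); assert (Hcs := clamp_bounds 0 T s ltac:(lra)).
assert (P1 := continuous_rect_pwc P T f _ HT Hf Hct); assert (P2 := continuous_rect_pwc P T f _ HT Hf Hcs).
change (Rabs (int01 (fun x => f x (clamp 0 T s) * w x) - int01 (fun x => f x (clamp 0 T t) * w x)) < e).
rewrite <- (int01_minus P) by (eauto with pw).
rewrite (int01_ext P _ (fun x => (f x (clamp 0 T s) - f x (clamp 0 T t)) * w x))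
  by (intros; try ring; eauto 6 with pw).
eapply Rle_lt_trans; [apply (int01_small P) with (c := e / (2 * W)); [eauto with pw|assumption|lra|]|].
- intros x Hx; apply off_nodes_bounds in Hx; apply Rlt_le, Hu; try lra.
  + rewrite Rminus_diag, Rabs_R0; exact Hd.
  + eapply Rle_lt_trans; [apply clamp_lipschitz|exact Hs].
- fold W; replace (e / (2 * W) * W) with (e / 2) by (field; lra); assert (H := cond_pos e); lra.
Qed.

(** By the mean value theorem the difference quotient is [Dt T f] at a nearby time, and uniform
    continuity on the rectangle makes the convergence uniform in [x]. The weight [w] may jump at
    nodes. *)
Lemma int01_param_derive P T f w t : 0 < T -> Cm_rect 1 T f -> pwc P w -> 0 < t < T ->
  is_derive (fun t => int01 (fun x => f x t * w x)) t (int01 (fun x => Dt T f x t * w x)).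
Proof.
intros HT [Hf [Hd [_ [Hft _]]]] Hw Ht; apply is_derive_Reals; intros e He.
set (W := 1 + int01 (fun x => w x * w x)).
assert (HW : 0 < W).
{ assert (0 <= int01 (fun x => w x * w x)); [|unfold W; lra].
  apply (int01_ge0 P); [eauto with pw|intros; apply Rle_0_sqr]. }
assert (He' : 0 < e / (2 * W)) by (apply Rdiv_lt_0_compat; lra).
destruct (continuous_rect_uniform T _ _ HT Hft He') as [d [Hd0 Hu]].
assert (Hm : 0 < Rmin d (Rmin t (T - t))) by (repeat apply Rmin_glb_lt; lra).
exists (mkposreal _ Hm); simpl; intros h Hh0 Hh.
assert (M1 := Rmin_l d (Rmin t (T - t))); assert (M2 := Rmin_r d (Rmin t (T - t))).
assert (M3 := Rmin_l t (T - t)); assert (M4 := Rmin_r t (T - t)).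
assert (Hhd : Rabs h < d) by lra.
assert (Hth : 0 < t + h < T) by (apply Rabs_def2 in Hh; lra).
assert (P1 := continuous_rect_pwc P T f t HT Hf ltac:(lra)).
assert (P2 := continuous_rect_pwc P T f (t + h) HT Hf ltac:(lra)).
assert (P3 := continuous_rect_pwc P T (Dt T f) t HT Hft ltac:(lra)).
assert (Hpt : forall x, 0 <= x <= 1 -> Rabs (/ h * (f x (t + h) - f x t) - Dt T f x t) <= e / (2 * W)).
{ intros x Hx.
  assert (Hmvt : exists c, f x (t + h) - f x t = Dt T f x c * h /\ Rabs (c - t) <= Rabs h /\ 0 < c < T).
  { assert (HD : forall c, 0 < c < T -> derivable_pt_lim (fun s => f x s) c (Dt T f x c)).
    { intros c Hc; apply is_derive_Reals, (is_derive_on_interior 0 T); [assumption|].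
      apply Derive_on_correct; [lra|lra|apply Hd; lra]. }
    destruct (Rlt_dec 0 h) as [Hp|Hp].
    - destruct (MVT_cor2 (fun s => f x s) (fun s => Dt T f x s) t (t + h)) as [c [Hc1 Hc2]]; [lra| |].
      + intros c Hc; apply HD; lra.
      + exists c; split; [rewrite Hc1; ring|split; [|lra]].
        rewrite !Rabs_pos_eq; lra.
    - destruct (MVT_cor2 (fun s => f x s) (fun s => Dt T f x s) (t + h) t) as [c [Hc1 Hc2]]; [lra| |].
      + intros c Hc; apply HD; lra.
      + exists c; split; [lra|split; [|lra]].
        rewrite !Rabs_left1; lra. }
  destruct Hmvt as [c [Hc1 [Hc2 Hc3]]]; rewrite Hc1.
  replace (/ h * (Dt T f x c * h)) with (Dt T f x c) by (field; assumption).
  apply Rlt_le, Hu; try lra; rewrite Rminus_diag, Rabs_R0; exact Hd0. }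
replace ((int01 (fun x => f x (t + h) * w x) - int01 (fun x => f x t * w x)) / h
    - int01 (fun x => Dt T f x t * w x))
  with (int01 (fun x => (/ h * (f x (t + h) - f x t) - Dt T f x t) * w x)).
- eapply Rle_lt_trans; [apply (int01_small P) with (c := e / (2 * W)); [eauto 6 with pw|assumption|lra|]|].
  + intros x Hx; apply off_nodes_bounds in Hx; apply Hpt; lra.
  + fold W; replace (e / (2 * W) * W) with (e / 2) by (field; lra); lra.
- rewrite (int01_ext P _ (fun x => / h * (f x (t + h) * w x - f x t * w x) - Dt T f x t * w x))
    by (intros; try ring; eauto 7 with pw).
  rewrite (int01_minus P), (int01_scal P), (int01_minus P) by (eauto 7 with pw).
  unfold Rdiv; ring.
Qed.

Lemma Dx_is_derive m T f x t : Cm_rect (S m) T f -> 0 < x < 1 -> 0 <= t <= T ->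
  is_derive (fun y => f y t) x (Dx f x t).
Proof.
intros [_ [Hd _]] Hx Ht; apply (is_derive_on_interior 0 1); [assumption|].
apply Derive_on_correct; [lra|lra|apply Hd; lra].
Qed.

Lemma Dt_is_derive m T f x t : Cm_rect (S m) T f -> 0 <= x <= 1 -> 0 < t < T ->
  is_derive (fun s => f x s) t (Dt T f x t).
Proof.
intros [_ [Hd _]] Hx Ht; apply (is_derive_on_interior 0 T); [assumption|].
apply Derive_on_correct; [lra|lra|apply Hd; lra].
Qed.

(** Schwarz's theorem, restricted to the open rectangle; the boundary has no weight in the integrals
    where the exchange is made. *)
Lemma Dt_Dx_comm T f x t : Cm_rect 2 T f -> 0 < x < 1 -> 0 < t < T ->
  Dt T (Dx f) x t = Dx (Dt T f) x t.
Proof.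
intros Hf Hx Ht.
assert (Hfx := Cm_rect_Dx 1 T f Hf); assert (Hft := Cm_rect_Dt 1 T f Hf).
assert (He : 0 < Rmin (Rmin x (1 - x)) (Rmin t (T - t))) by (repeat apply Rmin_glb_lt; lra).
assert (Hloc : locally_2d (fun u v => 0 < u < 1 /\ 0 < v < T) x t).
{ exists (mkposreal _ He); simpl; intros u v Hu Hv.
  assert (M1 := Rmin_l (Rmin x (1 - x)) (Rmin t (T - t))).
  assert (M2 := Rmin_r (Rmin x (1 - x)) (Rmin t (T - t))).
  assert (M3 := Rmin_l x (1 - x)); assert (M4 := Rmin_r x (1 - x)).
  assert (M5 := Rmin_l t (T - t)); assert (M6 := Rmin_r t (T - t)).
  apply Rabs_def2 in Hu; apply Rabs_def2 in Hv; lra. }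
assert (L1 : forall u, 0 < u < 1 -> locally u (fun z => 0 < z < 1)).
{ intros u Hu; apply (locally_open 0 1); auto. }
assert (L2 : forall v, 0 < v < T -> locally v (fun z => 0 < z < T)).
{ intros v Hv; apply (locally_open 0 T); auto. }
assert (Et : forall u v, 0 < u < 1 -> 0 < v < T -> Derive (fun t => f u t) v = Dt T f u v)
  by (intros; apply is_derive_unique, (Dt_is_derive 1); try assumption; lra).
assert (Ex : forall u v, 0 < u < 1 -> 0 < v < T -> Derive (fun t => f t v) u = Dx f u v)
  by (intros; apply is_derive_unique, (Dx_is_derive 1 T); try assumption; lra).
assert (Etx : forall u v, 0 < u < 1 -> 0 < v < T ->
  is_derive (fun z => Derive (fun t => f z t) v) u (Dx (Dt T f) u v)).
{ intros u v Hu Hv; apply (is_derive_ext_loc (fun z => Dt T f z v)).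
  - generalize (L1 u Hu); apply filter_imp; intros z Hz; symmetry; apply Et; assumption.
  - apply (Dx_is_derive 0 T); [assumption|assumption|lra]. }
assert (Ext : forall u v, 0 < u < 1 -> 0 < v < T ->
  is_derive (fun z => Derive (fun t => f t z) u) v (Dt T (Dx f) u v)).
{ intros u v Hu Hv; apply (is_derive_ext_loc (fun z => Dx f u z)).
  - generalize (L2 v Hv); apply filter_imp; intros z Hz; symmetry; apply Ex; assumption.
  - apply (Dt_is_derive 0 T); [assumption|lra|assumption]. }
rewrite <- (is_derive_unique _ _ _ (Ext x t Hx Ht)), <- (is_derive_unique _ _ _ (Etx x t Hx Ht)).
symmetry; apply Schwarz.
- generalize Hloc; apply locally_2d_impl, locally_2d_forall; intros u v [Hu Hv]; split; [|split; [|split]].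
  + eexists; apply (Dx_is_derive 1 T); [assumption|assumption|lra].
  + eexists; apply (Dt_is_derive 1 T); [assumption|lra|assumption].
  + eexists; apply Etx; assumption.
  + eexists; apply Ext; assumption.
- apply (continuity_2d_pt_ext_loc (fun x t => Dx (Dt T f) (clamp 0 1 x) (clamp 0 T t))).
  + generalize Hloc; apply locally_2d_impl, locally_2d_forall; intros u v [Hu Hv].
    rewrite !clamp_id by lra; symmetry; apply is_derive_unique, Etx; assumption.
  + apply continuous_rect_clamp; [lra|apply (Cm_rect_continuous 0), Cm_rect_Dx, Hft].
- apply (continuity_2d_pt_ext_loc (fun x t => Dt T (Dx f) (clamp 0 1 x) (clamp 0 T t))).
  + generalize Hloc; apply locally_2d_impl, locally_2d_forall; intros u v [Hu Hv].
    rewrite !clamp_id by lra; symmetry; apply is_derive_unique, Ext; assumption.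
  + apply continuous_rect_clamp; [lra|apply (Cm_rect_continuous 0), Cm_rect_Dt, Hfx].
Qed.

Lemma Cm_rect_slice_pc1 m T f P t : 0 < T -> Cm_rect (S m) T f -> 0 <= t <= T -> pc1 P (fun x => f x t).
Proof. intros HT Hf Ht; apply (Ck_on_pc1 m), (Cm_rect_slice (S m) T); assumption. Qed.

Definition slice (zeta u : R -> R -> R) (t : R) : bool * R -> R :=
  pairf (fun x => zeta x t) (fun x => u x t).

Lemma energy_form_slice mu beta b c1 c2 M P T zeta u t w : bottom mu beta b c1 c2 M -> 0 < T ->
  Cm_rect 1 T zeta -> Cm_rect 2 T u -> 0 <= t <= T -> pair_pc1 P w ->
  energy_form mu beta b (slice zeta u t) w
  = int01 (fun x => zeta x t * fstf w x)
    + (int01 (fun x => u x t * (mass_coef mu beta b x * sndf w x))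
       + mu / 3 * int01 (fun x => Dx u x t * (eta_b beta b x ^ 3 * Derive_on 0 1 (sndf w) x))).
Proof.
intros HB HT Hz Hu Ht [Hw1 Hw2]; unfold energy_form, formA; apply f_equal2; [reflexivity|apply f_equal2; [|apply f_equal]].
- apply RInt_ext_R; [lra|]; intros; unfold slice, pairf, sndf; simpl; ring.
- apply RInt_ext_R; [lra|]; intros.
  change (sndf (slice zeta u t)) with (fun y => u y t); unfold Dx; ring.
Qed.

Lemma energy_form_slice_continuous mu beta b c1 c2 M P T zeta u w : bottom mu beta b c1 c2 M -> 0 < T ->
  Cm_rect 1 T zeta -> Cm_rect 2 T u -> pair_pc1 P w ->
  continuous_on (fun t => 0 <= t <= T) (fun t => energy_form mu beta b (slice zeta u t) w).
Proof.
intros HB HT Hz Hu Hw.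
assert (Hm := bottom_mass_pwc HB P); assert (He := bottom_eta3_pwc _ _ _ _ _ _ P HB).
destruct Hw as [Hw1 Hw2].
apply (continuous_on_ext 0 T (fun t => (int01 (fun x => zeta x t * fstf w x)
    + 1 * int01 (fun x => u x t * (mass_coef mu beta b x * sndf w x)))
       + mu / 3 * int01 (fun x => Dx u x t * (eta_b beta b x ^ 3 * Derive_on 0 1 (sndf w) x)))); [lra| |].
- intros t Ht; rewrite (energy_form_slice mu beta b c1 c2 M P T) by (try assumption; split; assumption); ring.
- apply continuous_on_axpy; [lra|apply continuous_on_axpy; [lra|..]|].
  + apply (int01_param_continuous P); [assumption|apply Hz|eauto with pw].
  + apply (int01_param_continuous P); [assumption|apply Hu|eauto with pw].
  + apply (int01_param_continuous P T (Dx u)); [assumption|apply (Cm_rect_continuous 1), Cm_rect_Dx, Hu|eauto with pw].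
Qed.

Lemma energy_form_slice_derive mu beta b c1 c2 M P T zeta u w t : bottom mu beta b c1 c2 M -> 0 < T ->
  Cm_rect 2 T zeta -> Cm_rect 3 T u -> pair_pc1 P w -> 0 < t < T ->
  is_derive (fun t => energy_form mu beta b (slice zeta u t) w) t
    (energy_form mu beta b (slice (Dt T zeta) (Dt T u) t) w).
Proof.
intros HB HT Hz Hu Hw Ht.
assert (Hm := bottom_mass_pwc HB P); assert (He := bottom_eta3_pwc _ _ _ _ _ _ P HB).
assert (Hz1 : Cm_rect 1 T zeta) by (apply (Cm_rect_le 1 2); [lia|assumption]).
assert (Hu1 : Cm_rect 1 T u) by (apply (Cm_rect_le 1 3); [lia|assumption]).
assert (Hu2 : Cm_rect 2 T u) by (apply (Cm_rect_le 2 3); [lia|assumption]).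
rewrite (energy_form_slice mu beta b c1 c2 M P T (Dt T zeta) (Dt T u) t)
  by (try assumption; try apply Cm_rect_Dt; try assumption; lra).
assert (Hw' := Hw); destruct Hw' as [Hw1 Hw2].
(* Differentiation under the integral produces [Dt T (Dx u)], whereas the energy form of the time
   derivative contains [Dx (Dt T u)]. *)
rewrite (int01_ext P (fun x => Dx (Dt T u) x t * _)
  (fun x => Dt T (Dx u) x t * (eta_b beta b x ^ 3 * Derive_on 0 1 (sndf w) x))).
- apply (is_derive_ext_loc (fun t => int01 (fun x => zeta x t * fstf w x)
    + (int01 (fun x => u x t * (mass_coef mu beta b x * sndf w x))
       + mu / 3 * int01 (fun x => Dx u x t * (eta_b beta b x ^ 3 * Derive_on 0 1 (sndf w) x))))).
  + apply (locally_open 0 T); [assumption|]; intros z Hz'.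
    symmetry; apply (energy_form_slice mu beta b c1 c2 M P T); try assumption; lra.
  + apply (is_derive_plus (V := R_NormedModule)); [|apply (is_derive_plus (V := R_NormedModule))].
    * apply (int01_param_derive P); try assumption; eauto with pw.
    * apply (int01_param_derive P); try assumption; eauto with pw.
    * apply (is_derive_scal (fun t => int01 (fun x => Dx u x t * _))).
      apply (int01_param_derive P); try assumption; [|eauto with pw].
      apply (Cm_rect_le 1 2); [lia|apply Cm_rect_Dx, Hu].
- apply pwc_mult; [|eauto with pw].
  apply (continuous_rect_pwc P T (Dx (Dt T u))); [assumption| |lra].
  apply (Cm_rect_continuous 1), Cm_rect_Dx, Cm_rect_Dt, Hu.
- intros x Hx; apply off_nodes_bounds in Hx.
  rewrite (Dt_Dx_comm T u x t) by assumption; reflexivity.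
Qed.

(** * The weak form and the error equation *)

(** All terms of the weak system without a time derivative, the first equation tested with [phi] and
    the second with [chi], added. *)
Definition flux (eps : R) (eta z u phi chi : R -> R) : R :=
  eps * inner (Derive_on 0 1 (fun y => z y * u y)) phi
  + inner (Derive_on 0 1 (fun y => eta y * u y)) phi
  + (inner (fun x => eta x * Derive_on 0 1 z x) chi
     + eps * inner (fun x => eta x * u x * Derive_on 0 1 u x) chi).

Ltac pc1_auto := repeat first
  [assumption|apply pc1_const|apply pc1_minus|apply pc1_plus|apply pc1_mult].
Ltac pwc_auto := repeat first
  [assumption|apply pwc_const|apply pc1_Derive; solve [pc1_auto]|apply pc1_pwc; assumption
  |apply pwc_minus|apply pwc_plus|apply pwc_mult].

Lemma trilinear_term_bound (M c x y S : R) : Rabs c <= M -> x * x <= S -> y * y <= S ->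
  Rabs (c * x * y) <= M * S.
Proof.
intros Hc Hx Hy; rewrite Rmult_assoc, Rabs_mult.
apply Rmult_le_compat; try apply Rabs_pos; [assumption|].
apply Rabs_le; split; nra.
Qed.

Lemma Rabs_triple_le (M a b c : R) : 0 <= M -> Rabs a <= M -> Rabs b <= M -> Rabs c <= M ->
  Rabs (a * b * c) <= M ^ 3.
Proof.
intros HM Ha Hb Hc; rewrite !Rabs_mult; replace (M ^ 3) with (M * M * M) by ring.
repeat apply Rmult_le_compat; try apply Rmult_le_pos; try apply Rabs_pos; assumption.
Qed.

(* The terms of the error equation in which [theta] or [zeta - zh] are
   differentiated are integrated by parts; the boundary terms vanish with
   [uh] and [xi]. *)
Definition flux_error_density (eps : R) (eta z u zh uh th xi : R -> R) (x : R) : R :=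
  let e := u x - uh x in
  let de := Derive_on 0 1 u x - Derive_on 0 1 uh x in
  let rho := z x - zh x - th x in
  let deta := Derive_on 0 1 eta x in
  eps * ((Derive_on 0 1 z x * e + z x * de) * th x - rho * uh x * Derive_on 0 1 th x
         + 1 / 2 * Derive_on 0 1 uh x * th x * th x)
  + (deta * e + eta x * de) * th x
  - (rho + th x) * (deta * xi x + eta x * Derive_on 0 1 xi x)
  + eps * eta x * (e * Derive_on 0 1 u x + uh x * de) * xi x.

Lemma flux_difference P eps eta z u zh uh th xi :
  pc1 P eta -> pc1 P z -> pc1 P u -> pc1 P zh -> pc1 P uh -> pc1 P th -> pc1 P xi ->
  uh 0 = 0 -> uh 1 = 0 -> xi 0 = 0 -> xi 1 = 0 ->
  flux eps eta z u th xi - flux eps eta zh uh th xi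
  = int01 (flux_error_density eps eta z u zh uh th xi).
Proof.
intros Heta Hz Hu Hzh Huh Hth Hxi U0 U1 X0 X1.
(* The total derivative by which the two sides differ. With [rho = z - zh - th]: [(rho uh)' th]
   equals [(rho uh th)' - rho uh th'], and [(th uh)' th] equals [(th^2 uh / 2)' + uh' th^2 / 2]; the
   last summand moves the derivative off [z - zh] in the second equation. Each summand contains [uh]
   or [xi]. *)
set (psi := fun x => eps * (((z x - zh x) - th x) * (uh x * th x) + 1 / 2 * (th x * th x * uh x))
  + eta x * ((z x - zh x) * xi x)).
assert (Hpsi : pc1 P psi) by (unfold psi; pc1_auto).
assert (Hint : int01 (Derive_on 0 1 psi) = 0).
{ rewrite (int01_Derive P) by assumption; unfold psi; rewrite U0, U1, X0, X1; ring. }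
assert (Hd : pwc P (flux_error_density eps eta z u zh uh th xi)).
{ unfold flux_error_density; cbv zeta.
  pwc_auto. }
assert (Hf : forall z u, pc1 P z -> pc1 P u ->
  flux eps eta z u th xi = int01 (fun x =>
    (eps * (Derive_on 0 1 z x * u x + z x * Derive_on 0 1 u x)
     + (Derive_on 0 1 eta x * u x + eta x * Derive_on 0 1 u x)) * th x
    + (eta x * Derive_on 0 1 z x + eps * (eta x * u x * Derive_on 0 1 u x)) * xi x)).
{ clear - Heta Hth Hxi; intros z u Hz Hu; unfold flux, inner.
  change (eps * int01 (fun x => Derive_on 0 1 (fun y => z y * u y) x * th x)
    + int01 (fun x => Derive_on 0 1 (fun y => eta y * u y) x * th x)
    + (int01 (fun x => eta x * Derive_on 0 1 z x * xi x)
       + eps * int01 (fun x => eta x * u x * Derive_on 0 1 u x * xi x)) =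
    int01 (fun x => (eps * (Derive_on 0 1 z x * u x + z x * Derive_on 0 1 u x)
     + (Derive_on 0 1 eta x * u x + eta x * Derive_on 0 1 u x)) * th x
    + (eta x * Derive_on 0 1 z x + eps * (eta x * u x * Derive_on 0 1 u x)) * xi x)).
  rewrite <- !(int01_scal P), <- !(int01_plus P) by (pwc_auto).
  apply (int01_ext P); [pwc_auto|].
  intros x Hx; rewrite !(Derive_on_mult P) by assumption; ring. }
rewrite !Hf, <- (int01_minus P) by (first [assumption|pwc_auto]).
transitivity (int01 (flux_error_density eps eta z u zh uh th xi) + int01 (Derive_on 0 1 psi));
  [|rewrite Hint; ring].
rewrite <- (int01_plus P) by pwc_auto.
apply (int01_ext P); [pwc_auto|].
intros x Hx; unfold psi.
rewrite (Derive_on_plus P) by (first [exact Hx|pc1_auto]).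
rewrite (Derive_on_mult P (fun _ => eps)) by (first [exact Hx|pc1_auto]).
rewrite (Derive_on_plus P (fun y => (z y - zh y - th y) * (uh y * th y))) by (first [exact Hx|pc1_auto]).
rewrite (Derive_on_mult P (fun y => z y - zh y - th y)) by (first [exact Hx|pc1_auto]).
rewrite (Derive_on_mult P (fun _ => 1 / 2)) by (first [exact Hx|pc1_auto]).
rewrite (Derive_on_mult P (fun y => th y * th y)) by (first [exact Hx|pc1_auto]).
rewrite (Derive_on_mult P eta) by (first [exact Hx|pc1_auto]).
rewrite (Derive_on_mult P (fun y => z y - zh y)) by (first [exact Hx|pc1_auto]).
rewrite (Derive_on_minus P (fun y => z y - zh y)) by (first [exact Hx|pc1_auto]).
rewrite (Derive_on_minus P z zh) by assumption.
rewrite (Derive_on_mult P uh th), (Derive_on_mult P th th) by assumption.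
assert (Hc : forall c, Derive_on 0 1 (fun _ => c) x = 0).
{ intros c; apply Derive_on_is_derive; [apply (off_nodes_bounds P), Hx|apply @is_derive_const]. }
rewrite !Hc; unfold flux_error_density; field.
Qed.

(** Writing [u - uh = sg + xi] splits the density into 18 products, each padded to three factors
    bounded by [M] and two whose squares are at most the bracket. In the product of [rho] with [th']
    these two are [rho / h] and [h * th'], whence the weights [1 / h ^ 2] and [h ^ 2]. *)
Lemma flux_error_density_bound (eps M h x : R) (eta z u zh uh th xi : R -> R) (rho sg dsg : R) :
  0 < h -> h <= 1 -> 1 <= M -> Rabs eps <= M ->
  Rabs (z x) <= M -> Rabs (Derive_on 0 1 z x) <= M -> Rabs (Derive_on 0 1 u x) <= M ->
  Rabs (eta x) <= M -> Rabs (Derive_on 0 1 eta x) <= M ->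
  Rabs (uh x) <= M -> Rabs (Derive_on 0 1 uh x) <= M ->
  rho = z x - zh x - th x -> sg = u x - uh x - xi x ->
  dsg = Derive_on 0 1 u x - Derive_on 0 1 uh x - Derive_on 0 1 xi x ->
  Rabs (flux_error_density eps eta z u zh uh th xi x)
  <= 18 * M ^ 3 * (th x * th x + xi x * xi x + Derive_on 0 1 xi x * Derive_on 0 1 xi x
       + sg * sg + dsg * dsg + 1 / h ^ 2 * (rho * rho)
       + h ^ 2 * (Derive_on 0 1 th x * Derive_on 0 1 th x)).
Proof.
intros Hh Hh1 HM1 He Hz Hdz Hdu Heta Hdeta Huh Hduh Hrho Hsg Hdsg.
unfold flux_error_density; cbv zeta; rewrite <- Hrho.
replace (u x - uh x) with (sg + xi x) by (rewrite Hsg; ring).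
replace (Derive_on 0 1 u x - Derive_on 0 1 uh x) with (dsg + Derive_on 0 1 xi x) by (rewrite Hdsg; ring).
clear Hrho Hsg Hdsg zh.
set (dz := Derive_on 0 1 z x) in *; set (du := Derive_on 0 1 u x) in *.
set (deta := Derive_on 0 1 eta x) in *; set (duh := Derive_on 0 1 uh x) in *.
set (dxi := Derive_on 0 1 xi x); set (dth := Derive_on 0 1 th x).
set (zz := z x) in *; set (et := eta x) in *; set (v := uh x) in *.
set (t := th x); set (s := xi x); clearbody dz du deta duh dxi dth zz et v t s; clear z u eta uh th xi.
assert (Hr : 1 / h ^ 2 * (rho * rho) = (rho / h) * (rho / h)) by (field; lra).
assert (Hdt : h ^ 2 * (dth * dth) = (h * dth) * (h * dth)) by ring.
rewrite Hr, Hdt.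
set (S := t * t + s * s + dxi * dxi + sg * sg + dsg * dsg + rho / h * (rho / h) + h * dth * (h * dth)).
assert (Hsq : forall y, 0 <= y * y) by (intros; apply Rle_0_sqr).
assert (S1 := Hsq t); assert (S2 := Hsq s); assert (S3 := Hsq dxi); assert (S4 := Hsq sg);
assert (S5 := Hsq dsg); assert (S6 := Hsq (rho / h)); assert (S7 := Hsq (h * dth)).
assert (S8 : rho * rho <= rho / h * (rho / h)).
{ replace (rho * rho) with ((h * h) * (rho / h * (rho / h))) by (field; lra).
  rewrite <- (Rmult_1_l (rho / h * (rho / h))) at 2.
  apply Rmult_le_compat_r; [assumption|]; nra. }
assert (Bt : t * t <= S) by (unfold S; lra); assert (Bs : s * s <= S) by (unfold S; lra).
assert (Bdx : dxi * dxi <= S) by (unfold S; lra); assert (Bsg : sg * sg <= S) by (unfold S; lra).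
assert (Bds : dsg * dsg <= S) by (unfold S; lra).
assert (Brh : rho / h * (rho / h) <= S) by (unfold S; lra).
assert (Bdt : h * dth * (h * dth) <= S) by (unfold S; lra).
assert (Br : rho * rho <= S) by (unfold S; lra).
assert (M0 : 0 <= M) by lra.
assert (H1M : Rabs 1 <= M) by (rewrite Rabs_R1; assumption).
assert (HhM : Rabs (1 / 2) <= M) by (rewrite Rabs_pos_eq; lra).
assert (HN : forall y, Rabs y <= M -> Rabs (- y) <= M) by (intros; rewrite Rabs_Ropp; assumption).
assert (T : forall a b c x y, Rabs a <= M -> Rabs b <= M -> Rabs c <= M -> x * x <= S -> y * y <= S ->
  Rabs (a * b * c * x * y) <= M ^ 3 * S).
{ intros; apply trilinear_term_bound; [apply Rabs_triple_le|..]; assumption. }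
assert (T1 := T 1 eps dz sg t H1M He Hdz Bsg Bt).
assert (T2 := T 1 eps dz s t H1M He Hdz Bs Bt).
assert (T3 := T 1 eps zz dsg t H1M He Hz Bds Bt).
assert (T4 := T 1 eps zz dxi t H1M He Hz Bdx Bt).
assert (T5 := T 1 (- eps) v (rho / h) (h * dth) H1M (HN _ He) Huh Brh Bdt).
assert (T6 := T (1 / 2) eps duh t t HhM He Hduh Bt Bt).
assert (T7 := T 1 1 deta sg t H1M H1M Hdeta Bsg Bt).
assert (T8 := T 1 1 deta s t H1M H1M Hdeta Bs Bt).
assert (T9 := T 1 1 et dsg t H1M H1M Heta Bds Bt).
assert (T10 := T 1 1 et dxi t H1M H1M Heta Bdx Bt).
assert (T11 := T 1 (- 1) deta rho s H1M (HN _ H1M) Hdeta Br Bs).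
assert (T12 := T 1 (- 1) et rho dxi H1M (HN _ H1M) Heta Br Bdx).
assert (T13 := T 1 (- 1) deta t s H1M (HN _ H1M) Hdeta Bt Bs).
assert (T14 := T 1 (- 1) et t dxi H1M (HN _ H1M) Heta Bt Bdx).
assert (T15 := T eps et du sg s He Heta Hdu Bsg Bs).
assert (T16 := T eps et du s s He Heta Hdu Bs Bs).
assert (T17 := T eps et v dsg s He Heta Huh Bds Bs).
assert (T18 := T eps et v dxi s He Heta Huh Bdx Bs).
clear T.
apply Rabs_le_between in T1, T2, T3, T4, T5, T6, T7, T8, T9, T10, T11, T12, T13, T14, T15, T16, T17, T18.
match goal with |- Rabs ?X <= _ =>
  replace X with (1 * eps * dz * sg * t + 1 * eps * dz * s * t + 1 * eps * zz * dsg * t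
    + 1 * eps * zz * dxi * t + 1 * (- eps) * v * (rho / h) * (h * dth) + 1 / 2 * eps * duh * t * t
    + 1 * 1 * deta * sg * t + 1 * 1 * deta * s * t + 1 * 1 * et * dsg * t + 1 * 1 * et * dxi * t
    + 1 * (- 1) * deta * rho * s + 1 * (- 1) * et * rho * dxi + 1 * (- 1) * deta * t * s
    + 1 * (- 1) * et * t * dxi + eps * et * du * sg * s + eps * et * du * s * s
    + eps * et * v * dsg * s + eps * et * v * dxi * s) by (field; lra)
end.
rewrite (Rmult_assoc 18); generalize dependent (M ^ 3 * S); intros; apply Rabs_le; split; lra.
Qed.

(** When [th] and [xi] are the differences between the projected and the Galerkin solution, [rho]
    and [sg] become the projection errors. The weight on the derivative of [th] is the one that
    [Sh_inverse] absorbs. *)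
Lemma flux_difference_bound P eps M eta z u zh uh th xi :
  mesh P <= 1 -> 1 <= M -> Rabs eps <= M ->
  pc1 P eta -> pc1 P z -> pc1 P u -> pc1 P zh -> pc1 P uh -> pc1 P th -> pc1 P xi ->
  uh 0 = 0 -> uh 1 = 0 -> xi 0 = 0 -> xi 1 = 0 ->
  (forall x, off_nodes P x ->
     (Rabs (z x) <= M /\ Rabs (Derive_on 0 1 z x) <= M /\ Rabs (Derive_on 0 1 u x) <= M) /\
     (Rabs (eta x) <= M /\ Rabs (Derive_on 0 1 eta x) <= M) /\
     Rabs (uh x) <= M /\ Rabs (Derive_on 0 1 uh x) <= M) ->
  let rho := fun x => z x - zh x - th x in
  let sg := fun x => u x - uh x - xi x in
  Rabs (flux eps eta z u th xi - flux eps eta zh uh th xi)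
  <= 18 * M ^ 3 * (inner th th + (inner xi xi + inner (Derive_on 0 1 xi) (Derive_on 0 1 xi))
       + (inner sg sg + inner (Derive_on 0 1 sg) (Derive_on 0 1 sg))
       + 1 / mesh P ^ 2 * inner rho rho
       + mesh P ^ 2 * inner (Derive_on 0 1 th) (Derive_on 0 1 th)).
Proof.
intros Hh1 HM1 He Heta Hz Hu Hzh Huh Hth Hxi U0 U1 X0 X1 HB rho sg.
assert (Hh := mesh_pos P).
rewrite (flux_difference P) by assumption.
assert (Hrho : pc1 P rho) by (unfold rho; eauto with pw).
assert (Hsg : pc1 P sg) by (unfold sg; eauto with pw).
assert (Hd : pwc P (flux_error_density eps eta z u zh uh th xi)).
{ unfold flux_error_density; cbv zeta.
  pwc_auto. }
set (F := fun x => 18 * M ^ 3 * (th x * th x + xi x * xi x + Derive_on 0 1 xi x * Derive_on 0 1 xi x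
       + sg x * sg x + Derive_on 0 1 sg x * Derive_on 0 1 sg x + 1 / mesh P ^ 2 * (rho x * rho x)
       + mesh P ^ 2 * (Derive_on 0 1 th x * Derive_on 0 1 th x))).
assert (HF : pwc P F).
{ unfold F; pwc_auto. }
assert (Hp : forall x, off_nodes P x -> Rabs (flux_error_density eps eta z u zh uh th xi x) <= F x).
{ intros x Hx; destruct (HB x Hx) as [[H1 [H2 H3]] [[H4 H5] [H6 H7]]].
  apply flux_error_density_bound; try assumption; try reflexivity.
  unfold sg; rewrite (Derive_on_minus P (fun y => u y - uh y)), (Derive_on_minus P u)
    by (eauto with pw); reflexivity. }
assert (HI : 18 * M ^ 3 * (inner th th + (inner xi xi + inner (Derive_on 0 1 xi) (Derive_on 0 1 xi))
       + (inner sg sg + inner (Derive_on 0 1 sg) (Derive_on 0 1 sg))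
       + 1 / mesh P ^ 2 * inner rho rho
       + mesh P ^ 2 * inner (Derive_on 0 1 th) (Derive_on 0 1 th)) = int01 F).
{ unfold F, inner.
  assert (A : forall f, pc1 P f -> pwc P (fun x => f x * f x)) by (eauto with pw).
  assert (A' : forall f, pc1 P f -> pwc P (fun x => Derive_on 0 1 f x * Derive_on 0 1 f x)) by (eauto with pw).
  rewrite (int01_scal P) by (pwc_auto).
  do 6 (rewrite (int01_plus P) by (pwc_auto)).
  rewrite !(int01_scal P) by (pwc_auto); unfold int01; ring. }
rewrite HI; apply Rabs_le; split.
- replace (- int01 F) with (int01 (fun x => (-1) * F x)) by (rewrite (int01_scal P) by assumption; ring).
  apply (int01_le P); [eauto with pw|assumption|].
  intros x Hx; specialize (Hp x Hx); apply Rabs_le_between in Hp; lra.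
- apply (int01_le P); [assumption..|].
  intros x Hx; specialize (Hp x Hx); apply Rabs_le_between in Hp; lra.
Qed.

(** * The flux on pairs and the weak form *)

Definition pair_flux (eps : R) (eta : R -> R) (v w : bool * R -> R) : R :=
  flux eps eta (fstf v) (sndf v) (fstf w) (sndf w).

Definition pair_flux_lin (eta : R -> R) (v w : bool * R -> R) : R :=
  inner (Derive_on 0 1 (fun y => eta y * sndf v y)) (fstf w)
  + inner (fun x => eta x * Derive_on 0 1 (fstf v) x) (sndf w).

(** Polarised so as to be linear in [v] and in [v'] separately; the quadratic part of the flux is
    its diagonal. It is not symmetric: [u_x] in the second equation is taken from [v']. *)
Definition pair_flux_quad (eps : R) (eta : R -> R) (v v' w : bool * R -> R) : R :=
  eps * inner (Derive_on 0 1 (fun y => fstf v y * sndf v' y)) (fstf w)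
  + eps * inner (fun x => eta x * sndf v x * Derive_on 0 1 (sndf v') x) (sndf w).

Lemma pair_flux_split eps eta v w :
  pair_flux eps eta v w = pair_flux_lin eta v w + pair_flux_quad eps eta v v w.
Proof. unfold pair_flux, flux, pair_flux_lin, pair_flux_quad; ring. Qed.

Lemma pair_flux_lin_axpy P eta v v' w a : pc1 P eta -> pair_pc1 P v -> pair_pc1 P v' -> pair_pc1 P w ->
  pair_flux_lin eta (fun p => v p + a * v' p) w
  = pair_flux_lin eta v w + a * pair_flux_lin eta v' w.
Proof.
intros He [V1 V2] [V1' V2'] [W1 W2]; unfold pair_flux_lin.
change (fstf (fun p => v p + a * v' p)) with (fun x => fstf v x + a * fstf v' x).
change (sndf (fun p => v p + a * v' p)) with (fun x => sndf v x + a * sndf v' x).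
cbv beta; rewrite (inner_ext P (Derive_on 0 1 (fun y => eta y * (sndf v y + a * sndf v' y))) (fstf w)
  (fun x => Derive_on 0 1 (fun y => eta y * sndf v y) x + a * Derive_on 0 1 (fun y => eta y * sndf v' y) x)
  (fstf w)).
- rewrite (inner_ext P (fun x => eta x * Derive_on 0 1 (fun y => fstf v y + a * fstf v' y) x) (sndf w)
    (fun x => eta x * Derive_on 0 1 (fstf v) x + a * (eta x * Derive_on 0 1 (fstf v') x)) (sndf w)).
  + rewrite !(inner_axpy_l P) by (eauto 8 with pw); ring.
  + eauto 10 with pw.
  + eauto with pw.
  + intros x Hx; rewrite (Derive_on_axpy P) by assumption; ring.
  + reflexivity.
- eauto 10 with pw.
- eauto with pw.
- intros x Hx; rewrite !(Derive_on_mult P eta), (Derive_on_axpy P) by (eauto with pw); ring.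
- reflexivity.
Qed.

Lemma pair_flux_quad_axpy_l P eps eta v v' y w a : pc1 P eta -> pair_pc1 P v -> pair_pc1 P v' ->
  pair_pc1 P y -> pair_pc1 P w ->
  pair_flux_quad eps eta (fun p => v p + a * v' p) y w
  = pair_flux_quad eps eta v y w + a * pair_flux_quad eps eta v' y w.
Proof.
intros He [V1 V2] [V1' V2'] [Y1 Y2] [W1 W2]; unfold pair_flux_quad.
change (fstf (fun p => v p + a * v' p)) with (fun x => fstf v x + a * fstf v' x).
change (sndf (fun p => v p + a * v' p)) with (fun x => sndf v x + a * sndf v' x).
cbv beta; rewrite (inner_ext P (Derive_on 0 1 (fun z => (fstf v z + a * fstf v' z) * sndf y z)) (fstf w)
  (fun x => Derive_on 0 1 (fun z => fstf v z * sndf y z) x + a * Derive_on 0 1 (fun z => fstf v' z * sndf y z) x)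
  (fstf w)).
- rewrite (inner_ext P (fun x => eta x * (sndf v x + a * sndf v' x) * Derive_on 0 1 (sndf y) x) (sndf w)
    (fun x => eta x * sndf v x * Derive_on 0 1 (sndf y) x + a * (eta x * sndf v' x * Derive_on 0 1 (sndf y) x)) (sndf w)).
  + rewrite !(inner_axpy_l P) by (eauto 8 with pw); ring.
  + eauto 10 with pw.
  + eauto with pw.
  + intros x Hx; ring.
  + reflexivity.
- eauto 10 with pw.
- eauto with pw.
- intros x Hx; rewrite !(Derive_on_mult P), (Derive_on_axpy P) by (eauto with pw); ring.
- reflexivity.
Qed.

Lemma pair_flux_quad_axpy_r P eps eta v v' y w a : pc1 P eta -> pair_pc1 P v -> pair_pc1 P v' ->
  pair_pc1 P y -> pair_pc1 P w ->
  pair_flux_quad eps eta y (fun p => v p + a * v' p) w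
  = pair_flux_quad eps eta y v w + a * pair_flux_quad eps eta y v' w.
Proof.
intros He [V1 V2] [V1' V2'] [Y1 Y2] [W1 W2]; unfold pair_flux_quad.
change (sndf (fun p => v p + a * v' p)) with (fun x => sndf v x + a * sndf v' x).
cbv beta; rewrite (inner_ext P (Derive_on 0 1 (fun z => fstf y z * (sndf v z + a * sndf v' z))) (fstf w)
  (fun x => Derive_on 0 1 (fun z => fstf y z * sndf v z) x + a * Derive_on 0 1 (fun z => fstf y z * sndf v' z) x)
  (fstf w)).
- rewrite (inner_ext P (fun x => eta x * sndf y x * Derive_on 0 1 (fun z => sndf v z + a * sndf v' z) x) (sndf w)
    (fun x => eta x * sndf y x * Derive_on 0 1 (sndf v) x + a * (eta x * sndf y x * Derive_on 0 1 (sndf v') x)) (sndf w)).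
  + rewrite !(inner_axpy_l P) by (eauto 8 with pw); ring.
  + eauto 10 with pw.
  + eauto with pw.
  + intros x Hx; rewrite (Derive_on_axpy P) by assumption; ring.
  + reflexivity.
- eauto 10 with pw.
- eauto with pw.
- intros x Hx; rewrite !(Derive_on_mult P), (Derive_on_axpy P) by (eauto with pw); ring.
- reflexivity.
Qed.

Lemma pair_flux_axpy_test P eps eta v w w' a : pc1 P eta -> pair_pc1 P v -> pair_pc1 P w -> pair_pc1 P w' ->
  pair_flux eps eta v (fun p => w p + a * w' p) = pair_flux eps eta v w + a * pair_flux eps eta v w'.
Proof.
intros He [V1 V2] [W1 W2] [W1' W2']; unfold pair_flux, flux.
change (fstf (fun p => w p + a * w' p)) with (fun x => fstf w x + a * fstf w' x).
change (sndf (fun p => w p + a * w' p)) with (fun x => sndf w x + a * sndf w' x).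
assert (Hr : forall f g h, pwc P f -> pwc P g -> pwc P h ->
  inner f (fun x => g x + a * h x) = inner f g + a * inner f h).
{ intros f g h Hf Hg Hh; rewrite inner_comm, (inner_axpy_l P) by assumption.
  rewrite (inner_comm g), (inner_comm h); reflexivity. }
rewrite !Hr by (eauto 8 with pw); ring.
Qed.

(** The equations are multiplied by the test functions and integrated. Only the dispersive term is
    integrated by parts, which uses that the second test function vanishes at both ends. *)
Lemma ibvp_weak_form mu beta b c1 c2 M P T eps zeta0 u0 zeta u t w :
  bottom mu beta b c1 c2 M -> 0 < T -> Cm_rect 3 T zeta -> Cm_rect 3 T u ->
  ibvp_solution T eps mu beta b zeta0 u0 zeta u -> 0 <= t <= T ->
  pair_pc1 P w -> sndf w 0 = 0 -> sndf w 1 = 0 ->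
  energy_form mu beta b (slice (Dt T zeta) (Dt T u) t) w
  + pair_flux eps (eta_b beta b) (slice zeta u t) w = 0.
Proof.
intros HB HT Hz Hu [Hm [Hp _]] Ht [W1 W2] B0 B1.
assert (Pm := bottom_mass_pwc HB P); assert (Pe := bottom_eta3_pwc _ _ _ _ _ _ P HB).
assert (He := bottom_eta_pc1 _ _ _ _ _ _ P HB).
set (eta := eta_b beta b) in *.
assert (Qz : pc1 P (fun x => zeta x t)) by (apply (Cm_rect_slice_pc1 2 T); assumption).
assert (Qu : pc1 P (fun x => u x t)) by (apply (Cm_rect_slice_pc1 2 T); assumption).
assert (Qzt : pc1 P (fun x => Dt T zeta x t)) by (apply (Cm_rect_slice_pc1 1 T); [|apply Cm_rect_Dt|]; assumption).
assert (Qut : pc1 P (fun x => Dt T u x t)) by (apply (Cm_rect_slice_pc1 1 T); [|apply Cm_rect_Dt|]; assumption).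
assert (Quxt : pc1 P (fun x => Dx (Dt T u) x t))
  by (apply (Cm_rect_slice_pc1 0 T); [|apply Cm_rect_Dx, Cm_rect_Dt|]; assumption).
set (th := fstf w) in *; set (xi := sndf w) in *.
(* The dispersive flux [eta_b^3 u_tx], piecewise C^1 because [u] has continuous derivatives up to
   order 3. *)
set (flx := fun y => eta y ^ 3 * Dx (Dt T u) y t).
assert (Pflx : pc1 P flx).
{ apply (pc1_ext P (fun y => eta y * eta y * eta y * Dx (Dt T u) y t)); [intros; unfold flx; ring|].
  eauto 8 with pw. }
assert (Hparts : int01 (fun x => flx x * Derive_on 0 1 xi x) = - int01 (fun x => Derive_on 0 1 flx x * xi x)).
{ assert (H := int01_Derive P (fun x => flx x * xi x) ltac:(eauto with pw)); cbv beta in H.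
  rewrite B0, B1 in H.
  rewrite (int01_ext P _ (fun x => Derive_on 0 1 flx x * xi x + flx x * Derive_on 0 1 xi x)) in H.
  - rewrite (int01_plus P) in H by (eauto with pw); lra.
  - eauto with pw.
  - intros x Hx; apply (Derive_on_mult P); assumption. }
unfold energy_form, formA, pair_flux, flux, inner.
change (fstf (slice (Dt T zeta) (Dt T u) t)) with (fun x => Dt T zeta x t).
change (sndf (slice (Dt T zeta) (Dt T u) t)) with (fun x => Dt T u x t).
change (fstf (slice zeta u t)) with (fun x => zeta x t).
change (sndf (slice zeta u t)) with (fun x => u x t).
fold eta th xi.
change (int01 (fun x => Dt T zeta x t * th x)
  + (int01 (fun x => mass_coef mu beta b x * Dt T u x t * xi x)
     + mu / 3 * int01 (fun x => flx x * Derive_on 0 1 xi x))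
  + (eps * int01 (fun x => Derive_on 0 1 (fun y => zeta y t * u y t) x * th x)
     + int01 (fun x => Derive_on 0 1 (fun y => eta y * u y t) x * th x)
     + (int01 (fun x => eta x * Derive_on 0 1 (fun y => zeta y t) x * xi x)
        + eps * int01 (fun x => eta x * u x t * Derive_on 0 1 (fun y => u y t) x * xi x))) = 0).
assert (E1 : int01 (fun x => Dt T zeta x t * th x)
  + eps * int01 (fun x => Derive_on 0 1 (fun y => zeta y t * u y t) x * th x)
  + int01 (fun x => Derive_on 0 1 (fun y => eta y * u y t) x * th x) = 0).
{ rewrite <- (int01_scal P), <- !(int01_plus P) by pwc_auto.
  apply int01_zero; intros x Hx; assert (H := Hm x t ltac:(lra) Ht).
  unfold Dx in H; match type of H with ?l = 0 => transitivity (l * th x) end;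
    [ring|rewrite H; ring]. }
assert (E2 : int01 (fun x => mass_coef mu beta b x * Dt T u x t * xi x)
  - mu / 3 * int01 (fun x => Derive_on 0 1 flx x * xi x)
  + int01 (fun x => eta x * Derive_on 0 1 (fun y => zeta y t) x * xi x)
  + eps * int01 (fun x => eta x * u x t * Derive_on 0 1 (fun y => u y t) x * xi x) = 0).
{ rewrite <- !(int01_scal P), <- (int01_minus P), <- !(int01_plus P) by pwc_auto.
  apply int01_zero; intros x Hx; assert (H := Hp x t ltac:(lra) Ht).
  match type of H with ?l = 0 => transitivity (l * xi x) end;
    [unfold flx, Dx; ring|rewrite H; ring]. }
rewrite Hparts; lra.
Qed.

Lemma continuous_on_bounded (a b : R) (f : R -> R) : a <= b ->
  continuous_on (fun x => a <= x <= b) f ->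
  exists M, 0 <= M /\ forall x, a <= x <= b -> Rabs (f x) <= M.
Proof.
intros Hab Hf; rewrite continuous_on_clamp in Hf by assumption.
destruct (continuity_ab_maj (fun x => Rabs (f (clamp a b x))) a b) as [xm [Hxm _]]; [assumption| |].
- intros c _; apply continuity_pt_filterlim.
  apply (continuous_comp (fun x => f (clamp a b x)) Rabs); [apply Hf|apply continuous_Rabs].
- exists (Rabs (f (clamp a b xm))); split; [apply Rabs_pos|].
  intros x Hx; assert (H := Hxm x Hx); rewrite (clamp_id a b x) in H by assumption; exact H.
Qed.

Lemma bottom_exists mu beta b c1 c2 : 0 < mu -> 0 < c1 -> 0 < c2 -> Ck_on 2 0 1 b ->
  (forall x, 0 <= x <= 1 -> c1 <= eta_b beta b x) ->
  (forall x, 0 <= x <= 1 -> c2 <= mass_coef mu beta b x) ->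
  exists M, bottom mu beta b c1 c2 M.
Proof.
intros Hmu Hc1 Hc2 Hb H1 H2.
assert (He : Ck_on 2 0 1 (eta_b beta b)).
{ apply (Ck_on_ext 2 0 1 (fun x => 1 + - beta * b x)); [lra|intros; unfold eta_b; ring|].
  apply Ck_on_axpy; [lra|apply Ck_on_const; lra|assumption]. }
assert (K0 : continuous_on (fun x => 0 <= x <= 1) (eta_b beta b)) by apply He.
assert (K1 : continuous_on (fun x => 0 <= x <= 1) (Derive_on 0 1 (eta_b beta b))) by apply He.
assert (K2 : continuous_on (fun x => 0 <= x <= 1) (Derive_on 0 1 (Derive_on 0 1 (eta_b beta b)))) by apply He.
destruct (continuous_on_bounded 0 1 _ Rle_0_1 K0) as [M0 [M0p B0]].
destruct (continuous_on_bounded 0 1 _ Rle_0_1 K1) as [M1 [M1p B1]].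
destruct (continuous_on_bounded 0 1 _ Rle_0_1 K2) as [M2 [M2p B2]].
assert (HM : 0 <= mu / 2 * (M0 ^ 2 * M2)).
{ apply Rmult_le_pos; [lra|]; apply Rmult_le_pos; [apply pow_le|]; assumption. }
(* [M0] bounds [eta_b], [M1] its derivative, and [M0] plus the last term the mass coefficient. *)
exists (M0 + M1 + mu / 2 * (M0 ^ 2 * M2)); constructor; try assumption.
- apply Ck_on_C1_on, (Ck_on_le 1 2); [lia|assumption].
- intros P; unfold mass_coef.
  assert (P0 := continuous_on_pwc P _ K0); assert (P2 := continuous_on_pwc P _ K2).
  apply pwc_minus; [assumption|]; apply pwc_mult; [apply pwc_mult|assumption];
    [apply pwc_const|apply pwc_pow2; assumption].
- intros x Hx; assert (H := B0 x Hx); apply Rabs_le_between in H; lra.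
- intros x Hx; assert (H := B1 x Hx); lra.
- intros x Hx; assert (Hb0 := B0 x Hx); assert (Hb2 := B2 x Hx); unfold mass_coef.
  set (et := eta_b beta b x) in *; set (dd := Derive_on 0 1 (Derive_on 0 1 (eta_b beta b)) x) in *.
  assert (Habs : Rabs (et ^ 2 * dd) <= M0 ^ 2 * M2).
  { rewrite Rabs_mult, <- RPow_abs; apply Rmult_le_compat; try apply Rabs_pos; try assumption.
    - apply pow_le, Rabs_pos.
    - apply pow_incr; split; [apply Rabs_pos|assumption]. }
  apply Rabs_le_between in Hb0, Habs.
  assert (mu / 2 * - (M0 ^ 2 * M2) <= mu / 2 * (et ^ 2 * dd)) by (apply Rmult_le_compat_l; lra).
  lra.
Qed.

Lemma inner_ext01 f g f' g' : (forall x, 0 <= x <= 1 -> f x = f' x) ->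
  (forall x, 0 <= x <= 1 -> g x = g' x) -> inner f g = inner f' g'.
Proof. intros H1 H2; apply RInt_ext_R; [lra|]; intros x Hx; rewrite H1, H2 by lra; reflexivity. Qed.

Lemma formA_ext01 mu beta b v w v' w' : (forall x, 0 <= x <= 1 -> v x = v' x) ->
  (forall x, 0 <= x <= 1 -> w x = w' x) -> formA mu beta b v w = formA mu beta b v' w'.
Proof.
intros H1 H2; unfold formA; apply f_equal2; [|apply f_equal]; apply inner_ext01; try assumption;
  intros x Hx.
- rewrite H1 by assumption; reflexivity.
- rewrite (Derive_on_ext 0 1 v v') by assumption; reflexivity.
- apply Derive_on_ext; assumption.
Qed.

(** The forms depend only on values in [0, 1], and only there is an element of the space recovered
    from its coordinates. *)
Definition same01 (v w : bool * R -> R) : Prop := forall p, 0 <= snd p <= 1 -> v p = w p.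

Lemma energy_form_ext mu beta b v w v' w' : same01 v v' -> same01 w w' ->
  energy_form mu beta b v w = energy_form mu beta b v' w'.
Proof.
intros H1 H2; unfold energy_form; apply f_equal2; [apply inner_ext01|apply formA_ext01];
  intros x Hx; try (apply (H1 (_, x)); assumption); apply (H2 (_, x)); assumption.
Qed.

Lemma pair_flux_ext eps eta v w v' w' : same01 v v' -> same01 w w' ->
  pair_flux eps eta v w = pair_flux eps eta v' w'.
Proof.
intros H1 H2.
assert (A1 : forall x, 0 <= x <= 1 -> fstf v x = fstf v' x) by (intros x Hx; apply (H1 (true, x)), Hx).
assert (A2 : forall x, 0 <= x <= 1 -> sndf v x = sndf v' x) by (intros x Hx; apply (H1 (false, x)), Hx).
assert (A3 : forall x, 0 <= x <= 1 -> fstf w x = fstf w' x) by (intros x Hx; apply (H2 (true, x)), Hx).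
assert (A4 : forall x, 0 <= x <= 1 -> sndf w x = sndf w' x) by (intros x Hx; apply (H2 (false, x)), Hx).
unfold pair_flux, flux; apply (f_equal2 Rplus); apply (f_equal2 Rplus);
  [apply (f_equal (Rmult eps))| | |apply (f_equal (Rmult eps))]; apply inner_ext01; try assumption;
  intros x Hx.
- apply Derive_on_ext; [assumption|]; intros; rewrite A1, A2 by assumption; reflexivity.
- apply Derive_on_ext; [assumption|]; intros; rewrite A2 by assumption; reflexivity.
- rewrite (Derive_on_ext 0 1 (fstf v) (fstf v')) by assumption; reflexivity.
- rewrite (Derive_on_ext 0 1 (sndf v) (sndf v')), A2 by assumption; reflexivity.
Qed.

Lemma pair_pc1_zero P : pair_pc1 P (fun _ => 0).
Proof. split; apply pc1_const. Qed.

Lemma pair_pc1_axpy P v w a : pair_pc1 P v -> pair_pc1 P w -> pair_pc1 P (fun p => v p + a * w p).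
Proof.
intros [Hv1 Hv2] [Hw1 Hw2]; split.
- apply (pc1_plus P (fstf v)); [assumption|apply pc1_mult; [apply pc1_const|assumption]].
- apply (pc1_plus P (sndf v)); [assumption|apply pc1_mult; [apply pc1_const|assumption]].
Qed.

Lemma pair_pc1_lcomb P N c E : (forall i, (i < N)%nat -> pair_pc1 P (E i)) -> pair_pc1 P (lcomb N c E).
Proof. apply lcomb_closed; [apply pair_pc1_zero|intros; apply pair_pc1_axpy; assumption]. Qed.

Lemma pair_flux_lcomb P eps eta N c E w : pc1 P eta -> pair_pc1 P w ->
  (forall i, (i < N)%nat -> pair_pc1 P (E i)) ->
  pair_flux eps eta (lcomb N c E) w
  = rsum N (fun j => c j * pair_flux_lin eta (E j) w)
    + rsum N (fun j => c j * rsum N (fun k => c k * pair_flux_quad eps eta (E j) (E k) w)).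
Proof.
intros He Hw HE; assert (HL := pair_pc1_lcomb P N c E HE).
rewrite pair_flux_split; apply f_equal2.
- apply (linear_on_lcomb (pair_pc1 P) (fun v => pair_flux_lin eta v w)); try assumption.
  + apply pair_pc1_zero.
  + intros; apply pair_pc1_axpy; assumption.
  + intros v v' a Hv Hv'; apply (pair_flux_lin_axpy P); assumption.
- transitivity (rsum N (fun j => c j * pair_flux_quad eps eta (E j) (lcomb N c E) w)).
  + apply (linear_on_lcomb (pair_pc1 P) (fun v => pair_flux_quad eps eta v (lcomb N c E) w)); try assumption.
    * apply pair_pc1_zero.
    * intros; apply pair_pc1_axpy; assumption.
    * intros v v' a Hv Hv'; apply (pair_flux_quad_axpy_l P); assumption.
  + apply rsum_ext; intros j Hj; apply f_equal.
    apply (linear_on_lcomb (pair_pc1 P) (fun v => pair_flux_quad eps eta (E j) v w)); try assumption.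
    * apply pair_pc1_zero.
    * intros; apply pair_pc1_axpy; assumption.
    * intros v v' a Hv Hv'; apply (pair_flux_quad_axpy_r P); try assumption; apply HE, Hj.
Qed.

Lemma pair_flux_lcomb_test P eps eta N c E v : pc1 P eta -> pair_pc1 P v ->
  (forall i, (i < N)%nat -> pair_pc1 P (E i)) ->
  pair_flux eps eta v (lcomb N c E) = rsum N (fun i => c i * pair_flux eps eta v (E i)).
Proof.
intros He Hv HE; apply (linear_on_lcomb (pair_pc1 P) (fun w => pair_flux eps eta v w)); try assumption.
- apply pair_pc1_zero.
- intros; apply pair_pc1_axpy; assumption.
- intros w w' a Hw Hw'; apply (pair_flux_axpy_test P); assumption.
Qed.

Definition pair_basis mu beta b d k P (N : nat) (E : nat -> bool * R -> R) : Prop :=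
  orthonormal (pair_space d k P) (energy_form mu beta b) N E /\
  (forall v, pair_space d k P v -> same01 v (lcomb N (coords (energy_form mu beta b) E v) E)) /\
  (forall Q : ((bool * R -> R) -> R) -> Prop,
       Q (fun _ => 0) ->
       (forall f g a, Q f -> Q g -> Q (fun v => f v + a * g v)) ->
       (forall f g, (forall v, pair_space d k P v -> f v = g v) -> Q f -> Q g) ->
       (forall p, 0 <= snd p <= 1 -> Q (fun v => v p)) ->
       forall i, (i < N)%nat -> Q (fun v => energy_form mu beta b v (E i))).

Lemma pair_basis_pc1 mu beta b d k P N E i : pair_basis mu beta b d k P N E -> (i < N)%nat -> pair_pc1 P (E i).
Proof. intros [[H _] _] Hi; apply (pair_space_pc1 d k), H, Hi. Qed.

Lemma pair_basis_lcomb mu beta b d k P N E c : pair_basis mu beta b d k P N E -> pair_space d k P (lcomb N c E).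
Proof.
intros [[H _] _]; apply lcomb_closed; [apply pair_space_zero|intros; apply pair_space_axpy; assumption|exact H].
Qed.

(** In an orthonormal basis the mass matrix is the identity, so the system is already solved for the
    derivatives of the coordinates. *)
Definition galerkin_field eps beta b (N : nat) (E : nat -> bool * R -> R) : (nat -> R) -> nat -> R :=
  quadratic_field N (fun j i => pair_flux_lin (eta_b beta b) (E j) (E i))
    (fun j k i => pair_flux_quad eps (eta_b beta b) (E j) (E k) (E i)).

Lemma galerkin_field_flux eps mu beta b c1 c2 M d k P N E c i : bottom mu beta b c1 c2 M ->
  pair_basis mu beta b d k P N E -> (i < N)%nat ->
  galerkin_field eps beta b N E c i = - pair_flux eps (eta_b beta b) (lcomb N c E) (E i).
Proof.
intros HB HE Hi; unfold galerkin_field, quadratic_field.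
rewrite (pair_flux_lcomb P); [reflexivity| | |].
- apply (bottom_eta_pc1 mu beta b c1 c2 M), HB.
- apply (pair_basis_pc1 mu beta b d k P N E); assumption.
- intros j Hj; apply (pair_basis_pc1 mu beta b d k P N E); assumption.
Qed.

Lemma is_derive_on_continuous a b f df : a < b ->
  (forall x, a <= x <= b -> is_derive_on a b f x (df x)) -> continuous_on (fun x => a <= x <= b) f.
Proof.
intros Hab H x Hx; assert (PF := within_interval_proper a b x Hab Hx).
apply (filterdiff_continuous_aux (K := R_AbsRing) (U := R_NormedModule) (V := R_NormedModule)).
- eexists; apply H, Hx.
- intros Q HQ; apply filter_le_within, HQ.
Qed.

Lemma is_derive_on_ext_all a b f g x l : (forall y, f y = g y) ->
  is_derive_on a b f x l -> is_derive_on a b g x l.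
Proof.
intros H; replace g with f; [auto|]; extensionality y; apply H.
Qed.

Lemma is_derive_on_rsum a b n (f df : nat -> R -> R) x :
  (forall i, (i < n)%nat -> is_derive_on a b (f i) x (df i x)) ->
  is_derive_on a b (fun y => rsum n (fun i => f i y)) x (rsum n (fun i => df i x)).
Proof.
induction n as [|n IH]; intros H; simpl; [apply is_derive_on_const|].
replace (rsum n (fun i => df i x) + df n x) with (rsum n (fun i => df i x) + 1 * df n x) by ring.
apply (is_derive_on_ext_all a b (fun y => rsum n (fun i => f i y) + 1 * f n y)); [intros; ring|].
apply is_derive_on_axpy; [apply IH; intros|]; apply H; lia.
Qed.

(** * The Galerkin system in coordinates *)

Lemma inner_zero_r f : inner f (fun _ => 0) = 0.
Proof. apply int01_zero; intros; ring. Qed.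

Lemma formA_zero_r mu beta b v : formA mu beta b v (fun _ => 0) = 0.
Proof.
unfold formA; rewrite inner_zero_r.
replace (inner _ (Derive_on 0 1 (fun _ => 0))) with 0; [ring|symmetry].
apply int01_zero; intros x Hx.
rewrite (is_derive_on_unique 0 1 (fun _ => 0) x 0); [ring|lra|lra|apply is_derive_on_const].
Qed.

Lemma slice_lcomb N (c : nat -> R -> R) (E : nat -> bool * R -> R) t :
  slice (fun x t => lcomb N (fun i => c i t) E (true, x)) (fun x t => lcomb N (fun i => c i t) E (false, x)) t
  = lcomb N (fun i => c i t) E.
Proof. extensionality p; destruct p as [[] x]; reflexivity. Qed.

Lemma slice_Dt_same01 T N (c dc : nat -> R -> R) E zh uh t : 0 < T -> 0 <= t <= T ->
  (forall s, 0 <= s <= T -> same01 (slice zh uh s) (lcomb N (fun i => c i s) E)) ->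
  (forall i, (i < N)%nat -> is_derive_on 0 T (c i) t (dc i t)) ->
  same01 (slice (Dt T zh) (Dt T uh) t) (lcomb N (fun i => dc i t) E) /\
  (forall x, 0 <= x <= 1 -> ex_derive_on 0 T (fun s => zh x s) t /\ ex_derive_on 0 T (fun s => uh x s) t).
Proof.
intros HT Ht Hs Hd.
assert (H : forall p, 0 <= snd p <= 1 ->
  is_derive_on 0 T (fun s => slice zh uh s p) t (lcomb N (fun i => dc i t) E p)).
{ intros p Hp; apply (is_derive_on_ext 0 T (fun s => rsum N (fun i => c i s * E i p))); [assumption| |].
  - intros s Hs'; symmetry; apply (Hs s Hs' p Hp).
  - apply (is_derive_on_rsum 0 T N (fun i s => c i s * E i p) (fun i s => dc i s * E i p)).
    intros i Hi; replace (dc i t * E i p) with (0 + E i p * dc i t) by ring.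
    apply (is_derive_on_ext_all 0 T (fun s => 0 + E i p * c i s)); [intros; ring|].
    apply is_derive_on_axpy; [apply is_derive_on_const|apply Hd, Hi]. }
split.
- intros [[] x] Hx; unfold slice, pairf, Dt; simpl fst; simpl snd; cbv iota.
  + apply is_derive_on_unique; [assumption..|apply (H (true, x) Hx)].
  + apply is_derive_on_unique; [assumption..|apply (H (false, x) Hx)].
- intros x Hx; split; eexists; [apply (H (true, x) Hx)|apply (H (false, x) Hx)].
Qed.

(** The two semidiscrete equations amount to one identity on pairs: adding them gives it, and
    testing it with [(phi, 0)] and [(0, chi)] recovers each. *)
Lemma weak_form_sum eps mu beta b T zh uh t w :
  energy_form mu beta b (slice (Dt T zh) (Dt T uh) t) w + pair_flux eps (eta_b beta b) (slice zh uh t) w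
  = (inner (fun x => Dt T zh x t) (fstf w)
     + eps * inner (fun x => Dx (fun y s => zh y s * uh y s) x t) (fstf w)
     + inner (fun x => Dx (fun y s => eta_b beta b y * uh y s) x t) (fstf w))
    + (formA mu beta b (fun x => Dt T uh x t) (sndf w)
       + inner (fun x => eta_b beta b x * Dx zh x t) (sndf w)
       + eps * inner (fun x => eta_b beta b x * uh x t * Dx uh x t) (sndf w)).
Proof.
transitivity ((inner (fun x => Dt T zh x t) (fstf w) + formA mu beta b (fun x => Dt T uh x t) (sndf w))
  + (eps * inner (fun x => Dx (fun y s => zh y s * uh y s) x t) (fstf w)
     + inner (fun x => Dx (fun y s => eta_b beta b y * uh y s) x t) (fstf w)
     + (inner (fun x => eta_b beta b x * Dx zh x t) (sndf w)
        + eps * inner (fun x => eta_b beta b x * uh x t * Dx uh x t) (sndf w))));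
  [reflexivity|ring].
Qed.

Lemma semidiscrete_coords T eps mu beta b c1 c2 M zeta0 u0 d k P N E zh uh :
  0 < T -> bottom mu beta b c1 c2 M -> pair_basis mu beta b d k P N E ->
  semidiscrete_solution T eps mu beta b zeta0 u0 (S d) k P zh uh ->
  let c := fun i t => energy_form mu beta b (slice zh uh t) (E i) in
  (forall i t, (i < N)%nat -> 0 <= t <= T ->
     is_derive_on 0 T (c i) t (galerkin_field eps beta b N E (fun j => c j t) i)) /\
  (forall i, (i < N)%nat -> c i 0 = energy_form mu beta b (pairf zeta0 u0) (E i)) /\
  (forall t, 0 <= t <= T -> same01 (slice zh uh t) (lcomb N (fun i => c i t) E)).
Proof.
intros HT HB HE [S1 [S2 [S3 [S4 [[_ S5] [_ S6]]]]]] c.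
assert (HI := energy_inner_space_pair mu beta b c1 c2 M d k P HB).
assert (HV : forall t, 0 <= t <= T -> pair_space d k P (slice zh uh t)) by (intros t Ht; apply S1, Ht).
assert (Hspan : forall t, 0 <= t <= T -> same01 (slice zh uh t) (lcomb N (fun i => c i t) E)).
{ intros t Ht; apply (proj1 (proj2 HE)), HV, Ht. }
(* A solution is only known to have differentiable point values; the closure clause of the basis
   carries this over to the coordinates. *)
assert (Hex : forall i, (i < N)%nat -> forall t, 0 <= t <= T -> ex_derive_on 0 T (c i) t).
{ apply (proj2 (proj2 HE) (fun f => forall t, 0 <= t <= T -> ex_derive_on 0 T (fun s => f (slice zh uh s)) t)).
  - intros t Ht; exists 0; apply is_derive_on_const.
  - intros f g a Hf Hg t Ht; destruct (Hf t Ht) as [l Hl]; destruct (Hg t Ht) as [m Hm].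
    exists (l + a * m); apply is_derive_on_axpy; assumption.
  - intros f g Hfg Hf t Ht; destruct (Hf t Ht) as [l Hl]; exists l.
    apply (is_derive_on_ext 0 T (fun s => f (slice zh uh s))); [assumption| |assumption].
    intros s Hs; apply Hfg, HV, Hs.
  - intros [[] x] Hx t Ht; apply (S2 x t Hx Ht). }
assert (Hd : forall i t, (i < N)%nat -> 0 <= t <= T -> is_derive_on 0 T (c i) t (Derive_on 0 T (c i) t)).
{ intros i t Hi Ht; apply Derive_on_correct; [assumption|assumption|apply Hex; assumption]. }
split; [|split; [|assumption]].
- intros i t Hi Ht.
  replace (galerkin_field eps beta b N E (fun j => c j t) i) with (Derive_on 0 T (c i) t); [apply Hd; assumption|].
  rewrite (galerkin_field_flux eps mu beta b c1 c2 M d k P) by assumption.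
  destruct (slice_Dt_same01 T N c (fun i t => Derive_on 0 T (c i) t) E zh uh t HT Ht Hspan
    ltac:(intros; apply Hd; assumption)) as [HD _].
  assert (W := weak_form_sum eps mu beta b T zh uh t (E i)).
  destruct (proj1 (proj1 HE) i Hi) as [Ei1 Ei2].
  assert (W1 := S3 t Ht (fstf (E i)) Ei1); assert (W2 := S4 t Ht (sndf (E i)) Ei2).
  cbv zeta in W1, W2; rewrite W1, W2 in W.
  rewrite (energy_form_ext mu beta b _ (E i) _ (E i) HD) in W by (intros p _; reflexivity).
  rewrite (orthonormal_coords (pair_space d k P)) in W by (first [assumption|apply HE]).
  rewrite (pair_flux_ext _ _ _ (E i) _ (E i) (Hspan t Ht)) in W by (intros p _; reflexivity).
  lra.
- intros i Hi; destruct (proj1 (proj1 HE) i Hi) as [Ei1 Ei2].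
  exact (f_equal2 Rplus (S5 _ Ei1) (S6 _ Ei2)).
Qed.

Lemma energy_form_lcomb_r mu beta b c1 c2 M P N c E v : bottom mu beta b c1 c2 M ->
  pair_pc1 P v -> (forall i, (i < N)%nat -> pair_pc1 P (E i)) ->
  energy_form mu beta b v (lcomb N c E) = rsum N (fun i => c i * energy_form mu beta b v (E i)).
Proof.
intros HB Hv HE; assert (HI := energy_inner_space mu beta b c1 c2 M P HB).
apply (linear_on_lcomb (pair_pc1 P) (fun w => energy_form mu beta b v w)); try assumption.
- apply pair_pc1_zero.
- intros; apply pair_pc1_axpy; assumption.
- intros w w' a Hw Hw'.
  rewrite (inner_space_sym _ _ HI v) by (try apply pair_pc1_axpy; assumption).
  rewrite (inner_space_lin _ _ HI) by assumption.
  rewrite (inner_space_sym _ _ HI w), (inner_space_sym _ _ HI w') by assumption; reflexivity.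
Qed.

Lemma same01_refl v : same01 v v.
Proof. intros p _; reflexivity. Qed.

Lemma pair_space_fst d k P phi : Sh (S d) k P phi -> pair_space d k P (pairf phi (fun _ => 0)).
Proof. intros H; split; [exact H|apply Sh0_zero]. Qed.

Lemma pair_space_snd d k P chi : Sh0 (S d) k P chi -> pair_space d k P (pairf (fun _ => 0) chi).
Proof. intros H; split; [apply Sh_zero|exact H]. Qed.

Lemma energy_form_fst mu beta b v phi :
  energy_form mu beta b v (pairf phi (fun _ => 0)) = inner (fstf v) phi.
Proof.
unfold energy_form; change (sndf (pairf phi (fun _ => 0))) with (fun _ : R => 0).
rewrite formA_zero_r; apply Rplus_0_r.
Qed.

Lemma energy_form_snd mu beta b v chi :
  energy_form mu beta b v (pairf (fun _ => 0) chi) = formA mu beta b (sndf v) chi.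
Proof.
unfold energy_form; change (fstf (pairf (fun _ => 0) chi)) with (fun _ : R => 0).
rewrite inner_zero_r; apply Rplus_0_l.
Qed.

Lemma galerkin_semidiscrete T eps mu beta b c1 c2 M zeta0 u0 d k P N E (c : nat -> R -> R) :
  0 < T -> bottom mu beta b c1 c2 M -> pair_basis mu beta b d k P N E ->
  pair_pc1 P (pairf zeta0 u0) ->
  (forall i t, (i < N)%nat -> 0 <= t <= T ->
     is_derive_on 0 T (c i) t (galerkin_field eps beta b N E (fun j => c j t) i)) ->
  (forall i, (i < N)%nat -> c i 0 = energy_form mu beta b (pairf zeta0 u0) (E i)) ->
  semidiscrete_solution T eps mu beta b zeta0 u0 (S d) k P
    (fun x t => lcomb N (fun i => c i t) E (true, x)) (fun x t => lcomb N (fun i => c i t) E (false, x)).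
Proof.
intros HT HB HE H0 Hd Hc0.
set (zh := fun x t => lcomb N (fun i => c i t) E (true, x)).
set (uh := fun x t => lcomb N (fun i => c i t) E (false, x)).
assert (Hsl : forall t, slice zh uh t = lcomb N (fun i => c i t) E) by (intros; apply slice_lcomb).
assert (HV : forall t, pair_space d k P (slice zh uh t)).
{ intros t; rewrite Hsl; apply (pair_basis_lcomb mu beta b), HE. }
assert (HEp : forall i, (i < N)%nat -> pair_pc1 P (E i))
  by (intros; apply (pair_basis_pc1 mu beta b d k P N E); assumption).
assert (Heta := bottom_eta_pc1 _ _ _ _ _ _ P HB).
assert (HI := energy_inner_space_pair mu beta b c1 c2 M d k P HB).
set (dc := fun i t => galerkin_field eps beta b N E (fun j => c j t) i).
assert (HDt : forall t, 0 <= t <= T ->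
  same01 (slice (Dt T zh) (Dt T uh) t) (lcomb N (fun i => dc i t) E) /\
  (forall x, 0 <= x <= 1 -> ex_derive_on 0 T (fun s => zh x s) t /\ ex_derive_on 0 T (fun s => uh x s) t)).
{ intros t Ht; apply (slice_Dt_same01 T N c dc E); try assumption.
  - intros s _; rewrite Hsl; apply same01_refl.
  - intros i Hi; apply Hd; assumption. }
(* The ODE is this identity for basis elements. Both terms are linear in the test pair, and every
   test pair agrees on [0, 1] with its expansion. *)
assert (HW : forall t, 0 <= t <= T -> forall w, pair_space d k P w ->
  energy_form mu beta b (slice (Dt T zh) (Dt T uh) t) w
  + pair_flux eps (eta_b beta b) (slice zh uh t) w = 0).
{ intros t Ht w Hw; destruct (HDt t Ht) as [HD _].
  assert (Hws := proj1 (proj2 HE) w Hw).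
  rewrite (energy_form_ext mu beta b _ w _ _ HD Hws), (pair_flux_ext _ _ _ w _ _ (same01_refl _) Hws), Hsl.
  rewrite (energy_form_lcomb_r mu beta b c1 c2 M P), (pair_flux_lcomb_test P)
    by (try assumption; apply pair_pc1_lcomb; assumption).
  rewrite <- (Rmult_1_l (rsum N (fun i => _ * pair_flux _ _ _ _))), <- rsum_lin.
  rewrite (rsum_ext N _ (fun _ => 0)), rsum_const; [ring|].
  intros i Hi; rewrite (orthonormal_coords (pair_space d k P)) by (first [assumption|apply HE]).
  unfold dc; rewrite (galerkin_field_flux eps mu beta b c1 c2 M d k P) by assumption; ring. }
assert (Hinit : forall w, pair_space d k P w ->
  energy_form mu beta b (slice zh uh 0) w = energy_form mu beta b (pairf zeta0 u0) w).
{ intros w Hw; assert (Hws := proj1 (proj2 HE) w Hw).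
  rewrite !(energy_form_ext mu beta b _ w _ _ (same01_refl _) Hws).
  rewrite Hsl, !(energy_form_lcomb_r mu beta b c1 c2 M P)
    by (try assumption; apply pair_pc1_lcomb; assumption).
  apply rsum_ext; intros i Hi.
  rewrite (orthonormal_coords (pair_space d k P)) by (first [assumption|apply HE]).
  rewrite Hc0 by assumption; reflexivity. }
split; [|split; [|split; [|split; [|split]]]].
- intros t _; split; apply (HV t).
- intros x t Hx Ht; apply (HDt t Ht); assumption.
- intros t Ht phi Hphi.
  assert (W := weak_form_sum eps mu beta b T zh uh t (pairf phi (fun _ => 0))).
  rewrite HW in W by (try assumption; apply pair_space_fst, Hphi).
  change (sndf (pairf phi (fun _ => 0))) with (fun _ : R => 0) in W.
  change (fstf (pairf phi (fun _ => 0))) with phi in W.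
  rewrite formA_zero_r, !inner_zero_r in W; rewrite W; ring.
- intros t Ht chi Hchi.
  assert (W := weak_form_sum eps mu beta b T zh uh t (pairf (fun _ => 0) chi)).
  rewrite HW in W by (try assumption; apply pair_space_snd, Hchi).
  change (fstf (pairf (fun _ => 0) chi)) with (fun _ : R => 0) in W.
  change (sndf (pairf (fun _ => 0) chi)) with chi in W.
  rewrite !inner_zero_r in W; rewrite W; ring.
- split; [apply (HV 0)|]; intros phi Hphi.
  assert (W := Hinit _ (pair_space_fst d k P phi Hphi)); rewrite !energy_form_fst in W; exact W.
- split; [apply (HV 0)|]; intros chi Hchi.
  assert (W := Hinit _ (pair_space_snd d k P chi Hchi)); rewrite !energy_form_snd in W; exact W.
Qed.

(** * Error estimates *)

(** Pythagoras: with [x] the error of an orthogonal projection and [s] the projection minus a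
    competitor, it says that the projection is the best approximation. *)
Lemma inner_space_best {I : Type} (V : (I -> R) -> Prop) B (x s : I -> R) :
  inner_space V B -> V x -> V s -> B x s = 0 ->
  B x x <= B (fun p => x p + 1 * s p) (fun p => x p + 1 * s p).
Proof.
intros HB Hx Hs H0.
assert (Hxs : V (fun p => x p + 1 * s p)) by (apply (inner_space_axpy V B HB); assumption).
rewrite (inner_space_lin V B HB), (inner_space_sym V B HB x (fun p => x p + 1 * s p)),
  (inner_space_sym V B HB s (fun p => x p + 1 * s p)) by assumption.
rewrite !(inner_space_lin V B HB), (inner_space_sym V B HB s x), H0 by assumption.
assert (H := inner_space_ge0 V B HB s Hs); lra.
Qed.

Lemma inner_inner_space P : inner_space (pc1 P) inner.
Proof.
constructor.
- apply pc1_const.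
- intros; apply pc1_plus; [assumption|apply pc1_mult; [apply pc1_const|assumption]].
- intros; apply (inner_axpy_l P); auto with pw.
- intros; apply inner_comm.
- intros; apply (inner_ge0 P); auto with pw.
Qed.

Lemma formA_inner_space mu beta b c1 c2 M P : bottom mu beta b c1 c2 M ->
  inner_space (pc1 P) (formA mu beta b).
Proof.
intros HB; constructor.
- apply pc1_const.
- intros; apply pc1_plus; [assumption|apply pc1_mult; [apply pc1_const|assumption]].
- intros; apply (formA_axpy_l mu beta b c1 c2 M P); assumption.
- intros; apply formA_comm.
- intros; apply (formA_ge mu beta b c1 c2 M P); assumption.
Qed.

Lemma inner_sqr_le P f e : pwc P f -> 0 <= e -> (forall x, off_nodes P x -> Rabs (f x) <= e) ->
  inner f f <= e ^ 2.
Proof.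
intros Hf He H; rewrite <- (int01_const (e ^ 2)).
apply (int01_le P); [eauto with pw|apply pwc_const|].
intros x Hx; replace (f x * f x) with (Rabs (f x) ^ 2) by (rewrite pow2_abs; ring).
apply pow_incr; split; [apply Rabs_pos|apply H, Hx].
Qed.

(** The expansion with the coordinates of [v] is its orthogonal projection for the energy form.
    Tested with [(phi, 0)] and [(0, chi)], this identifies its components with P and R_h of the
    components of [v]. *)
Lemma pair_projection_orthogonal mu beta b c1 c2 M d k P N E v w : bottom mu beta b c1 c2 M ->
  pair_basis mu beta b d k P N E -> pair_pc1 P v -> pair_space d k P w ->
  energy_form mu beta b (lcomb N (coords (energy_form mu beta b) E v) E) w = energy_form mu beta b v w.
Proof.
intros HB HE Hv Hw; assert (Hws := proj1 (proj2 HE) w Hw).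
assert (HEp : forall i, (i < N)%nat -> pair_pc1 P (E i))
  by (intros; apply (pair_basis_pc1 mu beta b d k P N E); assumption).
assert (HI := energy_inner_space_pair mu beta b c1 c2 M d k P HB).
rewrite !(energy_form_ext mu beta b _ w _ _ (same01_refl _) Hws).
rewrite !(energy_form_lcomb_r mu beta b c1 c2 M P) by (try assumption; apply pair_pc1_lcomb; assumption).
apply rsum_ext; intros i Hi.
rewrite (orthonormal_coords (pair_space d k P)) by (first [assumption|apply HE]); reflexivity.
Qed.

Lemma Sh_minus d k P f g : Sh (S d) k P f -> Sh (S d) k P g -> Sh (S d) k P (fun x => f x + -1 * g x).
Proof. intros; apply Sh_axpy; assumption. Qed.

(** Here [r = e + 2]. Both projections are compared with splines of smoothness [C^e], which belong
    to [S_h] for every [k <= e]. The spline of the last clause replaces R_h u where a uniform bound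
    on a derivative is called for, since the projection is controlled only in integral norms. *)
Lemma projection_error (e : nat) : exists Ca, 0 <= Ca /\
  forall mu beta b c1 c2 M k P N E z u Mr,
  bottom mu beta b c1 c2 M -> pair_basis mu beta b (S e) k P N E -> (k <= e)%nat -> 0 <= Mr ->
  Ck_on (S (S e)) 0 1 z -> Ck_on (S (S e)) 0 1 u -> u 0 = 0 -> u 1 = 0 ->
  (forall x, 0 <= x <= 1 -> Rabs (Dn (S (S e)) z x) <= Mr) ->
  (forall x, 0 <= x <= 1 -> Rabs (Dn (S (S e)) u x) <= Mr) ->
  let p := lcomb N (coords (energy_form mu beta b) E (pairf z u)) E in
  inner (fun x => z x - fstf p x) (fun x => z x - fstf p x) <= (Ca * Mr * mesh P ^ S (S e)) ^ 2 /\
  formA mu beta b (fun x => u x - sndf p x) (fun x => u x - sndf p x)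
    <= (M + mu / 3 * M ^ 3) * (2 * (Ca * Mr * mesh P ^ S e) ^ 2) /\
  exists s, Sh0 (S (S e)) k P s /\
    forall x, off_nodes P x -> Rabs (Derive_on 0 1 u x - Derive_on 0 1 s x) <= Ca * Mr * mesh P ^ S e.
Proof.
destruct (spline_approx_value e) as [C1 [C10 A1]]; destruct (spline_approx_deriv0 e) as [C2 [C20 A2]].
exists (C1 + C2); split; [lra|].
intros mu beta b c1 c2 M k P N E z u Mr HB HE Hk HMr Hz Hu U0 U1 Bz Bu p.
assert (Hh := mesh_pos P).
destruct (A1 P z Mr Hz HMr Bz) as [s1 [S1 E1]].
destruct (A2 P u Mr Hu HMr Bu U0 U1) as [s2 [[S2 S20] [E2 E2']]].
assert (S1' : Sh (S (S e)) k P s1) by (apply (Sh_le (S e) k e); assumption).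
assert (S2' : Sh0 (S (S e)) k P s2) by (split; [apply (Sh_le (S e) k e); assumption|assumption]).
assert (Pz : pc1 P z) by (apply (Ck_on_pc1 (S e)), Hz).
assert (Pu : pc1 P u) by (apply (Ck_on_pc1 (S e)), Hu).
assert (Hv : pair_pc1 P (pairf z u)) by (split; assumption).
assert (Hp : pair_space (S e) k P p) by (apply (pair_basis_lcomb mu beta b), HE).
destruct Hp as [Hp1 Hp2].
assert (Hpow1 : 0 <= mesh P ^ S e) by (apply pow_le; lra).
assert (Hpow2 : 0 <= mesh P ^ S (S e)) by (apply pow_le; lra).
assert (HC1 : C1 * Mr * mesh P ^ S (S e) <= (C1 + C2) * Mr * mesh P ^ S (S e)).
{ apply Rmult_le_compat_r; [assumption|]; apply Rmult_le_compat_r; lra. }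
assert (HC2 : C2 * Mr * mesh P ^ S e <= (C1 + C2) * Mr * mesh P ^ S e).
{ apply Rmult_le_compat_r; [assumption|]; apply Rmult_le_compat_r; lra. }
assert (Pp1 : pc1 P (fstf p)) by (apply (Sh_pc1 (S e) k), Hp1).
assert (Pp2 : pc1 P (sndf p)) by (apply (Sh0_pc1 (S e) k), Hp2).
assert (Ps1 : pc1 P s1) by (apply (Sh_pc1 (S e) k), S1').
assert (Ps2 : pc1 P s2) by (apply (Sh0_pc1 (S e) k), S2').
split; [|split].
- assert (Ho : inner (fun x => z x + -1 * fstf p x) (fun x => fstf p x + -1 * s1 x) = 0).
  { rewrite (inner_axpy_l P) by (eauto with pw).
    assert (H := pair_projection_orthogonal mu beta b c1 c2 M (S e) k P N E (pairf z u)
      (pairf (fun x => fstf p x + -1 * s1 x) (fun _ => 0)) HB HE Hv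
      (pair_space_fst (S e) k P _ (Sh_minus (S e) k P _ _ Hp1 S1'))).
    rewrite !energy_form_fst in H; fold p in H.
    change (fstf (pairf z u)) with z in H; lra. }
  assert (HIS := inner_inner_space P).
  assert (H := inner_space_best (pc1 P) inner _ _ HIS
    ltac:(apply (inner_space_axpy _ _ HIS z (fstf p)); assumption)
    ltac:(apply (inner_space_axpy _ _ HIS (fstf p) s1); assumption) Ho).
  cbv beta in H.
  rewrite (inner_ext01 (fun x => z x - fstf p x) (fun x => z x - fstf p x)
    (fun x => z x + -1 * fstf p x) (fun x => z x + -1 * fstf p x)) by (intros; ring).
  eapply Rle_trans; [exact H|].
  rewrite (inner_ext01 _ _ (fun x => z x - s1 x) (fun x => z x - s1 x)) by (intros; ring).
  apply (inner_sqr_le P); [auto with pw|apply Rmult_le_pos; [apply Rmult_le_pos; lra|assumption]|].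
  intros x Hx; apply off_nodes_bounds in Hx; eapply Rle_trans; [apply E1; lra|exact HC1].
- assert (Ho : formA mu beta b (fun x => u x + -1 * sndf p x) (fun x => sndf p x + -1 * s2 x) = 0).
  { rewrite (formA_axpy_l mu beta b c1 c2 M P) by (first [assumption|eauto with pw]).
    assert (H := pair_projection_orthogonal mu beta b c1 c2 M (S e) k P N E (pairf z u)
      (pairf (fun _ => 0) (fun x => sndf p x + -1 * s2 x)) HB HE Hv
      (pair_space_snd (S e) k P _ (Sh0_axpy (S e) k P _ _ (-1) Hp2 S2'))).
    rewrite !energy_form_snd in H; fold p in H.
    change (sndf (pairf z u)) with u in H; lra. }
  assert (HIS := formA_inner_space mu beta b c1 c2 M P HB).
  assert (H := inner_space_best (pc1 P) (formA mu beta b) _ _ HIS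
    ltac:(apply (inner_space_axpy _ _ HIS u (sndf p)); assumption)
    ltac:(apply (inner_space_axpy _ _ HIS (sndf p) s2); assumption) Ho).
  cbv beta in H.
  rewrite (formA_ext01 mu beta b (fun x => u x - sndf p x) (fun x => u x - sndf p x)
    (fun x => u x + -1 * sndf p x) (fun x => u x + -1 * sndf p x)) by (intros; ring).
  eapply Rle_trans; [exact H|].
  rewrite (formA_ext01 mu beta b _ _ (fun x => u x - s2 x) (fun x => u x - s2 x)) by (intros; ring).
  eapply Rle_trans; [apply (formA_bounded mu beta b c1 c2 M P); [assumption|auto with pw]|].
  apply Rmult_le_compat_l.
  { apply (bottom_bound_pos mu beta b c1 c2), HB. }
  assert (B0 : 0 <= (C1 + C2) * Mr * mesh P ^ S e)
    by (apply Rmult_le_pos; [apply Rmult_le_pos; lra|assumption]).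
  assert (B1 : inner (fun x => u x - s2 x) (fun x => u x - s2 x) <= ((C1 + C2) * Mr * mesh P ^ S e) ^ 2).
  { apply (inner_sqr_le P); [auto with pw|assumption|].
    intros x Hx; apply off_nodes_bounds in Hx; eapply Rle_trans; [apply E2; lra|exact HC2]. }
  assert (B2 : inner (Derive_on 0 1 (fun x => u x - s2 x)) (Derive_on 0 1 (fun x => u x - s2 x))
    <= ((C1 + C2) * Mr * mesh P ^ S e) ^ 2).
  { apply (inner_sqr_le P); [auto with pw|assumption|].
    intros x Hx; rewrite (Derive_on_minus P) by assumption.
    eapply Rle_trans; [apply E2', Hx|exact HC2]. }
  lra.
- exists s2; split; [assumption|]; intros x Hx; eapply Rle_trans; [apply E2', Hx|exact HC2].
Qed.

Lemma inner_sum_le P f g : pwc P f -> pwc P g ->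
  inner (fun x => f x + g x) (fun x => f x + g x) <= 2 * inner f f + 2 * inner g g.
Proof.
intros Hf Hg; unfold inner.
change (int01 (fun x => (f x + g x) * (f x + g x)) <= 2 * int01 (fun x => f x * f x) + 2 * int01 (fun x => g x * g x)).
rewrite <- !(int01_scal P), <- (int01_plus P) by pwc_auto.
apply (int01_le P); [pwc_auto..|].
intros x _; assert (H := Rle_0_sqr (f x - g x)); unfold Rsqr in H; lra.
Qed.

Lemma inner_ext_off P f f' : pwc P f -> (forall x, off_nodes P x -> f x = f' x) ->
  inner f f = inner f' f'.
Proof. intros Hf H; apply (inner_ext P); assumption. Qed.

Lemma pair_energy_split mu beta b c1 c2 M P v : bottom mu beta b c1 c2 M -> pair_pc1 P v ->
  inner (fstf v) (fstf v) <= energy_form mu beta b v v /\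
  inner (sndf v) (sndf v) + inner (Derive_on 0 1 (sndf v)) (Derive_on 0 1 (sndf v))
    <= energy_form mu beta b v v / Rmin c2 (mu / 3 * c1 ^ 3).
Proof.
intros HB [V1 V2]; unfold energy_form.
assert (Hal := coercive_pos mu c1 c2 (bottom_mu HB) (bottom_c1 HB) (bottom_c2 HB)).
assert (H1 := formA_ge mu beta b c1 c2 M P _ HB V2).
assert (H2 := formA_coercive mu beta b c1 c2 M P _ HB V2).
assert (H3 : 0 <= inner (fstf v) (fstf v)) by (apply (inner_ge0 P); auto with pw).
split; [lra|].
apply Rle_div_r; [assumption|]; lra.
Qed.

Lemma lcomb_energy mu beta b c1 c2 M d k P N E c : bottom mu beta b c1 c2 M ->
  pair_basis mu beta b d k P N E ->
  energy_form mu beta b (lcomb N c E) (lcomb N c E) = rsum N (fun i => c i * c i).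
Proof.
intros HB HE.
assert (HEp : forall i, (i < N)%nat -> pair_pc1 P (E i))
  by (intros; apply (pair_basis_pc1 mu beta b d k P N E); assumption).
rewrite (energy_form_lcomb_r mu beta b c1 c2 M P) by (try assumption; apply pair_pc1_lcomb; assumption).
apply rsum_ext; intros i Hi.
rewrite (orthonormal_coords (pair_space d k P)); [reflexivity| |apply HE|assumption].
apply (energy_inner_space_pair mu beta b c1 c2 M), HB.
Qed.

Lemma Rabs_le_of_sqr x L : x ^ 2 <= L -> Rabs x <= 1 + L.
Proof. intros H; apply Rabs_le; split; nra. Qed.

(* [A h^(r-1)] is the order of the projection errors and [rsum N ...] the
   energy of the difference between the projected solution and the Galerkin
   solution with coordinates [c].  The inverse inequality bounds [u_h] and its
   derivative as long as that energy does not exceed [h]. *)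
Lemma galerkin_rate_bound (e : nat) mu beta b c1 c2 M q eps Md Mr :
  bottom mu beta b c1 c2 M -> 1 <= Md -> Rabs eps <= Md -> M <= Md -> 0 <= Mr ->
  exists K C, 0 <= K /\ 0 <= C /\
  forall k P N E z u c,
  pair_basis mu beta b (S e) k P N E -> (k <= e)%nat -> quasiuniform q P -> mesh P <= 1 ->
  Ck_on (S (S e)) 0 1 z -> Ck_on (S (S e)) 0 1 u -> u 0 = 0 -> u 1 = 0 ->
  (forall x, 0 <= x <= 1 -> Rabs (Dn (S (S e)) z x) <= Mr) ->
  (forall x, 0 <= x <= 1 -> Rabs (Dn (S (S e)) u x) <= Mr) ->
  (forall x, 0 <= x <= 1 -> Rabs (z x) <= Md /\ Rabs (Derive_on 0 1 z x) <= Md /\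
     Rabs (Derive_on 0 1 u x) <= Md) ->
  let a := coords (energy_form mu beta b) E (pairf z u) in
  let en := rsum N (fun i => (a i - c i) * (a i - c i)) in
  let vh := lcomb N c E in
  let w := lcomb N (fun i => a i - c i) E in
  (en <= mesh P ->
   Rabs (pair_flux eps (eta_b beta b) (pairf z u) w - pair_flux eps (eta_b beta b) vh w)
   <= K * (en + (mesh P ^ S e) ^ 2)) /\
  inner (fun x => z x - fstf vh x) (fun x => z x - fstf vh x) <= C * (en + (mesh P ^ S e) ^ 2) /\
  inner (fun x => u x - sndf vh x) (fun x => u x - sndf vh x)
  + inner (Derive_on 0 1 (fun x => u x - sndf vh x)) (Derive_on 0 1 (fun x => u x - sndf vh x))
  <= C * (en + (mesh P ^ S e) ^ 2).
Proof.
intros HB HMd1 Heps HMM HMr.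
destruct (projection_error e) as [Ca [HCa Hproj]].
destruct (Sh_inverse (S e)) as [Ki [HKi Hinv]].
assert (Hal := coercive_pos mu c1 c2 (bottom_mu HB) (bottom_c1 HB) (bottom_c2 HB)).
set (al := Rmin c2 (mu / 3 * c1 ^ 3)) in *.
assert (HM0 := bottom_M_pos _ _ _ _ _ _ HB).
set (Cb := M + mu / 3 * M ^ 3).
assert (HCb : 0 <= Cb) by apply (bottom_bound_pos _ _ _ _ _ _ HB).
set (A := Ca * Mr).
assert (HA : 0 <= A) by (apply Rmult_le_pos; assumption).
(* Squared H^1 error of the elliptic projection in units of [h^(2r-2)]: the continuity constant of
   the form over its coercivity constant. *)
set (G := Cb * (2 * A ^ 2) / al).
assert (HG : 0 <= G).
{ apply Rdiv_le_0_compat; [|assumption]; apply Rmult_le_pos; [assumption|].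
  assert (H := pow2_ge_0 A); lra. }
set (ia := / al).
assert (Hia : 0 < ia) by (apply Rinv_0_lt_compat; assumption).
(* Bound for the square of [s' - u_h'], where the 3 comes from squaring a sum of three terms. [Mf]
   then bounds [u_h'] through [u'], [u' - s'] and [s' - u_h']. *)
set (L2 := Ki * q * (3 * (A ^ 2 + G + ia))).
set (Mf := Rmax Md (Md + A + (1 + L2))).
assert (HMf1 : Md <= Mf) by apply Rmax_l.
assert (HMf2 : Md + A + (1 + L2) <= Mf) by apply Rmax_r.
assert (HMf3 : 0 <= Mf ^ 3) by (apply pow_le; lra).
assert (HA2 : 0 <= A ^ 2) by apply pow2_ge_0.
assert (Hq2 : 0 <= Ki * q ^ 2) by (apply Rmult_le_pos; [assumption|apply pow2_ge_0]).
exists (18 * Mf ^ 3 * (1 + ia + G + A ^ 2 + Ki * q ^ 2)), (2 * (1 + ia + G + A ^ 2)).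
split; [apply Rmult_le_pos; lra|split; [lra|]].
intros k P N E z u c HE Hk Hq Hh1 Hz Hu U0 U1 Bz Bu Bd a en vh w.
assert (Hh := mesh_pos P).
assert (Hq0 : 0 < q).
{ assert (H := Hq O (ncells_pos P)); destruct (mesh_cell P O (ncells_pos P)).
  assert (0 < mesh P / cell P 0) by (apply Rdiv_lt_0_compat; lra); lra. }
assert (HL2 : 0 <= L2) by (repeat apply Rmult_le_pos; lra).
destruct (Hproj mu beta b c1 c2 M k P N E z u Mr HB HE Hk HMr Hz Hu U0 U1 Bz Bu) as [Erho [Esg [s [Hs Es]]]].
fold a in Erho, Esg; set (p := lcomb N a E) in *.
fold Cb in Esg; fold A in Erho, Esg, Es.
assert (HEp : forall i, (i < N)%nat -> pair_pc1 P (E i))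
  by (intros; apply (pair_basis_pc1 mu beta b (S e) k P N E); assumption).
assert (Pz : pc1 P z) by (apply (Ck_on_pc1 (S e)), Hz).
assert (Pu : pc1 P u) by (apply (Ck_on_pc1 (S e)), Hu).
assert (Vw : pair_space (S e) k P w) by (apply (pair_basis_lcomb mu beta b), HE).
assert (Vh : pair_space (S e) k P vh) by (apply (pair_basis_lcomb mu beta b), HE).
assert (Vp : pair_space (S e) k P p) by (apply (pair_basis_lcomb mu beta b), HE).
destruct Vw as [Vw1 Vw2]; destruct Vh as [Vh1 Vh2]; destruct Vp as [Vp1 Vp2].
assert (Pw1 := Sh_pc1 _ _ _ _ Vw1); assert (Pw2 := Sh0_pc1 _ _ _ _ Vw2).
assert (Ph1 := Sh_pc1 _ _ _ _ Vh1); assert (Ph2 := Sh0_pc1 _ _ _ _ Vh2).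
assert (Pp1 := Sh_pc1 _ _ _ _ Vp1); assert (Pp2 := Sh0_pc1 _ _ _ _ Vp2).
assert (Ps := Sh0_pc1 _ _ _ _ Hs).
assert (Heta := bottom_eta_pc1 _ _ _ _ _ _ P HB).
assert (Hpw : forall y, vh y = p y - w y).
{ intros y; unfold vh, p, w, lcomb.
  rewrite (rsum_ext N (fun i => (a i - c i) * E i y) (fun i => a i * E i y + -1 * (c i * E i y))) by (intros; ring).
  rewrite rsum_lin; ring. }
assert (Hen : energy_form mu beta b w w = en)
  by (apply (lcomb_energy mu beta b c1 c2 M (S e) k P); assumption).
assert (Hen0 : 0 <= en) by (apply rsum_ge0; intros; apply Rle_0_sqr).
destruct (pair_energy_split mu beta b c1 c2 M P w HB (conj Pw1 Pw2)) as [Bth Bxi].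
rewrite Hen in Bth, Bxi; fold al in Bxi.
set (rho := fun x => z x - fstf p x) in *; set (sg := fun x => u x - sndf p x) in *.
set (th := fstf w) in *; set (xi := sndf w) in *.
assert (Prho : pc1 P rho) by (unfold rho; auto with pw).
assert (Psg : pc1 P sg) by (unfold sg; auto with pw).
set (hh := (mesh P ^ S e) ^ 2).
assert (Hhh : 0 <= hh) by apply pow2_ge_0.
assert (Hpow : 0 <= mesh P ^ S e <= mesh P).
{ split; [apply pow_le; lra|]; simpl; rewrite <- (Rmult_1_r (mesh P)) at 3.
  apply Rmult_le_compat_l; [lra|]; rewrite <- (pow1 e); apply pow_incr; lra. }
assert (Hhm : hh <= mesh P) by (unfold hh; nra).
assert (Erho' : inner rho rho <= A ^ 2 * (mesh P ^ 2 * hh)).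
{ eapply Rle_trans; [exact Erho|]; right; unfold hh; simpl; ring. }
assert (Erho1 : 1 / mesh P ^ 2 * inner rho rho <= A ^ 2 * hh).
{ apply Rle_trans with (1 / mesh P ^ 2 * (A ^ 2 * (mesh P ^ 2 * hh))).
  - apply Rmult_le_compat_l; [|assumption]; apply Rlt_le, Rdiv_lt_0_compat; [lra|apply pow_lt, Hh].
  - right; field; lra. }
assert (Erho2 : inner rho rho <= A ^ 2 * hh).
{ eapply Rle_trans; [exact Erho'|]; apply Rmult_le_compat_l; [assumption|].
  rewrite <- (Rmult_1_l hh) at 2; apply Rmult_le_compat_r; [assumption|nra]. }
assert (Esg' : inner sg sg + inner (Derive_on 0 1 sg) (Derive_on 0 1 sg) <= G * hh).
{ assert (H := formA_coercive mu beta b c1 c2 M P sg HB Psg); fold al in H.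
  apply Rmult_le_reg_l with al; [assumption|].
  replace (al * (G * hh)) with (Cb * (2 * (A * mesh P ^ S e) ^ 2)) by (unfold G, hh; field; lra).
  lra. }
assert (Hsg0 : 0 <= inner sg sg) by (apply (inner_ge0 P); auto with pw).
assert (Hdsg0 : 0 <= inner (Derive_on 0 1 sg) (Derive_on 0 1 sg)) by (apply (inner_ge0 P); auto with pw).
assert (Hxi0 : 0 <= inner xi xi) by (apply (inner_ge0 P); auto with pw).
assert (Hdxi0 : 0 <= inner (Derive_on 0 1 xi) (Derive_on 0 1 xi)) by (apply (inner_ge0 P); auto with pw).
assert (Bxi' : inner xi xi + inner (Derive_on 0 1 xi) (Derive_on 0 1 xi) <= ia * en)
  by (unfold Rdiv in Bxi; fold ia in Bxi; lra).
assert (Hia_en : 0 <= ia * en) by (apply Rmult_le_pos; lra).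
assert (Hia_hh : 0 <= ia * hh) by (apply Rmult_le_pos; lra).
assert (HG_hh : 0 <= G * hh) by (apply Rmult_le_pos; lra).
assert (HG_en : 0 <= G * en) by (apply Rmult_le_pos; lra).
assert (HA_hh : 0 <= A ^ 2 * hh) by (apply Rmult_le_pos; lra).
assert (HA_en : 0 <= A ^ 2 * en) by (apply Rmult_le_pos; lra).
split; [|split].
- intros Hsmall.
  assert (Hdth := proj1 (Hinv k P q th Hq Vw1)).
  assert (Hdth' : mesh P ^ 2 * inner (Derive_on 0 1 th) (Derive_on 0 1 th) <= Ki * q ^ 2 * en).
  { eapply Rle_trans; [exact Hdth|]; apply Rmult_le_compat_l; assumption. }
  (* Unlike [u - u_h], the difference [s - u_h] lies in [S_h], so the inverse inequality applies;
     its derivative is that of [sg + xi] minus that of [u - s]. *)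
  set (y := fun x => s x + -1 * sndf vh x).
  assert (Sy : Sh (S (S e)) k P y) by (apply Sh_axpy; [apply Hs|apply Vh2]).
  assert (Hdy : forall x, off_nodes P x ->
    Derive_on 0 1 y x = Derive_on 0 1 s x - Derive_on 0 1 (sndf vh) x).
  { intros x Hx; unfold y; rewrite (Derive_on_axpy P) by assumption; ring. }
  assert (Hdvh : forall x, off_nodes P x ->
    Derive_on 0 1 (sndf vh) x = Derive_on 0 1 u x - Derive_on 0 1 sg x - Derive_on 0 1 xi x).
  { intros x Hx; assert (Hx' := off_nodes_bounds P x Hx).
    rewrite (Derive_on_ext 0 1 (sndf vh) (fun x => u x - sg x - xi x)).
    - rewrite (Derive_on_minus P (fun x => u x - sg x)), (Derive_on_minus P u) by (auto with pw); reflexivity.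
    - lra.
    - intros x' _; unfold sg, xi, sndf; rewrite Hpw; ring. }
  assert (Hy2 : inner (Derive_on 0 1 y) (Derive_on 0 1 y) <= 3 * (A ^ 2 * hh + (G * hh + ia * en))).
  { assert (Hle : inner (Derive_on 0 1 y) (Derive_on 0 1 y)
      <= int01 (fun x => 3 * (A ^ 2 * hh + (Derive_on 0 1 sg x * Derive_on 0 1 sg x
           + Derive_on 0 1 xi x * Derive_on 0 1 xi x)))).
    { apply (int01_le P).
      - assert (Py := Sh_pc1 _ _ _ _ Sy); eauto with pw.
      - assert (pwc P (Derive_on 0 1 sg)) by (auto with pw).
        assert (pwc P (Derive_on 0 1 xi)) by (auto with pw); pwc_auto.
      - intros x Hx; rewrite Hdy, Hdvh by assumption.
        assert (H1 := Es x Hx); apply Rabs_le_between in H1.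
        set (D1 := Derive_on 0 1 u x - Derive_on 0 1 s x) in *.
        replace (Derive_on 0 1 s x - (Derive_on 0 1 u x - Derive_on 0 1 sg x - Derive_on 0 1 xi x))
          with (- D1 + Derive_on 0 1 sg x + Derive_on 0 1 xi x) by (unfold D1; ring).
        assert (HD1 : D1 * D1 <= A ^ 2 * hh).
        { replace (A ^ 2 * hh) with ((A * mesh P ^ S e) * (A * mesh P ^ S e)) by (unfold hh; ring).
          apply Rsqr_le_abs_1 with (x := D1) (y := A * mesh P ^ S e).
          rewrite (Rabs_pos_eq (A * mesh P ^ S e)) by (apply Rmult_le_pos; lra).
          apply Rabs_le; assumption. }
        set (D2 := Derive_on 0 1 sg x); set (D3 := Derive_on 0 1 xi x).
        assert (0 <= (- D1 - D2) * (- D1 - D2)) by apply Rle_0_sqr.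
        assert (0 <= (- D1 - D3) * (- D1 - D3)) by apply Rle_0_sqr.
        assert (0 <= (D2 - D3) * (D2 - D3)) by apply Rle_0_sqr.
        lra. }
    eapply Rle_trans; [exact Hle|].
    assert (Q1 : pwc P (Derive_on 0 1 sg)) by (auto with pw).
    assert (Q2 : pwc P (Derive_on 0 1 xi)) by (auto with pw).
    rewrite (int01_scal P), (int01_plus P), (int01_plus P), int01_const by pwc_auto.
    change (int01 (fun x => Derive_on 0 1 sg x * Derive_on 0 1 sg x))
      with (inner (Derive_on 0 1 sg) (Derive_on 0 1 sg)).
    change (int01 (fun x => Derive_on 0 1 xi x * Derive_on 0 1 xi x))
      with (inner (Derive_on 0 1 xi) (Derive_on 0 1 xi)).
    lra. }
  (* Both [h^(2r-2)] and the energy are at most [h], which cancels exactly the factor [1 / h] in the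
     inverse inequality. *)
  assert (Hy3 : inner (Derive_on 0 1 y) (Derive_on 0 1 y) <= mesh P * (3 * (A ^ 2 + G + ia))).
  { eapply Rle_trans; [exact Hy2|].
    assert (A ^ 2 * hh <= A ^ 2 * mesh P) by (apply Rmult_le_compat_l; assumption).
    assert (G * hh <= G * mesh P) by (apply Rmult_le_compat_l; assumption).
    assert (ia * en <= ia * mesh P) by (apply Rmult_le_compat_l; lra).
    lra. }
  assert (Hyb : forall x, off_nodes P x -> Rabs (Derive_on 0 1 y x) <= 1 + L2).
  { intros x Hx; apply Rabs_le_of_sqr.
    eapply Rle_trans; [apply (proj2 (Hinv k P q y Hq Sy) x Hx)|].
    apply Rle_trans with (Ki * q / mesh P * (mesh P * (3 * (A ^ 2 + G + ia)))).
    - apply Rmult_le_compat_l; [|exact Hy3].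
      apply Rdiv_le_0_compat; [apply Rmult_le_pos; lra|assumption].
    - right; unfold L2; field; lra. }
  assert (Hduh : forall x, off_nodes P x -> Rabs (Derive_on 0 1 (sndf vh) x) <= Mf).
  { intros x Hx; assert (Hx' := off_nodes_bounds P x Hx).
    assert (H1 := Hyb x Hx); rewrite Hdy in H1 by assumption; assert (H2 := Es x Hx).
    assert (H3 := proj2 (proj2 (Bd x ltac:(lra)))).
    assert (HAh : A * mesh P ^ S e <= A * 1) by (apply Rmult_le_compat_l; lra).
    apply Rabs_le_between in H1, H2, H3; apply Rabs_le; lra. }
  (* [u_h] vanishes at 0, so the bound on its derivative over the unit interval also bounds its
     values. *)
  assert (Huh : forall x, off_nodes P x -> Rabs (sndf vh x) <= Mf).
  { intros x Hx; assert (Hx' := off_nodes_bounds P x Hx).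
    assert (H1 := pc1_lipschitz P (sndf vh) Mf ltac:(lra) Ph2 Hduh 0 x ltac:(lra) ltac:(lra) ltac:(lra)).
    rewrite (proj1 (proj2 Vh2)), Rminus_0_r, Rminus_0_r in H1.
    eapply Rle_trans; [exact H1|]; rewrite <- (Rmult_1_r Mf) at 2; apply Rmult_le_compat_l; lra. }
  assert (HF := flux_difference_bound P eps Mf (eta_b beta b) z u (fstf vh) (sndf vh) th xi Hh1
    ltac:(lra) ltac:(lra) Heta Pz Pu Ph1 Ph2 Pw1 Pw2
    (proj1 (proj2 Vh2)) (proj2 (proj2 Vh2)) (proj1 (proj2 Vw2)) (proj2 (proj2 Vw2))).
  cbv zeta in HF.
  rewrite (inner_ext01 (fun x => z x - fstf vh x - th x) (fun x => z x - fstf vh x - th x) rho rho) in HF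
    by (intros x _; unfold rho, th, fstf; rewrite Hpw; ring).
  rewrite (inner_ext01 (fun x => u x - sndf vh x - xi x) (fun x => u x - sndf vh x - xi x) sg sg) in HF
    by (intros x _; unfold sg, xi, sndf; rewrite Hpw; ring).
  assert (HDsg : forall x, 0 <= x <= 1 ->
    Derive_on 0 1 (fun x => u x - sndf vh x - xi x) x = Derive_on 0 1 sg x).
  { intros x Hx; apply Derive_on_ext; [assumption|].
    intros x' _; unfold sg, xi, sndf; rewrite Hpw; ring. }
  rewrite (inner_ext01 (Derive_on 0 1 (fun x => u x - sndf vh x - xi x))
    (Derive_on 0 1 (fun x => u x - sndf vh x - xi x)) (Derive_on 0 1 sg) (Derive_on 0 1 sg)) in HF
    by (intros; apply HDsg; assumption).
  change (pair_flux eps (eta_b beta b) (pairf z u) w) with (flux eps (eta_b beta b) z u th xi).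
  change (pair_flux eps (eta_b beta b) vh w) with (flux eps (eta_b beta b) (fstf vh) (sndf vh) th xi).
  eapply Rle_trans; [apply HF|].
  + intros x Hx; assert (Hx' := off_nodes_bounds P x Hx).
    destruct (Bd x ltac:(lra)) as [B1 [B2 B3]].
    assert (E1 := bottom_eta_ge HB x ltac:(lra)).
    assert (E2 := bottom_eta_le HB x ltac:(lra)).
    assert (E3 := bottom_deta_le HB x ltac:(lra)).
    assert (E4 := bottom_c1 HB).
    split; [split; [lra|split; lra]|split; [split; [rewrite Rabs_pos_eq|]; lra|]].
    split; [apply Huh|apply Hduh]; assumption.
  + rewrite !(Rmult_assoc (18 * Mf ^ 3)).
    apply Rmult_le_compat_l; [lra|].
    assert (0 <= Ki * q ^ 2 * hh) by (apply Rmult_le_pos; assumption).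
    lra.
- rewrite (inner_ext01 _ _ (fun x => rho x + th x) (fun x => rho x + th x))
    by (intros x _; unfold rho, th, fstf; rewrite Hpw; ring).
  eapply Rle_trans; [apply (inner_sum_le P); auto with pw|]; lra.
- assert (He : forall x, u x - sndf vh x = sg x + xi x) by (intros x; unfold sg, xi, sndf; rewrite Hpw; ring).
  rewrite (inner_ext01 _ _ (fun x => sg x + xi x) (fun x => sg x + xi x)) by (intros; apply He).
  rewrite (inner_ext_off P (Derive_on 0 1 (fun x => u x - sndf vh x))
    (fun x => Derive_on 0 1 sg x + Derive_on 0 1 xi x)).
  + assert (H1 := inner_sum_le P sg xi ltac:(auto with pw) ltac:(auto with pw)).
    assert (H2 := inner_sum_le P (Derive_on 0 1 sg) (Derive_on 0 1 xi) ltac:(auto with pw) ltac:(auto with pw)).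
    lra.
  + auto with pw.
  + intros x Hx; assert (Hx' := off_nodes_bounds P x Hx).
    rewrite (Derive_on_ext 0 1 _ (fun x => sg x + xi x)) by (intros; try apply He; lra).
    apply (Derive_on_plus P); assumption.
Qed.

Lemma quadratic_field_ext N A Q c c' i : (forall j, (j < N)%nat -> c j = c' j) ->
  quadratic_field N A Q c i = quadratic_field N A Q c' i.
Proof.
intros H; unfold quadratic_field; apply f_equal, f_equal2; apply rsum_ext; intros j Hj;
  rewrite H by assumption; [reflexivity|].
apply f_equal, rsum_ext; intros k Hk; rewrite H by assumption; reflexivity.
Qed.

Lemma continuous_on_bounded_family (T : R) (N : nat) (c : nat -> R -> R) : 0 <= T ->
  (forall i, (i < N)%nat -> continuous_on (fun t => 0 <= t <= T) (c i)) ->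
  exists M, 0 <= M /\ forall i t, (i < N)%nat -> 0 <= t <= T -> Rabs (c i t) <= M.
Proof.
intros HT; induction N as [|N IH]; intros H; [exists 0; split; [lra|intros; lia]|].
destruct IH as [M [HM0 HM]]; [intros; apply H; lia|].
destruct (continuous_on_bounded 0 T (c N) HT) as [M' [HM0' HM']]; [apply H; lia|].
exists (M + M'); split; [lra|]; intros i t Hi Ht.
destruct (Nat.eq_dec i N) as [->|Hn].
- specialize (HM' t Ht); lra.
- specialize (HM i t ltac:(lia) Ht); lra.
Qed.

(** The coordinates of any two solutions are continuous on [0, T], hence bounded. Truncated above
    both bounds, the field becomes globally Lipschitz and still has both as solutions. No smallness
    of the mesh enters. *)
Lemma semidiscrete_unique T eps mu beta b c1 c2 M zeta0 u0 d k P zh uh zh' uh' :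
  0 < T -> bottom mu beta b c1 c2 M ->
  semidiscrete_solution T eps mu beta b zeta0 u0 (S d) k P zh uh ->
  semidiscrete_solution T eps mu beta b zeta0 u0 (S d) k P zh' uh' ->
  forall x t, 0 <= x <= 1 -> 0 <= t <= T -> zh' x t = zh x t /\ uh' x t = uh x t.
Proof.
intros HT HB S1 S2; destruct (pair_space_basis mu beta b c1 c2 M d k P HB) as [N [E HE]].
destruct (semidiscrete_coords T eps mu beta b c1 c2 M zeta0 u0 d k P N E zh uh HT HB HE S1) as [D1 [I1 E1]].
destruct (semidiscrete_coords T eps mu beta b c1 c2 M zeta0 u0 d k P N E zh' uh' HT HB HE S2) as [D2 [I2 E2]].
set (c := fun i t => energy_form mu beta b (slice zh uh t) (E i)) in *.
set (c' := fun i t => energy_form mu beta b (slice zh' uh' t) (E i)) in *.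
change (forall t, 0 <= t <= T -> same01 (slice zh uh t) (lcomb N (fun i => c i t) E)) in E1.
change (forall t, 0 <= t <= T -> same01 (slice zh' uh' t) (lcomb N (fun i => c' i t) E)) in E2.
assert (C1 : forall i, (i < N)%nat -> continuous_on (fun t => 0 <= t <= T) (c i)).
{ intros i Hi; apply (is_derive_on_continuous 0 T (c i) _ HT (fun t Ht => D1 i t Hi Ht)). }
assert (C2 : forall i, (i < N)%nat -> continuous_on (fun t => 0 <= t <= T) (c' i)).
{ intros i Hi; apply (is_derive_on_continuous 0 T (c' i) _ HT (fun t Ht => D2 i t Hi Ht)). }
destruct (continuous_on_bounded_family T N c ltac:(lra) C1) as [M1 [M10 B1]].
destruct (continuous_on_bounded_family T N c' ltac:(lra) C2) as [M2 [M20 B2]].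
set (Mb := M1 + M2).
destruct (truncated_field_lipschitz N (fun j i => pair_flux_lin (eta_b beta b) (E j) (E i))
    (fun j k i => pair_flux_quad eps (eta_b beta b) (E j) (E k) (E i)) Mb) as [L [HL0 [_ HL]]];
  [unfold Mb; lra|].
assert (Hcc : forall i t, (i < N)%nat -> 0 <= t <= T -> c i t = c' i t).
{ apply (ode_unique N (fun y i => galerkin_field eps beta b N E (fun j => clamp (- Mb) Mb (y j)) i) L T c c');
    try assumption.
  - intros i Hi; exact (eq_trans (I1 i Hi) (eq_sym (I2 i Hi))).
  - intros i t Hi Ht; apply (is_derive_on_interior 0 T); [assumption|].
    unfold galerkin_field; rewrite (quadratic_field_ext N _ _ _ (fun j => c j t)).
    + apply D1; [assumption|lra].
    + intros j Hj; apply clamp_id, Rabs_le_between; assert (H := B1 j t Hj ltac:(lra)); unfold Mb; lra.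
  - intros i t Hi Ht; apply (is_derive_on_interior 0 T); [assumption|].
    unfold galerkin_field; rewrite (quadratic_field_ext N _ _ _ (fun j => c' j t)).
    + apply D2; [assumption|lra].
    + intros j Hj; apply clamp_id, Rabs_le_between; assert (H := B2 j t Hj ltac:(lra)); unfold Mb; lra. }
intros x t Hx Ht.
assert (Hl : lcomb N (fun i => c' i t) E = lcomb N (fun i => c i t) E).
{ apply lcomb_ext; intros i Hi; symmetry; apply Hcc; assumption. }
assert (H1 := E1 t Ht (true, x) Hx); assert (H2 := E2 t Ht (true, x) Hx).
assert (H3 := E1 t Ht (false, x) Hx); assert (H4 := E2 t Ht (false, x) Hx).
rewrite Hl in H2, H4; rewrite <- H1 in H2; rewrite <- H3 in H4; split; assumption.
Qed.

(* The order m of smoothness required of (zeta, u) depends only on r. *)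
Theorem theorem2p1 (r : nat) (Hr : (2 <= r)%nat) :
  exists m : nat,
  forall (T eps mu beta : R) (b : R -> R) (c1 c2 : R)
         (zeta0 u0 : R -> R) (zeta u : R -> R -> R) (k : nat) (q : R),
    0 < T -> 0 < eps -> 0 < mu -> 0 < beta ->
    Ck_on 2 0 1 b ->
    0 < c1 -> 0 < c2 ->
    (forall x, 0 <= x <= 1 -> c1 <= eta_b beta b x) ->
    (forall x, 0 <= x <= 1 -> c2 <= mass_coef mu beta b x) ->
    Cm_rect m T zeta -> Cm_rect m T u ->
    (forall x t, 0 <= x <= 1 -> 0 <= t <= T ->
       0 < eps * zeta x t + eta_b beta b x) ->
    ibvp_solution T eps mu beta b zeta0 u0 zeta u ->
    (k <= r - 2)%nat ->
    exists h0 C : R, 0 < h0 /\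
    forall P : partition,
      quasiuniform q P -> mesh P <= h0 ->
      exists zh uh : R -> R -> R,
        semidiscrete_solution T eps mu beta b zeta0 u0 r k P zh uh /\
        (forall zh' uh' : R -> R -> R,
           semidiscrete_solution T eps mu beta b zeta0 u0 r k P zh' uh' ->
           forall x t, 0 <= x <= 1 -> 0 <= t <= T ->
             zh' x t = zh x t /\ uh' x t = uh x t) /\
        (forall t, 0 <= t <= T ->
           normL2 (fun x => zeta x t - zh x t)
           + normH1 (fun x => u x t - uh x t) <= C * mesh P ^ (r - 1)).
Proof.
(* With [r = e + 2], the order [m = r + 1] covers the [r] derivatives in [x] used for approximation
   and the order 3 used for the weak form and for differentiating the energy. *)
destruct r as [|[|e]]; [lia|lia|]; exists (S (S (S e))).
intros T eps mu beta b c1 c2 zeta0 u0 zeta u k q HT Heps Hmu Hbeta Hb Hc1 Hc2 He1 He2 Hz Hu _ Hpde Hk.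
replace (S (S e) - 2)%nat with e in Hk by lia; replace (S (S e) - 1)%nat with (S e) by lia.
destruct (bottom_exists mu beta b c1 c2 Hmu Hc1 Hc2 Hb He1 He2) as [M HB].
assert (Hz3 : Cm_rect 3 T zeta) by (apply (Cm_rect_le 3 (S (S (S e)))); [lia|assumption]).
assert (Hu3 : Cm_rect 3 T u) by (apply (Cm_rect_le 3 (S (S (S e)))); [lia|assumption]).
assert (Hz2 : Cm_rect 2 T zeta) by (apply (Cm_rect_le 2 3); [lia|assumption]).
assert (Hu2 : Cm_rect 2 T u) by (apply (Cm_rect_le 2 3); [lia|assumption]).
assert (Hzr : Cm_rect (S (S e)) T zeta) by (apply (Cm_rect_le _ (S (S (S e)))); [lia|assumption]).
assert (Hur : Cm_rect (S (S e)) T u) by (apply (Cm_rect_le _ (S (S (S e)))); [lia|assumption]).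
destruct (Cm_rect_Dn_bounded _ T zeta HT Hzr) as [Mz [Mz0 Bz]].
destruct (Cm_rect_Dn_bounded _ T u HT Hur) as [Mu [Mu0 Bu]].
destruct (continuous_rect_bounded T zeta HT (Cm_rect_continuous _ _ _ Hz)) as [N1 [N10 B1]].
destruct (continuous_rect_bounded T (Dx zeta) HT (Cm_rect_continuous _ _ _ (Cm_rect_Dx _ _ _ Hz))) as [N2 [N20 B2]].
destruct (continuous_rect_bounded T u HT (Cm_rect_continuous _ _ _ Hu)) as [N3 [N30 B3]].
destruct (continuous_rect_bounded T (Dx u) HT (Cm_rect_continuous _ _ _ (Cm_rect_Dx _ _ _ Hu))) as [N4 [N40 B4]].
assert (HM0 := bottom_M_pos _ _ _ _ _ _ HB).
set (Md := 1 + eps + M + N1 + N2 + N3 + N4).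
destruct (galerkin_rate_bound e mu beta b c1 c2 M q eps Md (Mz + Mu) HB) as [K [C [HK0 [HC0 Hrate]]]];
  [unfold Md; lra|rewrite Rabs_pos_eq; unfold Md; lra|unfold Md; lra|lra|].
set (Cb := M + mu / 3 * M ^ 3).
assert (HCb : 0 <= Cb) by apply (bottom_bound_pos _ _ _ _ _ _ HB).
(* The factor 2 comes from differentiating squares; [Eg] is the growth allowed by Gronwall over
   [0, T]. *)
set (Kg := 2 * K); set (Eg := exp (Kg * T)).
assert (HEg : 0 < Eg) by apply exp_pos.
(* Truncation level, independent of the partition: the squared coordinates of the exact solution are
   bounded by its energy, hence their size by [Mc - 1], and those of the Galerkin solution deviate
   by at most 1 while the energy of the difference is at most [h <= 1]. *)
set (Mc := 2 + (Md ^ 2 + Cb * (2 * Md ^ 2))).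
assert (HMc : 2 <= Mc).
{ assert (0 <= Md ^ 2) by apply pow2_ge_0; assert (0 <= Cb * (2 * Md ^ 2)) by (apply Rmult_le_pos; lra).
  unfold Mc; lra. }
(* [h * Eg <= 1/2] keeps the Gronwall bound [h^(2r-2) * Eg <= h * (h * Eg)] strictly below the level
   [h]. The 2 in the second constant adds the two norms. *)
exists (Rmin 1 (/ (2 * Eg))), (2 * sqrt (C * (Eg + 1))); split.
{ apply Rmin_glb_lt; [lra|apply Rinv_0_lt_compat; lra]. }
intros P Hq Hmesh.
assert (Hh := mesh_pos P).
assert (Hh1 : mesh P <= 1) by (eapply Rle_trans; [exact Hmesh|apply Rmin_l]).
assert (Hh2 : mesh P * Eg < 1).
{ assert (H : mesh P <= / (2 * Eg)) by (eapply Rle_trans; [exact Hmesh|apply Rmin_r]).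
  apply Rmult_le_compat_r with (r := Eg) in H; [|lra].
  replace (/ (2 * Eg) * Eg) with (1 / 2) in H by (field; lra); lra. }
destruct (pair_space_basis mu beta b c1 c2 M (S e) k P HB) as [N [E HE]].
assert (HEp : forall i, (i < N)%nat -> pair_pc1 P (E i))
  by (intros; apply (pair_basis_pc1 mu beta b (S e) k P N E); assumption).
set (hh := (mesh P ^ S e) ^ 2).
assert (Hpow : 0 <= mesh P ^ S e <= mesh P).
{ split; [apply pow_le; lra|]; simpl; rewrite <- (Rmult_1_r (mesh P)) at 3.
  apply Rmult_le_compat_l; [lra|]; rewrite <- (pow1 e); apply pow_incr; lra. }
assert (Hhh0 : 0 <= hh) by apply pow2_ge_0.
assert (Hhh : hh <= mesh P * mesh P) by (unfold hh; nra).
set (a := fun i t => energy_form mu beta b (slice zeta u t) (E i)).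
destruct (truncated_field_lipschitz N (fun j i => pair_flux_lin (eta_b beta b) (E j) (E i))
    (fun j k i => pair_flux_quad eps (eta_b beta b) (E j) (E k) (E i)) Mc) as [L [HL0 [HLb HLl]]]; [lra|].
(* The initial values are the coordinates of the projected initial data, so the energy of the
   difference starts at zero. *)
destruct (picard_lindeloef N (fun y i => galerkin_field eps beta b N E (fun j => clamp (- Mc) Mc (y j)) i)
    L L (fun i => a i 0) HLb HLl HL0 HL0) as [c Hc].
set (En := fun t => rsum N (fun i => (a i t - c i t) * (a i t - c i t))).
assert (HEn0 : forall t, 0 <= En t) by (intros; apply rsum_ge0; intros; apply Rle_0_sqr).
assert (HEnstart : En 0 = 0).
{ unfold En; rewrite (rsum_ext N _ (fun _ => 0)), rsum_const; [ring|].
  intros i Hi; rewrite (proj1 (Hc i Hi)); ring. }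
assert (Hslice : forall t, 0 <= t <= T -> pair_pc1 P (slice zeta u t)).
{ intros t Ht; split; [apply (Cm_rect_slice_pc1 2 T zeta)|apply (Cm_rect_slice_pc1 2 T u)]; assumption. }
assert (Hab : forall i t, (i < N)%nat -> 0 <= t <= T -> Rabs (a i t) <= Mc - 1).
{ intros i t Hi Ht; destruct (Hslice t Ht) as [Q1 Q2].
  assert (HI := energy_inner_space mu beta b c1 c2 M P HB).
  assert (Hv : energy_form mu beta b (slice zeta u t) (slice zeta u t) <= Md ^ 2 + Cb * (2 * Md ^ 2)).
  { unfold energy_form; apply Rplus_le_compat.
    - apply (inner_sqr_le P); [auto with pw|unfold Md; lra|].
      intros x Hx; apply off_nodes_bounds in Hx.
      eapply Rle_trans; [apply (B1 x t); lra|unfold Md; lra].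
    - eapply Rle_trans; [apply (formA_bounded mu beta b c1 c2 M P); assumption|].
      apply Rmult_le_compat_l; [exact HCb|].
      assert (H1 : inner (sndf (slice zeta u t)) (sndf (slice zeta u t)) <= Md ^ 2).
      { apply (inner_sqr_le P); [auto with pw|unfold Md; lra|].
        intros x Hx; apply off_nodes_bounds in Hx.
        eapply Rle_trans; [apply (B3 x t); lra|unfold Md; lra]. }
      assert (H2 : inner (Derive_on 0 1 (sndf (slice zeta u t))) (Derive_on 0 1 (sndf (slice zeta u t))) <= Md ^ 2).
      { apply (inner_sqr_le P); [auto with pw|unfold Md; lra|].
        intros x Hx; apply off_nodes_bounds in Hx.
        eapply Rle_trans; [apply (B4 x t); lra|unfold Md; lra]. }
      lra. }
  (* Bessel's inequality for one basis element: the square of [v - a E_i] is nonnegative. *)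
  assert (Hbes : a i t ^ 2 <= energy_form mu beta b (slice zeta u t) (slice zeta u t)).
  { assert (Hx : pair_pc1 P (fun p => slice zeta u t p + - a i t * E i p))
      by (apply pair_pc1_axpy; [split; assumption|apply HEp, Hi]).
    assert (H := inner_space_ge0 _ _ HI _ Hx).
    rewrite (inner_space_lin _ _ HI) in H by (first [assumption|apply HEp, Hi|split; assumption]).
    rewrite (inner_space_sym _ _ HI (slice zeta u t) (fun p => _)), (inner_space_sym _ _ HI (E i)) in H
      by (first [assumption|apply HEp, Hi|split; assumption]).
    rewrite !(inner_space_lin _ _ HI) in H by (first [assumption|apply HEp, Hi|split; assumption]).
    rewrite (inner_space_sym _ _ HI (E i) (slice zeta u t)) in H by (first [apply HEp, Hi|split; assumption]).
    fold (a i t) in H.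
    assert (HEE : energy_form mu beta b (E i) (E i) = 1).
    { rewrite (proj2 (proj1 HE) i i Hi Hi); unfold delta; destruct (Nat.eq_dec i i); [reflexivity|congruence]. }
    rewrite HEE in H; lra. }
  eapply Rle_trans; [apply Rabs_le_of_sqr; eapply Rle_trans; [exact Hbes|exact Hv]|unfold Mc; lra]. }
(* While the energy is at most [h], truncation does not alter the coordinates. *)
assert (Hcb : forall t, 0 <= t <= T -> En t <= mesh P -> forall i, (i < N)%nat ->
  clamp (- Mc) Mc (c i t) = c i t).
{ intros t Ht Hen i Hi; apply clamp_id.
  assert (H1 := rsum_term_le N (fun i => (a i t - c i t) * (a i t - c i t)) i
    ltac:(intros; apply Rle_0_sqr) Hi); cbv beta in H1; fold (En t) in H1.
  assert (H2 := Hab i t Hi Ht); apply Rabs_le_between in H2.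
  assert (H3 : -1 <= a i t - c i t <= 1) by (split; nra); lra. }
assert (Hode : forall i t, (i < N)%nat -> 0 <= t <= T -> En t <= mesh P ->
  is_derive (c i) t (galerkin_field eps beta b N E (fun j => c j t) i)).
{ intros i t Hi Ht Hen; assert (H := proj2 (Hc i Hi) t (proj1 Ht)); revert H.
  unfold galerkin_field; rewrite (quadratic_field_ext N _ _ _ (fun j => c j t)); [auto|].
  intros j Hj; apply Hcb; assumption. }
assert (Hslice_data : forall t, 0 <= t <= T ->
  let en := En t in
  let vh := lcomb N (fun i => c i t) E in
  let w := lcomb N (fun i => a i t - c i t) E in
  (en <= mesh P ->
   Rabs (pair_flux eps (eta_b beta b) (slice zeta u t) w - pair_flux eps (eta_b beta b) vh w) <= K * (en + hh)) /\
  inner (fun x => zeta x t - fstf vh x) (fun x => zeta x t - fstf vh x) <= C * (en + hh) /\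
  inner (fun x => u x t - sndf vh x) (fun x => u x t - sndf vh x)
  + inner (Derive_on 0 1 (fun x => u x t - sndf vh x)) (Derive_on 0 1 (fun x => u x t - sndf vh x))
  <= C * (en + hh)).
{ intros t Ht; apply (Hrate k P N E (fun x => zeta x t) (fun x => u x t) (fun i => c i t)); try assumption.
  - apply (Cm_rect_slice _ T); assumption.
  - apply (Cm_rect_slice _ T); assumption.
  - apply Hpde, Ht.
  - apply Hpde, Ht.
  - intros x Hx; specialize (Bz x t Hx Ht); lra.
  - intros x Hx; specialize (Bu x t Hx Ht); lra.
  - intros x Hx; specialize (B1 x t Hx Ht); specialize (B2 x t Hx Ht); specialize (B4 x t Hx Ht).
    unfold Dx in B2, B4; unfold Md; split; [lra|split; lra]. }
set (da := fun i t => energy_form mu beta b (slice (Dt T zeta) (Dt T u) t) (E i)).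
set (G := fun i t => galerkin_field eps beta b N E (fun j => clamp (- Mc) Mc (c j t)) i).
(* The barrier level is [mesh P]: below it the truncation is inactive and the bound on the flux
   difference is available. *)
assert (Hgron : forall t, 0 <= t <= T -> En t + hh <= (En 0 + hh) * exp (Kg * t)).
{ apply (gronwall_barrier En (fun t => rsum N (fun i => 2 * (a i t - c i t) * (da i t - G i t))) T Kg hh (mesh P)).
  - assumption.
  - unfold Kg; lra.
  - lra.
  - apply continuous_on_rsum; [lra|]; intros i Hi; apply continuous_on_sqr_minus; [lra| |].
    + apply (energy_form_slice_continuous mu beta b c1 c2 M P); try assumption; [|apply HEp, Hi].
      apply (Cm_rect_le 1 2); [lia|assumption].
    + apply (is_derive_on_continuous 0 T (c i) (G i) HT); intros t Ht.
      apply is_derive_is_derive_on; [assumption|assumption|]; apply (proj2 (Hc i Hi)); lra.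
  - intros t Ht; apply (is_derive_rsum N (fun i t => (a i t - c i t) * (a i t - c i t))
      (fun i t => 2 * (a i t - c i t) * (da i t - G i t))).
    intros i Hi; apply is_derive_sqr_minus; [|apply (proj2 (Hc i Hi)); lra].
    apply (energy_form_slice_derive mu beta b c1 c2 M P); try assumption; apply HEp, Hi.
  - intros t Ht Hen.
    assert (Ht' : 0 <= t <= T) by lra.
    destruct (Hslice_data t Ht') as [Hr1 _]; specialize (Hr1 Hen).
    set (vh := lcomb N (fun i => c i t) E) in *; set (w := lcomb N (fun i => a i t - c i t) E) in *.
    (* Exact and Galerkin coordinates both have minus the flux tested with [E i] as derivative;
       summed against [a i - c i] this tests the difference of the fluxes with [w]. *)
    assert (Hsum : rsum N (fun i => 2 * (a i t - c i t) * (da i t - G i t))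
      = - 2 * (pair_flux eps (eta_b beta b) (slice zeta u t) w - pair_flux eps (eta_b beta b) vh w)).
    { unfold w; rewrite !(pair_flux_lcomb_test P) by
        (first [assumption|apply (bottom_eta_pc1 mu beta b c1 c2 M), HB|apply Hslice, Ht'
               |apply pair_pc1_lcomb; assumption]).
      rewrite (rsum_ext N (fun i => 2 * (a i t - c i t) * (da i t - G i t))
        (fun i => -2 * ((a i t - c i t) * pair_flux eps (eta_b beta b) (slice zeta u t) (E i)
          + -1 * ((a i t - c i t) * pair_flux eps (eta_b beta b) vh (E i))))).
      - rewrite rsum_scal, rsum_lin; ring.
      - intros i Hi.
        assert (HG : G i t = - pair_flux eps (eta_b beta b) vh (E i)).
        { unfold vh; rewrite <- (galerkin_field_flux eps mu beta b c1 c2 M (S e) k P) by assumption.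
          apply quadratic_field_ext; intros j Hj; apply Hcb; assumption. }
        assert (Hda : da i t = - pair_flux eps (eta_b beta b) (slice zeta u t) (E i)).
        { assert (Hi0 := proj2 (proj1 (proj1 HE) i Hi)).
          assert (H := ibvp_weak_form mu beta b c1 c2 M P T eps zeta0 u0 zeta u t (E i) HB HT Hz3 Hu3 Hpde Ht'
            (HEp i Hi) (proj1 (proj2 Hi0)) (proj2 (proj2 Hi0))).
          unfold da; lra. }
        rewrite HG, Hda; ring. }
    rewrite Hsum; apply Rabs_le_between in Hr1; unfold Kg; lra.
  - rewrite HEnstart, Rplus_0_l; fold Eg.
    assert (hh * Eg <= mesh P * mesh P * Eg) by (apply Rmult_le_compat_r; lra).
    assert (mesh P * (mesh P * Eg) < mesh P * 1) by (apply Rmult_lt_compat_l; lra); lra. }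
assert (HEn : forall t, 0 <= t <= T -> En t + hh <= hh * Eg).
{ intros t Ht; eapply Rle_trans; [apply Hgron, Ht|]; rewrite HEnstart, Rplus_0_l.
  apply Rmult_le_compat_l; [assumption|]; unfold Eg.
  assert (HKt : Kg * t <= Kg * T) by (apply Rmult_le_compat_l; unfold Kg; lra).
  destruct HKt as [H|H]; [apply Rlt_le, exp_increasing, H|rewrite H; lra]. }
(* The energy stays within the level on all of [0, T], so the solution of the truncated system
   solves the Galerkin system itself. *)
assert (HEnh : forall t, 0 <= t <= T -> En t <= mesh P).
{ intros t Ht; specialize (HEn t Ht).
  assert (hh * Eg <= mesh P * mesh P * Eg) by (apply Rmult_le_compat_r; lra).
  assert (mesh P * (mesh P * Eg) <= mesh P * 1) by (apply Rmult_le_compat_l; lra); lra. }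
set (zh := fun x t => lcomb N (fun i => c i t) E (true, x)).
set (uh := fun x t => lcomb N (fun i => c i t) E (false, x)).
assert (H00 : forall x, 0 <= x <= 1 -> zeta x 0 = zeta0 x /\ u x 0 = u0 x) by apply Hpde.
assert (Hs0 : same01 (slice zeta u 0) (pairf zeta0 u0)) by (intros [[] x] Hx; apply (H00 x Hx)).
assert (Hsemi : semidiscrete_solution T eps mu beta b zeta0 u0 (S (S e)) k P zh uh).
{ apply (galerkin_semidiscrete T eps mu beta b c1 c2 M); try assumption.
  - destruct (Hslice 0 ltac:(lra)) as [Q1 Q2]; split.
    + apply (pc1_ext P (fun x => zeta x 0)); [intros; apply H00; assumption|assumption].
    + apply (pc1_ext P (fun x => u x 0)); [intros; apply H00; assumption|assumption].
  - intros i t Hi Ht; apply is_derive_is_derive_on; [assumption|assumption|].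
    apply Hode; [assumption|assumption|apply HEnh, Ht].
  - intros i Hi; rewrite (proj1 (Hc i Hi)); apply energy_form_ext; [exact Hs0|apply same01_refl]. }
exists zh, uh; split; [exact Hsemi|split].
- intros zh' uh' Hsemi'.
  apply (semidiscrete_unique T eps mu beta b c1 c2 M zeta0 u0 (S e) k P); assumption.
- intros t Ht; destruct (Hslice_data t Ht) as [_ [Hr2 Hr3]]; specialize (HEn t Ht).
  assert (HCE : 0 <= C * (Eg + 1)) by (apply Rmult_le_pos; lra).
  assert (Hfin : C * (En t + hh) <= C * (Eg + 1) * hh).
  { rewrite Rmult_assoc; apply Rmult_le_compat_l; [assumption|lra]. }
  assert (Hsq : sqrt (C * (Eg + 1) * hh) = sqrt (C * (Eg + 1)) * mesh P ^ S e).
  { rewrite sqrt_mult by assumption; unfold hh; rewrite sqrt_pow2 by apply Hpow; reflexivity. }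
  assert (H1 : normL2 (fun x => zeta x t - zh x t) <= sqrt (C * (Eg + 1)) * mesh P ^ S e).
  { rewrite <- Hsq; apply sqrt_le_1_alt; eapply Rle_trans; [exact Hr2|exact Hfin]. }
  assert (H2 : normH1 (fun x => u x t - uh x t) <= sqrt (C * (Eg + 1)) * mesh P ^ S e).
  { rewrite <- Hsq; apply sqrt_le_1_alt; eapply Rle_trans; [exact Hr3|exact Hfin]. }
  lra.
Qed.
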